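(* Let $M$ be a contact sub-Riemannian manifold and $q\in M$. Denote by $(x,z)$ Darboux's coordinates on a neighbourhood $U$ of $q$ (centred at $q$). There exist constants $C(q), R(q)$ such that, for the generic $p=(x,z)\in U$ (that is, for all $p\in U$ outside a set of measure zero), $$\liminf_{\epsilon\to0}\nu(\delta_\epsilon(p))\ \ge\ C(q)\frac{|z|}{\|x\|^2}+R(q).$$
   Context: A contact sub-Riemannian manifold is a connected $(2n+1)$-dimensional manifold $M$ with a rank $2n$ distribution $\mathcal D\subset TM$, locally $\mathcal D=\ker\alpha$ for a one-form $\alpha$ with $d\alpha|_{\mathcal D}$ non-degenerate, and a smooth metric on $\mathcal D$. A geodesic is a non-constant Lipschitz curve $\gamma:[0,1]\to M$, tangent to $\mathcal D$ a.e., which is locally a minimizer of the energy $\frac12\int\|\dot\gamma\|^2dt$ between its endpoints. Darboux's coordinates near $q$ are local coordinates $(x,z)\in\mathbb{R}^{2n}\times\mathbb{R}$ centred at $q$ in which the contact form is $\alpha=-dz+\frac12\sum_{i,j=1}^{2n}J_{ij}x_i\,dx_j$ with $J=\begin{pmatrix}0&\mathbb{1}_n\\-\mathbb{1}_n&0\end{pmatrix}$, where $\mathbb{1}_n$ is the $n\times n$ identity matrix. In these coordinates $\delta_\epsilon(x,z)=(\epsilon x,\epsilon^2z)$, $\epsilon>0$. $\nu(p)$ is the number of (local) geodesics joining $q$ and $p$, i.e. geodesics whose image is contained in the coordinate chart $U$. *)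

(* Defs.v *)
From HB Require Import structures.
From mathcomp Require Import all_boot all_order all_algebra.
From mathcomp Require Import all_classical all_reals all_analysis.

Set Implicit Arguments.
Unset Strict Implicit.
Unset Printing Implicit Defensive.

Import Order.TTheory GRing.Theory Num.Theory.
Import numFieldNormedType.Exports.

Local Open Scope classical_set_scope.
Local Open Scope ring_scope.

Definition dotv (R : realType) (N : nat) (u v : 'rV[R]_N) : R :=
  (u *m v^T) 0 0.

(* The library norm on row vectors is the sup norm, hence this definition. *)
Definition sqnorm (R : realType) (N : nat) (u : 'rV[R]_N) : R := dotv u u.

Fixpoint Ck_on (R : realType) (V W : normedModType R) (k : nat)
    (U : set V) (f : V -> W) : Prop :=
  (forall x, U x -> {for x, continuous f}) /\
  (if k is k'.+1 then
     forall v, (forall x, U x -> derivable f x v) /\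
               Ck_on k' U (fun x => 'D_v f x)
   else True).

Definition smooth_on (R : realType) (V W : normedModType R)
    (U : set V) (f : V -> W) : Prop := forall k, Ck_on k U f.

(* Lebesgue-null subsets of R^N: the library has no Lebesgue measure on R^N
   for variable N. *)
Definition measure_zero (R : realType) (N : nat) (Z : set 'rV[R]_N) : Prop :=
  forall e : R, 0 < e ->
  exists a b : nat -> 'rV[R]_N,
    [/\ forall k i, a k 0 i <= b k 0 i,
        forall p, Z p -> exists k, forall i, a k 0 i <= p 0 i <= b k 0 i
      & (\sum_(0 <= k <oo) (\prod_i (b k 0 i - a k 0 i))%:E <= e%:E)%E].

(* [chart_map] is meaningful only on [chart_dom] and [chart_inv] only on
   [chart_img]. *)
Record chart (R : realType) (N : nat) (M : topologicalType) := Chart {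
  chart_dom : set M ;
  chart_map : M -> 'rV[R]_N ;
  chart_inv : 'rV[R]_N -> M ;
  chart_dom_open : open chart_dom ;
  chart_img_open : open (chart_map @` chart_dom) ;
  chart_mapK : forall m, chart_dom m -> chart_inv (chart_map m) = m ;
  chart_map_continuous :
    forall m, chart_dom m -> {for m, continuous chart_map} ;
  chart_inv_continuous :
    forall m, chart_dom m -> {for chart_map m, continuous chart_inv}
}.

Definition chart_img (R : realType) (N : nat) (M : topologicalType)
    (c : chart R N M) : set 'rV[R]_N := chart_map c @` chart_dom c.

Definition transition (R : realType) (N : nat) (M : topologicalType)
    (c c' : chart R N M) : 'rV[R]_N -> 'rV[R]_N :=
  chart_map c' \o chart_inv c.

Definition overlap (R : realType) (N : nat) (M : topologicalType)
    (c c' : chart R N M) : set 'rV[R]_N :=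
  chart_map c @` (chart_dom c `&` chart_dom c').

Definition compatible (R : realType) (N : nat) (M : topologicalType)
    (c c' : chart R N M) : Prop :=
  smooth_on (overlap c c') (transition c c') /\
  smooth_on (overlap c' c) (transition c' c).

(* [atlas] is a maximal atlas; [chart_at] selects one chart around each
   point, used only to evaluate quantities that do not depend on the chart. *)
Record connected_manifold (R : realType) (N : nat) (M : topologicalType) :=
  ConnectedManifold {
  atlas : set (chart R N M) ;
  chart_at : M -> chart R N M ;
  manifold_hausdorff : hausdorff_space M ;
  manifold_second_countable : @second_countable M ;
  manifold_connected : connected [set: M] ;
  chart_at_atlas : forall m, atlas (chart_at m) ;
  chart_at_dom : forall m, chart_dom (chart_at m) m ;
  atlas_compatible : forall c c', atlas c -> atlas c' -> compatible c c' ;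
  atlas_maximal :
    forall c, (forall c', atlas c' -> compatible c c') -> atlas c
}.

(* Exterior derivative of the one-form with components [a] at [p]. *)
Definition ext_deriv (R : realType) (N : nat) (a : 'rV[R]_N -> 'rV[R]_N)
    (p u v : 'rV[R]_N) : R :=
  'D_u (fun y => dotv (a y) v) p - 'D_v (fun y => dotv (a y) u) p.

(* Tangent vectors are handled through their components in the charts of the
   maximal atlas: [dist c p] is the fibre of the distribution and [metric c p]
   the inner product on it, at the point of coordinates [p] in the chart [c],
   subject to the tensorial transformation laws.  Only the values of
   [metric c p] on [dist c p] matter. *)
Record contact_subriemannian (R : realType) (n : nat) (M : topologicalType)
    (A : connected_manifold R (n + n + 1) M) := ContactSubriemannian {
  dist : chart R (n + n + 1) M -> 'rV[R]_(n + n + 1) ->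
    set 'rV[R]_(n + n + 1) ;
  metric : chart R (n + n + 1) M -> 'rV[R]_(n + n + 1) ->
    'rV[R]_(n + n + 1) -> 'rV[R]_(n + n + 1) -> R ;
  dist_transition : forall c c' p v, atlas A c -> atlas A c' ->
    overlap c c' p ->
    dist c p v <-> dist c' (transition c c' p) ('D_v (transition c c') p) ;
  dist_contact : forall m : M, exists c a,
    [/\ atlas A c, chart_dom c m, smooth_on (chart_img c) a
      & forall p, chart_img c p ->
        [/\ a p != 0,
            forall v, dist c p v <-> dotv (a p) v = 0
          & forall u, dist c p u ->
              (forall v, dist c p v -> ext_deriv a p u v = 0) -> u = 0]] ;
  metric_transition : forall c c' p u v, atlas A c -> atlas A c' ->
    overlap c c' p -> dist c p u -> dist c p v ->
    metric c p u v =
    metric c' (transition c c' p) ('D_u (transition c c') p)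
                                  ('D_v (transition c c') p) ;
  metric_linear : forall c p k u v w, atlas A c -> chart_img c p ->
    dist c p u -> dist c p v -> dist c p w ->
    metric c p (k *: u + v) w = k * metric c p u w + metric c p v w ;
  metric_sym : forall c p u v, atlas A c -> chart_img c p ->
    dist c p u -> dist c p v -> metric c p u v = metric c p v u ;
  metric_pos : forall c p u, atlas A c -> chart_img c p ->
    dist c p u -> u != 0 -> 0 < metric c p u u ;
  metric_smooth : forall c W (X Y : 'rV[R]_(n + n + 1) -> 'rV[R]_(n + n + 1)),
    atlas A c -> open W -> W `<=` chart_img c ->
    smooth_on W X -> smooth_on W Y ->
    (forall p, W p -> dist c p (X p) /\ dist c p (Y p)) ->
    smooth_on W (fun p => metric c p (X p) (Y p) : R^o)
}.

Section geodesics.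
Context {R : realType} {n : nat} {M : topologicalType}
  {A : connected_manifold R (n + n + 1) M}.
Variable S : contact_subriemannian A.

Definition velocity (c : chart R (n + n + 1) M) (g : R -> M) (t : R) :
    'rV[R]_(n + n + 1) :=
  'D_1 (chart_map c \o g : R^o -> 'rV[R]_(n + n + 1)) t.

(* On a compact interval this is the Lipschitz property for the distance of
   any Riemannian metric on [M]. *)
Definition lipschitz_curve (a b : R) (g : R -> M) : Prop :=
  forall t, a <= t <= b ->
  exists c (B : set R) (k : R),
    [/\ atlas A c, nbhs t B,
        forall s, B s -> a <= s <= b -> chart_dom c (g s)
      & forall s s', B s -> B s' -> a <= s <= b -> a <= s' <= b ->
          `|chart_map c (g s) - chart_map c (g s')| <= k * `|s - s'|].

Definition ae_tangent (a b : R) (g : R -> M) : Prop :=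
  {ae lebesgue_measure, forall t : R, a < t < b ->
    forall c, atlas A c -> chart_dom c (g t) ->
      derivable (chart_map c \o g : R^o -> 'rV[R]_(n + n + 1)) t 1 /\
      dist S c (chart_map c (g t)) (velocity c g t)}.

Definition horizontal (a b : R) (g : R -> M) : Prop :=
  lipschitz_curve a b g /\ ae_tangent a b g.

Definition sqspeed (g : R -> M) (t : R) : R :=
  let c := chart_at A (g t) in
  metric S c (chart_map c (g t)) (velocity c g t) (velocity c g t).

Definition energy (a b : R) (g : R -> M) : \bar R :=
  (2^-1%:E * \int[lebesgue_measure]_(t in `]a, b[) (sqspeed g t)%:E)%E.

Definition locally_minimizing (g : R -> M) : Prop :=
  forall t : R, 0 <= t <= 1 ->
  exists2 d : R, 0 < d &
    forall a b, 0 <= a -> a < b -> b <= 1 -> `|a - t| < d -> `|b - t| < d ->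
    forall h, horizontal a b h -> h a = g a -> h b = g b ->
    (energy a b g <= energy a b h)%E.

Definition geodesic (g : R -> M) : Prop :=
  [/\ horizontal 0 1 g,
      exists s t : R, [/\ 0 <= s <= 1, 0 <= t <= 1 & g s <> g t]
    & locally_minimizing g].

(* Curves are functions on R of which only the restriction to [0, 1] is
   relevant; the last condition selects a unique extension of that
   restriction, so that each curve is counted once. *)
Definition geodesics_joining (U : set M) (q p : M) : set (R -> M) :=
  [set g | [/\ geodesic g, g 0 = q, g 1 = p,
      forall t, 0 <= t <= 1 -> U (g t)
    & forall t, g t = g (Num.max 0 (Num.min 1 t))]].

Definition nu (U : set M) (q p : M) : \bar R :=
  counting (geodesics_joining U q p).

End geodesics.

Definition xcoord (R : realType) (n : nat) (p : 'rV[R]_(n + n + 1)) :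
  'rV[R]_(n + n) := lsubmx p.

Definition zcoord (R : realType) (n : nat) (p : 'rV[R]_(n + n + 1)) : R :=
  rsubmx p 0 0.

Definition Jmx (R : realType) (n : nat) : 'M[R]_(n + n) :=
  block_mx 0 1%:M (- 1%:M) 0.

Definition darboux_form (R : realType) (n : nat)
    (p v : 'rV[R]_(n + n + 1)) : R :=
  - zcoord v + 2^-1 * \sum_i \sum_j Jmx R n i j * xcoord p 0 i * xcoord v 0 j.

Definition darboux_chart (R : realType) (n : nat) (M : topologicalType)
    (A : connected_manifold R (n + n + 1) M) (S : contact_subriemannian A)
    (q : M) (c : chart R (n + n + 1) M) : Prop :=
  [/\ atlas A c, chart_dom c q, chart_map c q = 0
    & forall p v, chart_img c p ->
        (dist S c p v <-> darboux_form p v = 0)].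

Definition dilation (R : realType) (n : nat) (e : R)
    (p : 'rV[R]_(n + n + 1)) : 'rV[R]_(n + n + 1) :=
  row_mx (e *: xcoord p) (e ^+ 2 *: rsubmx p).

(* Main.v *)
(* In a frame that is orthonormal for the metric at q and puts the symplectic form
   in normal form with frequencies beta_j, horizontal curves are pairs (y, z) with
   z' = W(y, y') / 2, and in the normal geodesic equations the multiplier mu of this
   constraint rotates the j-th plane at speed mu * beta_j.  Rescaled by the dilation
   of factor eps, these equations are an O(eps) perturbation of those with constant
   coefficients, whose solution of multiplier mu from 0 to X reaches the height
     phi(mu) = sum_j beta_j |X_j|^2 (th_j - sin th_j) / (8 sin^2(th_j / 2)),
   where th_j = mu * beta_j.  On the k-th period of length 2 pi / beta_max, phi is at
   most C k |X|^2 at some point far from all poles and tends to infinity at a pole, so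
   for each k with C k |X|^2 < |z| it crosses the height z on an interval without
   poles.  A contraction argument and the intermediate value theorem carry each such
   crossing over to a solution of the perturbed equations for all small eps.

   A solution is locally minimizing inside the chart by a calibration argument, with
   a quadratic correction that absorbs second-order errors, and a competitor leaving
   the chart in a short time is too expensive.  A nonconstant solution determines its
   multiplier, hence different periods give different geodesics.  The exceptional set
   is the union of the hyperplanes on which the first coordinate of some X_j vanishes. *)

Require Import Defs.
From HB Require Import structures.
From mathcomp Require Import all_boot all_order all_algebra.
From mathcomp Require Import all_classical all_reals all_analysis.
From mathcomp Require Import measurable_realfun.
From mathcomp Require Import ring lra.
Import Order.TTheory GRing.Theory Num.Theory.
Import numFieldNormedType.Exports.
Set Implicit Arguments.
Unset Strict Implicit.
Unset Printing Implicit Defensive.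
Local Open Scope classical_set_scope.
Local Open Scope ring_scope.

(** * Integral inequalities and calibration *)

Section integral_lower_bounds.
Context {R : realType}.
Notation mu := (@lebesgue_measure R).
Implicit Types (f g : R -> R) (a b t : R).

(** Three obstacles shape the proof. The squared speed of a competitor is not assumed measurable, so
    its energy is bounded from below through measurable minorants: each such bound reduces to a
    pointwise inequality, off a null set, between speeds and the derivative of a Lipschitz function.
    The perturbed geodesic equations must be solved with bounds uniform in the dilation factor [e]
    and in the multiplier. They are therefore integrated once and written as a fixed point equation
    for the rescaled velocity, [U = Lop (e * rhat U)], where [Lop] solves the constant-coefficient
    two-point problem explicitly; its formula is singular where some [mu * beta_j] is a multiple of
    [2 pi], hence the segments of multipliers without poles. Finally, the solutions must be
    Lipschitz in the multiplier for the intermediate value theorem to apply. The constants of the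
    theorem come from one count: there is a geodesic for each [k] below [truncn r - 1], where
    [r = |z| / (C1 |x|_q^2)] and [|x|_q] is the norm at [q]. Comparing this norm with the Euclidean
    one gives [C(q)], and rounding gives [R(q) = -2]. *)

Lemma primitive_exists f (A : R) : continuous f ->
  exists P : R -> R, forall x : R, A < x -> is_derive x 1 P (f x).
Proof.
move=> cf; exists (fun x => \int[mu]_(t in `[A, x]) f t) => x Ax.
have xx1 : x < x + 1 by rewrite ltrDl.
have i : mu.-integrable `[A, x + 1] (EFin \o f).
  apply: continuous_compact_integrable; first exact: segment_compact.
  exact: continuous_subspaceT.
have [d e] := continuous_FTC1_closed xx1 i Ax (cf x).
by apply: (DeriveDef d); rewrite -derive1E; exact: e.
Qed.

(** [f] is not assumed measurable. Its integral is still a difference of suprema over simple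
    functions: those below the positive part of [g] are also below that of [f], and those below the
    negative part of [f] are, off a null set, below that of [g]. *)
Lemma le_integral_ae_subset (D D' : set R) f g :
  measurable D -> measurable D' -> D' `<=` D -> mu (D `\` D') = 0%E ->
  mu.-integrable D' (EFin \o g) -> (forall t, D' t -> g t <= f t) ->
  (\int[mu]_(t in D') (g t)%:E <= \int[mu]_(t in D) (f t)%:E)%E.
Proof.
Import HBNNSimple.
move=> mD mD' sD D0 /integrableP[mg _] gf.
rewrite integralE [leRHS]integralE.
apply: leeB; last first.
  rewrite ge0_integralE; last by move=> *; exact: funeneg_ge0.
  apply: ub_ereal_sup => _ [h /= hf <-].
  rewrite -integralT_nnsfun.
  (* Bounded by a restriction to [D], the simple function [h] vanishes off [D], and [D] exceeds [D']
     by a null set only. *)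
  have -> : (\int[mu]_x (h x)%:E = \int[mu]_(x in D') (h x)%:E)%E.
    rewrite [RHS]integral_mkcond; apply: ae_eq_integral => //.
    - exact/measurable_EFinP/measurable_funTS.
    - apply: (measurable_restrictT _ _).1 => //.
      exact/measurable_EFinP/measurable_funTS.
    exists (D `\` D'); split => //; first exact: measurableD.
    move=> t /= /not_implyP[_]; rewrite patchE.
    case: ifPn => // /negP tD' ht; split; last by move=> /mem_set.
    apply: contrapT => tD; apply: ht; congr (_%:E).
    have := hf t; rewrite patchE memNset//= lee_fin => h0.
    by apply/eqP; rewrite eq_le h0 /=; exact: fun_ge0.
  apply: ge0_le_integral => //.
  - by move=> t _; rewrite lee_fin; exact: fun_ge0.
  - exact/measurable_EFinP/measurable_funTS.
  - exact: measurable_funeneg.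
  move=> t D't; have := hf t; rewrite patchE mem_set; last exact: sD.
  move=> /le_trans; apply.
  rewrite !funenegE ge_max; apply/andP; split; rewrite le_max lee_fin.
    by rewrite lerN2 gf.
  by rewrite lexx orbT.
rewrite !ge0_integralE; try by move=> *; exact: funepos_ge0.
apply: le_ereal_sup => _ [h /= hg <-]; exists h => // t.
apply: (le_trans (hg t)); rewrite !patchE; case: ifPn => tD'; last first.
  by case: ifPn => // _; exact: funepos_ge0.
rewrite mem_set; last by apply: sD; exact: set_mem.
rewrite !funeposE ge_max; apply/andP; split; rewrite le_max lee_fin.
  by rewrite gf //; exact: set_mem.
by rewrite lexx orbT.
Qed.

Definition lipschitz_within (k a b : R) f :=
  forall s t, a <= s <= b -> a <= t <= b -> `|f s - f t| <= k * `|s - t|.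

(** Retraction of the line onto the segment. Being 1-Lipschitz, it extends a function from [[a, b]]
    to the line with the same Lipschitz constant. *)
Definition clampr a b t := Num.max a (Num.min b t).

Lemma clampr_itv a b t : a <= b -> a <= clampr a b t <= b.
Proof.
by move=> ab; rewrite /clampr le_max lexx /= ge_max ab ge_min lexx.
Qed.

Lemma clampr_id a b t : a <= t <= b -> clampr a b t = t.
Proof. by move=> /andP[a_t tb]; rewrite /clampr min_r// max_r. Qed.

Lemma clampr_lip a b s t : `|clampr a b s - clampr a b t| <= `|s - t|.
Proof.
have h1 := ler_norm (s - t); have h2 : t - s <= `|s - t|.
  by rewrite distrC ler_norm.
rewrite /clampr ler_norml.
by case: (leP b s) => ?; case: (leP b t) => ?; repeat case: (leP a _) => ?;
   apply/andP; split; lra.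
Qed.

Lemma clampr_continuous a b : continuous (clampr a b).
Proof.
move=> t; apply/(@cvgrPdist_le _ R^o) => e e0; near=> s.
rewrite (le_trans (clampr_lip _ _ _ _))//.
Unshelve. all: by end_near. Qed.

Lemma derive_seq f t : derivable f t 1 ->
  n.+1%:R * (f (t + n.+1%:R^-1) - f t) @[n --> \oo] --> 'D_1 f t.
Proof.
move=> df; have /cvgr_dnbhsP/(_ (fun n => n.+1%:R^-1)) := df.
have h : (forall n, n.+1%:R^-1 != 0 :> R) /\ n.+1%:R^-1 @[n --> \oo] --> (0 : R).
  by split => [n|]; [rewrite invr_eq0 pnatr_eq0|exact: cvg_harmonic].
move=> /(_ h); apply: cvg_trans; apply: near_eq_cvg; near=> n.
by rewrite /= invrK [_ *: 1]mulr1 [X in f X]addrC.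
Unshelve. all: by end_near. Qed.

(** Fundamental theorem of calculus for a Lipschitz function that is differentiable off a null set:
    its difference quotients are bounded by [k], so dominated convergence applies, and the integral
    of each quotient telescopes to averages near the endpoints. The conclusion has the form that a
    calibration needs, with no regularity asked of [fh]. *)
Lemma lipschitz_integral_lower_bound k a b (N : set R) (Phi fg fh : R -> R) :
  a < b -> lipschitz_within k a b Phi -> continuous fg ->
  measurable N -> mu N = 0%E ->
  (forall t, a < t < b -> ~ N t ->
     derivable Phi t 1 /\ fg t + 'D_1 Phi t <= fh t) ->
  (\int[mu]_(t in `]a, b[) (fg t)%:E + (Phi b - Phi a)%:E <=
   \int[mu]_(t in `]a, b[) (fh t)%:E)%E.
Proof.
move=> ab lipP cfg mN N0 hN.
have k0 : 0 <= k.
  have := lipP a b; rewrite !lexx (ltW ab) => /(_ erefl erefl).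
  move=> /(le_trans (normr_ge0 _)); rewrite pmulr_lge0// normr_gt0 subr_eq0.
  by rewrite lt_eqF.
pose D : set R := `]a, b[%classic; pose D' := D `\` N.
have mD : measurable D by exact: measurable_itv.
have mD' : measurable D' by exact: measurableD.
pose Psi t := Phi (clampr a b t).
have lipPsi s t : `|Psi s - Psi t| <= k * `|s - t|.
  rewrite (le_trans (lipP _ _ _ _))//; try exact/clampr_itv/ltW.
  by rewrite ler_wpM2l// clampr_lip.
have cPsi : continuous Psi.
  move=> t; apply/(@cvgrPdist_le _ R^o) => e e0; near=> s.
  rewrite (le_trans (lipPsi _ _))// (@le_trans _ _ ((k + 1) * `|t - s|))//.
    by rewrite ler_wpM2r// lerDl.
  rewrite mulrC -ler_pdivlMr ?ltr_wpDl//.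
  near: s; apply: (@cvgr_dist_le _ R^o _ _ _ id t cvg_id).
  by rewrite divr_gt0// ltr_wpDl.
(* Starting before [a] makes [P] differentiable at [a] itself. *)
have [P dP] := @primitive_exists _ (a - 1) cPsi.
pose q n t := n.+1%:R * (Psi (t + n.+1%:R^-1) - Psi t).
have cq n : continuous (q n).
  move=> t; apply: cvgM; first exact: cvg_cst.
  apply: cvgB; last exact: cPsi.
  by apply: continuous_comp; [apply: cvgD; [exact: cvg_id|exact: cvg_cst]|exact: cPsi].
have qk n t : `|q n t| <= k.
  rewrite /q normrM ger0_norm// mulrC -ler_pdivlMr// (le_trans (lipPsi _ _))//.
  by rewrite addrC addKr ger0_norm.
have mq n E : measurable_fun E (EFin \o q n).
  apply/measurable_EFinP; apply: measurable_funTS.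
  exact: continuous_measurable_fun.
have D'ab t : D' t -> a < t < b by move=> []; rewrite /D /= in_itv.
have q_cvg t : D' t -> q n t @[n --> \oo] --> 'D_1 Phi t.
  move=> D't; have atb := D'ab _ D't; have [dPhi _] := hN _ atb D't.2.
  have tPsi : \forall s \near t, Phi s = Psi s.
    have tab : t \in `]a, b[ by rewrite in_itv.
    have := near_in_itvoo tab; apply: filterS => s; rewrite in_itv/=.
    by move=> /andP[a_s sb]; rewrite /Psi clampr_id// !ltW.
  rewrite (near_eq_derive _ tPsi); apply: derive_seq.
  exact: near_eq_derivable tPsi dPhi.
have icont (h : R -> R) (E : set R) : measurable E -> E `<=` `[a, b]%classic -> continuous h ->
    mu.-integrable E (EFin \o h).
  move=> mE sE ch; have i : mu.-integrable `[a, b]%classic (EFin \o h).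
    apply: continuous_compact_integrable; first exact: segment_compact.
    exact: continuous_subspaceT.
  exact: integrableS i.
have sD : D `<=` `[a, b]%classic by exact: subset_itv_oo_cc.
have sD' : D' `<=` `[a, b]%classic by move=> t [/sD].
have i1 : mu.-integrable D' (EFin \o cst k).
  by apply: icont => // t; exact: cst_continuous.
have mdPhi : measurable_fun D' (fun t => 'D_1 Phi t).
  apply: (@measurable_fun_cvg _ _ _ _ q) => // n.
  by apply: measurable_funTS; exact: continuous_measurable_fun.
have [|||||iPhi _ cvPhi] := @dominated_convergence _ _ _ mu D' mD'
    (fun n => EFin \o q n) (EFin \o (fun t => 'D_1 Phi t)) (EFin \o cst k).
- by move=> n; exact: mq.
- exact/measurable_EFinP.
- by apply: aeW => t /= D't; apply: cvg_EFin; [exact: nearW|exact: q_cvg].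
- exact: i1.
- by apply: aeW => t n _ /=; rewrite lee_fin qk.
have lim : (\int[mu]_(t in D') ('D_1 Phi t)%:E = (Phi b - Phi a)%:E)%E.
  have : (\int[mu]_(x in D') (q n x)%:E)%E @[n --> \oo] -->
      (Phi b - Phi a)%:E.
    (* [F n] is a primitive of [q n]; its increment over [[a, b]] is a difference of two quotients
       of [P], which tend to [Psi b] and [Psi a]. *)
    pose F (n : nat) (x : R) : R := n.+1%:R * (P (x + n.+1%:R^-1) - P x).
    have dF n x : a <= x -> derivable (F n) x 1 /\ 'D_1 (F n) x = q n x.
      move=> ax.
      have ax' : a - 1 < x by rewrite ltrBlDr (le_lt_trans ax)// ltrDl.
      have d1 := dP x ax'.
      have d2 : is_derive (x + n.+1%:R^-1) 1 P (Psi (x + n.+1%:R^-1)).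
        by apply: dP; rewrite (lt_trans ax')// ltrDl.
      have d3 : is_derive x 1 (fun y : R => y + n.+1%:R^-1 : R) (1 + 0 : R).
        exact: is_deriveD.
      have d4 : is_derive x 1 (P \o (fun y : R => y + n.+1%:R^-1 : R))
          (Psi (x + n.+1%:R^-1) * (1 + 0)) by exact: is_derive1_comp.
      have d5 := is_deriveZ (n.+1%:R) (is_deriveB d4 d1).
      split; first by have [] := d5.
      by have [_] := d5; rewrite /q addr0 mulr1.
    have qE n : (\int[mu]_(x in D') (q n x)%:E =
      (n.+1%:R * (P (b + n.+1%:R^-1) - P b) -
       n.+1%:R * (P (a + n.+1%:R^-1) - P a))%:E)%E.
      rewrite -negligible_integral//; last exact: icont.
      rewrite -(integral_itv_bndoo true false); last exact: mq.
      rewrite (@continuous_FTC2 _ _ (F n))//.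
      - exact/continuous_subspaceT.
      - split => [x||].
        + by rewrite in_itv/= => /andP[/ltW ax _]; have [] := dF n x ax.
        + exact/cvg_at_right_filter/differentiable_continuous/derivable1_diffP/(dF n _ (lexx a)).1.
        + exact/cvg_at_left_filter/differentiable_continuous/derivable1_diffP/(dF n _ (ltW ab)).1.
      - move=> x; rewrite in_itv/= => /andP[/ltW ax _].
        by rewrite derive1E; have [] := dF n x ax.
    rewrite (funext qE).
    apply: cvg_EFin; first exact: nearW.
    have Pd x : a <= x -> derivable P x 1 /\ 'D_1 P x = Psi x.
      move=> ax; have := dP x; rewrite ltrBlDr => /(_ _)[|//].
      by rewrite (le_lt_trans ax)// ltrDl.
    have [db eb] := Pd b (ltW ab); have [da ea] := Pd a (lexx a).
    have -> : Phi b - Phi a = 'D_1 P b - 'D_1 P a.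
      by rewrite eb ea /Psi !clampr_id// lexx ltW.
    by apply: cvgB; exact: derive_seq.
  by move=> h; apply/esym; exact: (cvg_unique _ h cvPhi).
have -> : (\int[mu]_(t in D) (fg t)%:E = \int[mu]_(t in D') (fg t)%:E)%E.
  by apply: negligible_integral => //; exact: icont.
have ig : mu.-integrable D' (EFin \o fg) by exact: icont.
rewrite -lim -integralD//.
apply: (@le_integral_ae_subset D D' fh (fun t => fg t + 'D_1 Phi t)) => //.
- by rewrite setDD; apply: subset_measure0 N0 => //; exact: measurableI.
- exact: (integrableD _ ig iPhi).
- by move=> t D't; have [] := hN _ (D'ab _ D't) D't.2.
Unshelve. all: by end_near. Qed.

End integral_lower_bounds.

(** * Bilinear forms in coordinates *)

Section sums.
Context {R : realType}.

Definition norm1 (I : finType) (a : I -> R) : R := \sum_i `|a i|.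
Definition bil (I : finType) (B : I -> I -> R) (a b : I -> R) : R :=
  \sum_i \sum_j B i j * a i * b j.

Variable I : finType.
Implicit Types (B : I -> I -> R) (a b c : I -> R).

Lemma norm1_ge0 a : 0 <= norm1 a.
Proof. by apply: sumr_ge0 => i _. Qed.

Lemma le_norm1 a i : `|a i| <= norm1 a.
Proof. by rewrite /norm1 (bigD1 i)//= lerDl sumr_ge0. Qed.

Lemma norm1_sum_le a d : (forall i, `|a i| <= d) -> norm1 a <= #|I|%:R * d.
Proof.
move=> ad; rewrite /norm1 (le_trans (ler_sum _ (fun i _ => ad i)))//.
by rewrite sumr_const cardT -cardE mulr_natl.
Qed.

Lemma bil_le B m a b : (forall i j, `|B i j| <= m) ->
  `|bil B a b| <= m * (norm1 a * norm1 b).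
Proof.
move=> Bm; rewrite /bil /norm1 mulr_suml mulr_sumr (le_trans (ler_norm_sum _ _ _))//.
apply: ler_sum => i _; rewrite mulr_sumr mulr_sumr (le_trans (ler_norm_sum _ _ _))//.
apply: ler_sum => j _; rewrite !normrM -mulrA ler_wpM2r// mulr_ge0//.
Qed.

Lemma bilDl B a b c : bil B (fun i => a i + b i) c = bil B a c + bil B b c.
Proof.
rewrite /bil -big_split/=; apply: eq_bigr => i _; rewrite -big_split/=.
by apply: eq_bigr => j _; rewrite mulrDr mulrDl.
Qed.

Lemma bilDr B a b c : bil B c (fun i => a i + b i) = bil B c a + bil B c b.
Proof.
rewrite /bil -big_split/=; apply: eq_bigr => i _; rewrite -big_split/=.
by apply: eq_bigr => j _; rewrite mulrDr.
Qed.

Lemma bil_sym B a b : (forall i j, B i j = B j i) -> bil B a b = bil B b a.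
Proof.
move=> sB; rewrite /bil exchange_big; apply: eq_bigr => i _; apply: eq_bigr => j _.
by rewrite sB; ring.
Qed.

Lemma bil_asym B a b : (forall i j, B i j = - B j i) -> bil B a b = - bil B b a.
Proof.
move=> sB; rewrite /bil exchange_big -sumrN; apply: eq_bigr => i _.
by rewrite -sumrN; apply: eq_bigr => j _; rewrite sB; ring.
Qed.

Lemma bilDB B1 B2 a b :
  bil (fun i j => B1 i j + B2 i j) a b = bil B1 a b + bil B2 a b.
Proof.
rewrite /bil -big_split/=; apply: eq_bigr => i _; rewrite -big_split/=.
by apply: eq_bigr => j _; rewrite !mulrDl.
Qed.

Lemma bilNB B a b : bil (fun i j => - B i j) a b = - bil B a b.
Proof.
rewrite /bil -sumrN; apply: eq_bigr => i _; rewrite -sumrN.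
by apply: eq_bigr => j _; rewrite !mulNr.
Qed.

Lemma sqr_norm1_le a : norm1 a ^+ 2 <= #|I|%:R * \sum_i a i ^+ 2.
Proof.
have -> : norm1 a ^+ 2 = \sum_i \sum_j `|a i| * `|a j|.
  by rewrite expr2 /norm1 mulr_suml; apply: eq_bigr => i _; rewrite mulr_sumr.
have h i j : `|a i| * `|a j| <= (a i ^+ 2 + a j ^+ 2) / 2.
  rewrite -(real_normK (num_real (a i))) -(real_normK (num_real (a j))).
  have := sqr_ge0 (`|a i| - `|a j|); lra.
rewrite (le_trans (ler_sum _ (fun i _ => ler_sum _ (fun j _ => h i j))))//.
have -> : \sum_i \sum_j (a i ^+ 2 + a j ^+ 2) / 2 =
   \sum_i (a i ^+ 2 * #|I|%:R / 2 + (\sum_j a j ^+ 2) / 2).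
  apply: eq_bigr => i _; rewrite -mulr_suml big_split/= mulrDl.
  by rewrite sumr_const cardT -cardE -[_ ^+ 2 *+ _]mulr_natr.
rewrite big_split/= -!mulr_suml sumr_const cardT -cardE -[_ *+ #|I|]mulr_natr.
lra.
Qed.

(** The deviation from the identity costs at most [(2 * #|I|%:R)^-1 * norm1 a ^+ 2], which
    Cauchy-Schwarz bounds by half the sum of squares. *)
Lemma bil_lower B a :
  (forall i j, `|B i j - (i == j)%:R| <= (2 * #|I|%:R)^-1) ->
  2^-1 * \sum_i a i ^+ 2 <= bil B a a.
Proof.
move=> hB.
have -> : B = fun i j => (i == j)%:R + (B i j - (i == j)%:R).
  by apply/funext => i; apply/funext => j; rewrite addrC subrK.
rewrite bilDB.
have -> : bil (fun i j => (i == j)%:R) a a = \sum_i a i ^+ 2.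
  apply: eq_bigr => i _; rewrite (bigD1 i)//= eqxx mul1r -expr2 big1 ?addr0//.
  by move=> j /negPf ji; rewrite eq_sym ji !mul0r.
have := bil_le a a hB; rewrite -expr2 ler_norml => /andP[+ _].
have [I0|I0] := eqVneq #|I| 0%N.
  rewrite (_ : \sum_i a i ^+ 2 = 0); last first.
    by rewrite big1// => i _; have := card0_eq I0 i.
  by rewrite (_ : norm1 a = 0) ?expr0n/=; [lra|
    rewrite /norm1 big1// => i _; have := card0_eq I0 i].
have := sqr_norm1_le a.
set s := \sum_i _; set q := bil _ _ _; set n1 := norm1 a ^+ 2 => h1 h2.
have c0 : (0 : R) < #|I|%:R by rewrite ltr0n lt0n.
have : (2 * #|I|%:R)^-1 * n1 <= s / 2; last by lra.
by rewrite invfM -mulrA mulrC ler_pM2r ?invr_gt0// mulrC ler_pdivrMr// mulrC.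
Qed.

End sums.

Section calibration.
Context {R : realType} (I : finType).
Implicit Types (W G : I -> I -> R) (y u eta w : I -> R).

(** The [+ 1] keeps [N] positive when [I] is empty. *)
Let N : R := #|I|%:R + 1.

(* AM-GM absorbs the cross terms [e1 * w1] into [s2 / 4]. *)
Let absorb (C3 C4 s2 w1 e1 e2 c r : R) : 0 <= e1 -> 0 <= w1 -> 0 <= s2 -> 0 <= C3 -> 0 <= C4 ->
  w1 ^+ 2 <= N * s2 -> e1 ^+ 2 <= 2 * N * e2 ->
  2^-1 * s2 <= c -> - (C3 * (e1 * w1) + C4 * e1 ^+ 2) <= r ->
  0 <= 2^-1 * c + r + 2 * N * (C4 + N * C3 ^+ 2) * e2.
Proof.
move=> e0 w0 s0 C30 C40 hw he hc hr.
have N1 : 1 <= N by rewrite /N lerDr.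
have N0 : 0 < N by lra.
have h1 : 4 * N * (C3 * (e1 * w1)) <= w1 ^+ 2 + 4 * N ^+ 2 * C3 ^+ 2 * e1 ^+ 2.
  have := sqr_ge0 (w1 - 2 * N * C3 * e1); lra.
have h2 : C3 * (e1 * w1) <= s2 / 4 + N * C3 ^+ 2 * e1 ^+ 2.
  rewrite -(@ler_pM2l _ (4 * N)) ?mulr_gt0// (le_trans h1)//.
  rewrite mulrDr lerD//; first by rewrite (le_trans hw)//; lra.
  lra.
have h3 : (C4 + N * C3 ^+ 2) * e1 ^+ 2 <= (C4 + N * C3 ^+ 2) * (2 * N * e2).
  by apply: ler_wpM2l => //; rewrite addr_ge0// mulr_ge0 ?sqr_ge0// ltW.
have -> : 2 * N * (C4 + N * C3 ^+ 2) * e2 = (C4 + N * C3 ^+ 2) * (2 * N * e2) by ring.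
lra.
Qed.

(** [momentum] is the covector [G (u, .)] and [contrW] the covector [W (y, .)]. Applied to the
    velocity and multiplied by the multiplier, the latter is a magnetic force. *)
Definition momentum G u (k : I) : R := \sum_i G i k * u i.
Definition contrW W y (k : I) : R := \sum_i W i k * y i.

Lemma sum_momentum G u w : \sum_k momentum G u k * w k = bil G u w.
Proof.
rewrite /bil exchange_big; apply: eq_bigr => k _; rewrite /momentum mulr_suml.
by apply: eq_bigr => i _.
Qed.

Lemma sum_contrW W y w : \sum_k contrW W y k * w k = bil W y w.
Proof. exact: sum_momentum. Qed.

Lemma sum_bil_family (D : I -> I -> I -> R) u eta :
  \sum_k bil (fun i j => D i j k) u u * eta k =
  bil (fun i j => \sum_k D i j k * eta k) u u.
Proof.
rewrite /bil; under eq_bigr do rewrite mulr_suml; rewrite exchange_big.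
apply: eq_bigr => i _; under eq_bigr do rewrite mulr_suml; rewrite exchange_big.
apply: eq_bigr => j _; rewrite !mulr_suml; apply: eq_bigr => k _; ring.
Qed.

(* The competitor is [y + eta] with velocity [u + w], and [zeta] is its excess of
   height.  Besides the energy of the geodesic, the left-hand side is the derivative
   of a function vanishing with [eta] and [zeta]; the terms in [K] and [kappa], which
   come from a multiple of [sum eta^2 + zeta^2], absorb the second-order errors. *)
Lemma calibration_inequality (w0 L B : R) : 0 <= w0 -> 0 <= L -> 0 <= B ->
  exists2 K : R, 0 <= K &
  forall W G G' (D : I -> I -> I -> R) (Dz : I -> I -> R) y u eta w (zeta mu kappa : R),
  (forall i j, W i j = - W j i) -> (forall i j, `|W i j| <= w0) ->
  (forall i j, G' i j = G' j i) ->
  (forall i j, `|G' i j - (i == j)%:R| <= (2 * #|I|%:R)^-1) ->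
  (forall i j, `|G' i j - G i j| <= L * (norm1 eta + `|zeta|)) ->
  (forall i j, `|G' i j - G i j - (\sum_k D i j k * eta k + Dz i j * zeta)| <=
      L * (norm1 eta + `|zeta|) ^+ 2) ->
  norm1 u <= B -> norm1 y <= B -> norm1 eta <= B -> `|mu| <= B ->
  0 <= kappa <= 1 ->
  forall (mu' zeta' : R) (pi' : I -> R),
  mu' = 2^-1 * bil Dz u u ->
  zeta' = 2^-1 * bil W (fun i => y i + eta i) (fun i => u i + w i)
        - 2^-1 * bil W y u ->
  (forall k, pi' k = 2^-1 * bil (fun i j => D i j k) u u
      + 2^-1 * mu' * contrW W y k + mu * contrW W u k) ->
  2^-1 * bil G u u
  + (\sum_k (pi' k * eta k + momentum G u k * w k) + mu' * zeta + mu * zeta'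
     - 2^-1 * mu' * bil W y eta - 2^-1 * mu * (bil W u eta + bil W y w))
  - (K * (\sum_k eta k ^+ 2 + zeta ^+ 2)
     + 2 * kappa * (\sum_k eta k * w k + zeta * zeta'))
  <= 2^-1 * bil G' (fun i => u i + w i) (fun i => u i + w i).
Proof.
move=> w00 L0 B0.
(* [C3] and [C4] collect the coefficients of [e1 * w1] and of [e1 ^+ 2] in the bounds [b1] to [b4]
   below. *)
pose C3 := L * B + 2^-1 * B * w0 + 2 * (1 + w0 * B).
pose C4 := 2^-1 * L * B ^+ 2 + 2 * w0 * B.
have C30 : 0 <= C3 by rewrite /C3 !addr_ge0// !mulr_ge0// addr_ge0// mulr_ge0.
have C40 : 0 <= C4 by rewrite /C4 addr_ge0// !mulr_ge0// sqr_ge0.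
have N0 : 0 <= N by rewrite /N addr_ge0.
exists (2 * N * (C4 + N * C3 ^+ 2)).
  by rewrite !mulr_ge0// addr_ge0// mulr_ge0// sqr_ge0.
move=> W G G' D Dz y u eta w zeta mu kappa aW Ww sG' G'1 GL GD uB yB eB muB k01.
move=> mu' zeta' pi' Emu' Ezeta' Epi'.
set e1 := norm1 eta + `|zeta| in GL GD *.
have e10 : 0 <= e1 by rewrite addr_ge0// norm1_ge0.
have eta_e1 : norm1 eta <= e1 by rewrite lerDl.
have zeta_e1 : `|zeta| <= e1 by rewrite lerDr norm1_ge0.
pose w1 := norm1 w; have w10 : 0 <= w1 by exact: norm1_ge0.
have u0 := norm1_ge0 u; have y0 := norm1_ge0 y; have eta0 := norm1_ge0 eta.
have Epi : \sum_k (pi' k * eta k + momentum G u k * w k) =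
    2^-1 * bil (fun i j => \sum_k D i j k * eta k) u u
    + 2^-1 * mu' * bil W y eta + mu * bil W u eta + bil G u w.
  rewrite big_split/= sum_momentum -sum_bil_family -!sum_contrW !mulr_sumr.
  by congr (_ + _); rewrite -!big_split/=; apply: eq_bigr => k _; rewrite Epi'; ring.
have Ez : zeta' = 2^-1 * (bil W y w + bil W eta u + bil W eta w).
  by rewrite Ezeta' !bilDr !bilDl; ring.
have Eeu : bil W eta u = - bil W u eta by exact: bil_asym.
have EG' : bil G' (fun i => u i + w i) (fun i => u i + w i) =
    bil G' u u + 2 * bil G' u w + bil G' w w.
  by rewrite !bilDr !bilDl (bil_sym w u sG'); ring.
have bz : `|zeta'| <= w0 * B * (w1 + e1).
  rewrite Ez normrM ger0_norm ?invr_ge0//.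
  have b1 : `|bil W y w| <= w0 * (B * w1).
    by rewrite (le_trans (bil_le _ _ Ww))// ler_wpM2l// ler_wpM2r.
  have b2 : `|bil W eta u| <= w0 * (e1 * B).
    by rewrite (le_trans (bil_le _ _ Ww))// ler_wpM2l// ler_pM.
  have b3 : `|bil W eta w| <= w0 * (B * w1).
    by rewrite (le_trans (bil_le _ _ Ww))// ler_wpM2l// ler_wpM2r.
  have := ler_normD (bil W y w + bil W eta u) (bil W eta w).
  have := ler_normD (bil W y w) (bil W eta u).
  have : 0 <= w0 * (e1 * B) by rewrite !mulr_ge0.
  lra.
have bew : `|\sum_k eta k * w k| <= e1 * w1.
  rewrite (le_trans (ler_norm_sum _ _ _))// /w1 /norm1 mulr_sumr ler_sum// => i _.
  by rewrite normrM ler_wpM2r// (le_trans (le_norm1 _ _)).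
have b1 : `|bil (fun i j => G' i j - G i j) u w| <= L * e1 * (B * w1).
  by rewrite (le_trans (bil_le _ _ GL))// ler_wpM2l ?mulr_ge0// ler_wpM2r.
have b2 : `|bil (fun i j => G' i j - G i j -
    (\sum_k D i j k * eta k + Dz i j * zeta)) u u| <= L * e1 ^+ 2 * (B * B).
  by rewrite (le_trans (bil_le _ _ GD))// ler_wpM2l ?mulr_ge0 ?sqr_ge0// ler_pM.
have b3 : `|mu * bil W eta w| <= B * (w0 * (e1 * w1)).
  rewrite normrM ler_pM// (le_trans (bil_le _ _ Ww))// ler_wpM2l// ler_wpM2r//.
have b4 : `|kappa * (\sum_k eta k * w k + zeta * zeta')| <=
    e1 * w1 + e1 * (w0 * B * (w1 + e1)).
  rewrite normrM -[leRHS]mul1r ler_pM//.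
    by rewrite ger0_norm; case/andP: k01.
  rewrite (le_trans (ler_normD _ _))// lerD// normrM ler_pM//.
move: b1 b2; rewrite !(bilDB, bilNB) => b1 b2.
have EDz : bil (fun i j => Dz i j * zeta) u u = zeta * bil Dz u u.
  rewrite /bil mulr_sumr; apply: eq_bigr => i _; rewrite mulr_sumr.
  by apply: eq_bigr => j _; ring.
rewrite EDz in b2.
have lowG := bil_lower w G'1.
(* The terms of first order in [eta], [zeta] and [w] cancel by the geodesic equations. Apart from
   [bil G' w w / 2] and the term in [K], what remains is [r]. *)
pose r := 2^-1 * (bil G' u u - bil G u u
            - (bil (fun i j => \sum_k D i j k * eta k) u u + zeta * bil Dz u u))
     + (bil G' u w - bil G u w) - 2^-1 * (mu * bil W eta w)
     + 2 * (kappa * (\sum_k eta k * w k + zeta * zeta')).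
have hr : - (C3 * (e1 * w1) + C4 * e1 ^+ 2) <= r.
  move: b1 b2 b3 b4; rewrite !ler_norml => /andP[b1 _] /andP[b2 _] /andP[_ b3] /andP[b4 _].
  rewrite /r /C3 /C4; lra.
have hw : w1 ^+ 2 <= N * \sum_i w i ^+ 2.
  rewrite (le_trans (sqr_norm1_le _))// /N mulrDl lerDl mul1r sumr_ge0// => i _.
  exact: sqr_ge0.
have he : e1 ^+ 2 <= 2 * N * (\sum_k eta k ^+ 2 + zeta ^+ 2).
  have := sqr_norm1_le eta; have := sqr_ge0 (norm1 eta - `|zeta|).
  rewrite /e1 -(real_normK (num_real zeta)) /N.
  have : 0 <= \sum_k eta k ^+ 2 by rewrite sumr_ge0// => i _; exact: sqr_ge0.
  have : 0 <= #|I|%:R * `|zeta| ^+ 2 by rewrite mulr_ge0// sqr_ge0.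
  lra.
have s0 : 0 <= \sum_i w i ^+ 2 by rewrite sumr_ge0// => i _; exact: sqr_ge0.
have := absorb e10 w10 s0 C30 C40 hw he lowG hr.
rewrite EG' Epi /r Ez Eeu Emu'; lra.
Qed.

End calibration.

(** * The boundary value problem *)

Section primitives.
Context {R : realType}.
Notation mu := (@lebesgue_measure R).
Implicit Types f g : R -> R.

Definition clamp01 (t : R) := clampr 0 1 t.

Lemma clamp01_itv t : 0 <= clamp01 t <= 1.
Proof. exact: clampr_itv. Qed.

Lemma clamp01_id t : 0 <= t <= 1 -> clamp01 t = t.
Proof. exact: clampr_id. Qed.

Lemma derive_bound_le f (df : R -> R) (m : R) : continuous f ->
  (forall t : R, 0 < t < 1 -> is_derive t 1 f (df t)) ->
  (forall t : R, 0 < t < 1 -> `|df t| <= m) ->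
  forall s t : R, 0 <= s -> s <= t -> t <= 1 -> `|f t - f s| <= m * (t - s).
Proof.
move=> cf dff dfm s t s0; rewrite le_eqVlt => /predU1P[->|st] t1.
  by rewrite !subrr normr0 mulr0.
have [||x] := @MVT _ f df s t st.
- move=> x; rewrite in_itv/= => /andP[sx xt]; apply: dff.
  by rewrite (le_lt_trans s0)// (lt_le_trans xt).
- exact: continuous_subspaceT.
rewrite in_itv/= => /andP[sx xt] ->.
have ts : 0 <= t - s by rewrite subr_ge0 ltW.
rewrite normrM (ger0_norm ts) ler_wpM2r// dfm//.
by rewrite (le_lt_trans s0)// (lt_le_trans xt).
Qed.

Lemma derive0_constant f : continuous f ->
  (forall t : R, 0 < t < 1 -> is_derive t 1 f 0) ->
  forall t : R, 0 <= t <= 1 -> f t = f 0.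
Proof.
move=> cf df t /andP[t0 t1].
have := @derive_bound_le f (fun=> 0) 0 cf df _ 0 t (lexx 0) t0 t1.
rewrite mul0r => h; apply/eqP; rewrite -subr_eq0 -normr_le0; apply: h.
by move=> s _; rewrite normr0.
Qed.

(** Primitive vanishing at [0], frozen outside [[0, 1]] so that it stays bounded on the line.
    Integrating from [-1] makes the underlying primitive differentiable at [0]. *)
Definition prim f t : R :=
  \int[mu]_(x in `[-1, clamp01 t]) f x - \int[mu]_(x in `[-1, 0]) f x.

Let prim_ex f : continuous f -> exists2 P : R -> R,
  (forall x : R, -1 < x -> is_derive x 1 P (f x)) &
  forall t, prim f t = P (clamp01 t) - P 0.
Proof.
move=> cf; exists (fun x => \int[mu]_(t in `[-1, x]) f t) => // x Ax.
have xx1 : x < x + 1 by rewrite ltrDl.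
have i : mu.-integrable `[-1, x + 1] (EFin \o f).
  apply: continuous_compact_integrable; first exact: segment_compact.
  exact: continuous_subspaceT.
have [d e] := continuous_FTC1_closed xx1 i Ax (cf x).
by apply: (DeriveDef d); rewrite -derive1E; exact: e.
Qed.

Lemma prim0 f : continuous f -> prim f 0 = 0.
Proof. by move=> /prim_ex[P _ ->]; rewrite clamp01_id ?subrr// lexx ler01. Qed.

Lemma prim_clamp f t : prim f (clamp01 t) = prim f t.
Proof. by rewrite /prim (clamp01_id (clamp01_itv t)). Qed.

Lemma prim_derive f (t : R) : continuous f -> 0 < t < 1 -> is_derive t 1 (prim f) (f t).
Proof.
move=> cf t01; have [P dP E] := prim_ex cf.
have t1 : -1 < t by case/andP: t01 => t0 _; rewrite (lt_trans _ t0)// ltrN10.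
have d : is_derive t 1 (P - cst (P 0)) (f t - 0) by apply: is_deriveB; exact: dP.
rewrite subr0 in d.
apply: near_eq_is_derive d.
have t01' : t \in `]0, 1[ by rewrite in_itv.
have := near_in_itvoo t01'; apply: filterS => s; rewrite in_itv/= => /andP[s0 s1].
by rewrite E clamp01_id// !ltW.
Qed.

Lemma prim_continuous f : continuous f -> continuous (prim f).
Proof.
move=> cf; have [P dP E] := prim_ex cf.
have -> : prim f = (P \o clamp01) - cst (P 0) by apply/funext => t; rewrite E.
move=> t; apply: cvgB; last exact: cvg_cst.
apply: continuous_comp; first exact: clampr_continuous.
apply/differentiable_continuous/derivable1_diffP.
have /andP[c0 _] := clamp01_itv t.
by have [] := dP (clamp01 t) (lt_le_trans (ltrN10 _) c0).
Qed.

(** The segment has length [1], so integration does not increase the sup distance and no constant is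
    lost when functionals are integrated. *)
Lemma prim_near f g (d : R) : continuous f -> continuous g ->
  (forall t, `|f t - g t| <= d) -> forall t, `|prim f t - prim g t| <= d.
Proof.
move=> cf cg fg t; rewrite -(prim_clamp f) -(prim_clamp g).
have /andP[t0 t1] := clamp01_itv t.
have c : continuous (prim f - prim g).
  by move=> s; apply: cvgB; exact: prim_continuous.
have := @derive_bound_le (prim f - prim g) (fun t => f t - g t) d c _ _ _ _
  (lexx 0) t0 t1.
rewrite !fctE /= !prim0// !subr0 => h; apply: (le_trans (h _ _)) => //.
  by move=> s s01; apply: is_deriveB; exact: prim_derive.
rewrite ler_piMr// (le_trans _ (fg 0))//.
Qed.

Lemma prim_bound f (m : R) : continuous f -> (forall t, `|f t| <= m) ->
  forall t, `|prim f t| <= m.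
Proof.
move=> cf fm t; have c0 : continuous (cst 0 : R -> R) by move=> s; exact: cst_continuous.
have p0 : prim (cst 0) t = 0.
  rewrite -prim_clamp -[RHS](prim0 c0).
  apply: (derive0_constant (prim_continuous c0)) (clamp01_itv t) => s s01.
  exact: prim_derive.
have := @prim_near f (cst 0) m cf c0 _ t; rewrite p0 subr0; apply => s.
by rewrite /= subr0.
Qed.

Lemma prim_unique f F : continuous f -> continuous F -> F 0 = 0 ->
  (forall t : R, 0 < t < 1 -> is_derive t 1 F (f t)) ->
  forall t : R, 0 <= t <= 1 -> F t = prim f t.
Proof.
move=> cf cF F0 dF t t01.
have c : continuous (F - prim f) by move=> s; apply: cvgB; [exact: cF|exact: prim_continuous].
have := derive0_constant c _ t01; rewrite !fctE F0 prim0// subrr => h.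
apply/eqP; rewrite -subr_eq0; apply/eqP; apply: h => s s01.
by rewrite -(subrr (f s)); apply: is_deriveB; [exact: dF|exact: prim_derive].
Qed.

End primitives.

(** * Contraction principle for families of curves *)

Section uniform_fixed_point.
Context {R : realType} (I : Type).
Implicit Types U : I -> R -> R.

Definition cball (r : R) U := forall i, continuous (U i) /\ forall t, `|U i t| <= r.
Definition within_dist (d : R) U U' := forall i t, `|U i t - U' i t| <= d.

Lemma half_pow_small (r e : R) : 0 <= r -> 0 < e -> exists k, r / 2 ^+ k < e.
Proof.
move=> r0 e0; have h : `|2^-1 : R| < 1 by rewrite ger0_norm// invf_lt1// ltr1n.
have /(@cvgrPdist_lt _ R^o)/(_ e e0)[k _ /(_ k (leqnn k))/=] := cvg_geometric r h.
rewrite sub0r normrN /geometric /= exprVn ger0_norm ?mulr_ge0// => hk.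
by exists k.
Qed.

(** Banach's principle with ratio [1/2] for the sup distance. The iterates of zero converge
    pointwise at a geometric rate that is uniform in the index and in time, so the limit is
    continuous and is a fixed point. *)
Lemma uniform_fixed_point (T : (I -> R -> R) -> I -> R -> R) (r : R) : 0 <= r ->
  (forall U, cball r U -> cball r (T U)) ->
  (forall U U' d, cball r U -> cball r U' -> within_dist d U U' ->
    within_dist (d / 2) (T U) (T U')) ->
  exists2 U, cball r U & forall i t, T U i t = U i t.
Proof.
move=> r0 Tr Tc.
pose V k := iter k T (fun _ _ => 0).
have Vr k : cball r (V k).
  elim: k => [|k IH]; last exact: Tr.
  by move=> i; split=> [t|t]; [exact: cst_continuous|rewrite normr0].
have Vd k m : within_dist (2 * r / 2 ^+ k) (V k) (V (k + m)%N).
  elim: k => [|k IH].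
    move=> i t; rewrite expr0 divr1 /= sub0r normrN add0n.
    by rewrite (le_trans ((Vr m i).2 t))// ler_peMl// ler1n.
  move=> i t; rewrite exprSr invfM mulrA addSn; apply: (Tc _ _ _ (Vr _) (Vr _) IH).
have small (e : R) : 0 < e -> exists k, 2 * r / 2 ^+ k < e.
  by apply: half_pow_small; rewrite mulr_ge0.
have cvgV i t : cvg (V k i t @[k --> \oo]).
  apply/cauchy_cvgP/cauchy_exP => e e0; have [K hK] := small e e0.
  exists (V K i t); exists K => // k /= Kk.
  by apply: le_lt_trans hK; have := Vd K (k - K)%N i t; rewrite subnKC.
pose U i t := lim (V k i t @[k --> \oo]).
have VU k : within_dist (2 * r / 2 ^+ k) (V k) U.
  move=> i t; have h m : (k <= m)%N -> `|V k i t - V m i t| <= 2 * r / 2 ^+ k.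
    by move=> km; have := Vd k (m - k)%N i t; rewrite subnKC.
  rewrite ler_distlC; apply/andP; split.
    apply: limr_ge => //; exists k => // m /= /h; rewrite ler_distl => /andP[_]; lra.
  apply: limr_le => //; exists k => // m /= /h; rewrite ler_distl => /andP[+ _]; lra.
have UC : cball r U.
  move=> i; split=> t; last first.
    rewrite ler_norml; apply/andP; split.
      by apply: limr_ge => //; apply: nearW => k; have := (Vr k i).2 t; rewrite ler_norml => /andP[].
    by apply: limr_le => //; apply: nearW => k; have := (Vr k i).2 t; rewrite ler_norml => /andP[].
  apply/(@cvgrPdist_le _ R^o) => e e0.
  have e3 : 0 < e / 3 by rewrite divr_gt0.
  have [K hK] := small _ e3.
  have /(@cvgrPdist_le _ R^o)/(_ _ e3) := (Vr K i).1 t.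
  apply: filterS => s hs.
  have h1 := VU K i t; have h2 := VU K i s.
  have -> : U i t - U i s = (V K i t - V K i s) + (V K i s - U i s) - (V K i t - U i t) by ring.
  have := ler_normB (V K i t - V K i s + (V K i s - U i s)) (V K i t - U i t).
  have := ler_normD (V K i t - V K i s) (V K i s - U i s); lra.
exists U => // i t.
apply/eqP; rewrite -subr_eq0 -normr_le0 leNgt; apply/negP => /small[K].
apply/negP; rewrite -leNgt.
have h1 := Tc _ _ _ (Vr K) UC (VU K) i t; have h2 := VU K.+1 i t.
have -> : T U i t - U i t = (V K.+1 i t - U i t) - (T (V K) i t - T U i t).
  by rewrite /V /=; ring.
move: h1 h2; rewrite exprSr invfM mulrA.
have := ler_normB (V K.+1 i t - U i t) (T (V K) i t - T U i t); lra.
Qed.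

End uniform_fixed_point.

(** * Functionals bounded and Lipschitz uniformly in the dilation factor *)

Section functionals.
Context {R : realType}.

Lemma continuous_bigsum (T : topologicalType) (J : Type) (r : seq J) (F : J -> T -> R) :
  (forall j, continuous (F j)) -> continuous (fun t => \sum_(j <- r) F j t).
Proof.
move=> cF t; elim: r => [|j r IH].
  by under eq_fun do rewrite big_nil; exact: cvg_cst.
under eq_fun do rewrite big_cons.
by apply: (@continuousD _ R^o _ (F j) (fun t => \sum_(k <- r) F k t)); first exact: cF.
Qed.

Lemma continuous_dominated (f h : R -> R) (t : R) :
  (forall s, `|f t - f s| <= h s) -> {for t, continuous h} -> h t = 0 ->
  {for t, continuous f}.
Proof.
move=> fh ch h0; apply/(@cvgrPdist_le _ R^o) => e e0.
have /(@cvgrPdist_le _ R^o)/(_ e e0) := ch; apply: filterS => s.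
rewrite h0 sub0r normrN => hs.
by rewrite (le_trans (fh s))// (le_trans (ler_norm _)).
Qed.

Variables (I : finType) (rad lo hi : R).

Definition admissible (m : R) (U : I -> R -> R) := lo <= m <= hi /\ cball rad U.

(* Functionals of a parameter [m] and a curve [U], bounded and Lipschitz
   uniformly in the scaling parameter [e]. *)
Definition nice (Th : R -> R -> (I -> R -> R) -> R -> R) :=
  exists2 C : R, 0 <= C & forall e : R, 0 < e <= 1 ->
   (forall m U, admissible m U ->
      continuous (Th e m U) /\ forall t, `|Th e m U t| <= C) /\
   (forall m m' U U' (d : R), admissible m U -> admissible m' U' ->
      `|m - m'| <= d -> within_dist d U U' ->
      forall t, `|Th e m U t - Th e m' U' t| <= C * d).

Lemma nice_cst (c : R) : nice (fun _ _ _ _ => c).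
Proof.
exists `|c| => // e e01; split=> [m U _|m m' U U' d _ _ md _ t].
  by split=> [t|t//]; exact: cst_continuous.
by rewrite subrr normr0 mulr_ge0// (le_trans _ md).
Qed.

Lemma nice_eps : nice (fun e _ _ _ => e).
Proof.
exists 1 => // e /andP[e0 e1]; split=> [m U _|m m' U U' d _ _ md _ t].
  by split=> [t|t]; [exact: cst_continuous|rewrite ger0_norm// ltW].
by rewrite subrr normr0 mulr_ge0// (le_trans _ md).
Qed.

Lemma nice_arg i : nice (fun _ _ U => U i).
Proof.
exists (`|rad| + 1) => [|e e01]; first by rewrite addr_ge0.
split=> [m U [_ aU]|m m' U U' d _ _ md UU' t].
  split=> [|t]; first exact: (aU i).1.
  by rewrite (le_trans ((aU i).2 t))// (le_trans (ler_norm _))// lerDl ler01.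
have d0 : 0 <= d by rewrite (le_trans _ md).
by rewrite (le_trans (UU' i t))// mulrDl mul1r lerDr mulr_ge0.
Qed.

Lemma nice_fun (f : R -> R -> R) (C : R) : 0 <= C ->
  (forall m, lo <= m <= hi -> continuous (f m) /\ forall t, `|f m t| <= C) ->
  (forall m m', lo <= m <= hi -> lo <= m' <= hi ->
     forall t, 0 <= t <= 1 -> `|f m t - f m' t| <= C * `|m - m'|) ->
  nice (fun _ m _ t => f m (clamp01 t)).
Proof.
move=> C0 fC fL; exists C => // e e01; split=> [m U [am _]|m m' U U' d [am _] [am' _] md _ t].
  split=> [t|t]; last exact: (fC m am).2.
  by apply: continuous_comp; [exact: clampr_continuous|exact: (fC m am).1].
by rewrite (le_trans (fL _ _ am am' _ (clamp01_itv t)))// ler_wpM2l.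
Qed.

Lemma nice_add Th Th' : nice Th -> nice Th' ->
  nice (fun e m U t => Th e m U t + Th' e m U t).
Proof.
move=> [C C0 nC] [C' C'0 nC']; exists (C + C') => [|e e01]; first exact: addr_ge0.
have [b1 l1] := nC e e01; have [b2 l2] := nC' e e01.
split=> [m U aU|m m' U U' d aU aU' md UU' t].
  have [c1 d1] := b1 m U aU; have [c2 d2] := b2 m U aU.
  split=> [t|t]; first by apply: cvgD; [exact: c1|exact: c2].
  by rewrite (le_trans (ler_normD _ _))// lerD.
have := l1 m m' U U' d aU aU' md UU' t; have := l2 m m' U U' d aU aU' md UU' t.
rewrite opprD addrACA mulrDl.
have := ler_normD (Th e m U t - Th e m' U' t) (Th' e m U t - Th' e m' U' t); lra.
Qed.

Lemma nice_mul Th Th' : nice Th -> nice Th' ->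
  nice (fun e m U t => Th e m U t * Th' e m U t).
Proof.
move=> [C C0 nC] [C' C'0 nC']; exists (2 * (C * C')) => [|e e01]; first by rewrite !mulr_ge0.
have [b1 l1] := nC e e01; have [b2 l2] := nC' e e01.
split=> [m U aU|m m' U U' d aU aU' md UU' t].
  have [c1 d1] := b1 m U aU; have [c2 d2] := b2 m U aU.
  split=> [t|t]; first by apply: cvgM; [exact: c1|exact: c2].
  rewrite normrM (@le_trans _ _ (C * C'))//; first exact: ler_pM.
  by rewrite ler_peMl ?mulr_ge0// ler1n.
have h1 := l1 m m' U U' d aU aU' md UU' t; have h2 := l2 m m' U U' d aU aU' md UU' t.
have [_ /(_ t) g1] := b1 m U aU; have [_ /(_ t) g2] := b2 m' U' aU'.
set a := Th e m U t in h1 g1 *; set a' := Th e m' U' t in h1 *.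
set b := Th' e m U t in h2 *; set b' := Th' e m' U' t in h2 g2 *.
have -> : a * b - a' * b' = a * (b - b') + (a - a') * b' by ring.
rewrite (le_trans (ler_normD _ _))// !normrM.
have k1 : `|a| * `|b - b'| <= C * (C' * d) by exact: ler_pM.
have k2 : `|a - a'| * `|b'| <= (C * d) * C' by exact: ler_pM.
lra.
Qed.

Lemma nice_scale (c : R) Th : nice Th -> nice (fun e m U t => c * Th e m U t).
Proof. exact/nice_mul/nice_cst. Qed.

Lemma nice_sub Th Th' : nice Th -> nice Th' ->
  nice (fun e m U t => Th e m U t - Th' e m U t).
Proof.
move=> n1 /(nice_scale (-1)) n2; have := nice_add n1 n2.
congr nice; apply/funext => e; apply/funext => m; apply/funext => U.
by apply/funext => t; rewrite mulN1r.
Qed.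

Lemma nice_sum (J : finType) (Th : J -> R -> R -> (I -> R -> R) -> R -> R) :
  (forall j, nice (Th j)) -> nice (fun e m U t => \sum_j Th j e m U t).
Proof.
move=> nT.
suff h (r : seq J) : nice (fun e m U t => \sum_(j <- r) Th j e m U t) by exact: h.
elim: r => [|j r IH].
  have := nice_cst 0; congr nice; apply/funext => e; apply/funext => m.
  by apply/funext => U; apply/funext => t; rewrite big_nil.
have := nice_add (nT j) IH; congr nice; apply/funext => e; apply/funext => m.
by apply/funext => U; apply/funext => t; rewrite big_cons.
Qed.

Lemma nice_prim Th : nice Th -> nice (fun e m U => prim (Th e m U)).
Proof.
move=> [C C0 nC]; exists C => // e e01; have [b1 l1] := nC e e01.
split=> [m U aU|m m' U U' d aU aU' md UU' t].
  have [c1 d1] := b1 m U aU; split; first exact: prim_continuous.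
  exact: prim_bound.
have [c1 _] := b1 m U aU; have [c2 _] := b1 m' U' aU'.
by apply: prim_near => // s; exact: l1.
Qed.

Lemma nice_eval Th (t0 : R) : nice Th -> nice (fun e m U _ => Th e m U t0).
Proof.
move=> [C C0 nC]; exists C => // e e01; have [b1 l1] := nC e e01.
split=> [m U aU|m m' U U' d aU aU' md UU' t]; last exact: l1.
by have [c1 d1] := b1 m U aU; split=> [t|t//]; exact: cst_continuous.
Qed.

Section composition.
Variables (H : (I -> R) -> R -> R) (L : R).
Hypotheses (L0 : 0 <= L) (HL : forall y z y' z',
  `|H y z - H y' z'| <= L * (norm1 (fun i => y i - y' i) + `|z - z'|)).

Let HLe (e : R) y z y' z' : 0 < e <= 1 ->
  `|H (fun i => e * y i) (e ^+ 2 * z) - H (fun i => e * y' i) (e ^+ 2 * z')| <=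
  e * L * (norm1 (fun i => y i - y' i) + `|z - z'|).
Proof.
move=> /andP[e0 e1]; rewrite (le_trans (HL _ _ _ _))//.
rewrite [leRHS](_ : _ = L * (e * (norm1 (fun i => y i - y' i) + `|z - z'|))); last by ring.
rewrite ler_wpM2l// mulrDr lerD//.
  rewrite /norm1 mulr_sumr; apply: ler_sum => i _.
  by rewrite -mulrBr normrM (ger0_norm (ltW e0)).
rewrite -mulrBr normrM ger0_norm ?sqr_ge0// ler_wpM2r// expr2 ler_piMr//.
exact: ltW.
Qed.

Variables (Y : I -> R -> R -> (I -> R -> R) -> R -> R) (Z : R -> R -> (I -> R -> R) -> R -> R).
Hypotheses (nY : forall i, nice (Y i)) (nZ : nice Z).

Let comp e m U t := H (fun i => e * Y i e m U t) (e ^+ 2 * Z e m U t).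

Let comp_lip : exists2 C : R, 0 <= C & forall e : R, 0 < e <= 1 ->
  (forall m U, admissible m U -> continuous (comp e m U)
     /\ forall t, `|comp e m U t - H (fun=> 0) 0| <= e * C) /\
  (forall m m' U U' (d : R), admissible m U -> admissible m' U' ->
      `|m - m'| <= d -> within_dist d U U' ->
      forall t, `|comp e m U t - comp e m' U' t| <= e * (C * d)).
Proof.
have [CZ CZ0 hZ] := nZ.
have [CY hY] : {CY : I -> R | forall i, 0 <= CY i /\ forall e : R, 0 < e <= 1 ->
   (forall m U, admissible m U ->
      continuous (Y i e m U) /\ forall t, `|Y i e m U t| <= CY i) /\
   (forall m m' U U' (d : R), admissible m U -> admissible m' U' ->
      `|m - m'| <= d -> within_dist d U U' ->
      forall t, `|Y i e m U t - Y i e m' U' t| <= CY i * d)}.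
  have /choice : forall i, exists C : R, 0 <= C /\ forall e : R, 0 < e <= 1 ->
   (forall m U, admissible m U ->
      continuous (Y i e m U) /\ forall t, `|Y i e m U t| <= C) /\
   (forall m m' U U' (d : R), admissible m U -> admissible m' U' ->
      `|m - m'| <= d -> within_dist d U U' ->
      forall t, `|Y i e m U t - Y i e m' U' t| <= C * d).
    by move=> i; have [C ? ?] := nY i; exists C.
  by move=> [f hf]; exists f.
pose C := L * (\sum_i CY i + CZ).
have C0 : 0 <= C by rewrite mulr_ge0// addr_ge0// sumr_ge0// => i _; exact: (hY i).1.
exists C => // e e01; have e0 : 0 < e by case/andP: e01.
have [bZ lZ] := hZ e e01.
split=> [m U aU|m m' U U' d aU aU' md UU' t].
  have [cZ dZ] := bZ m U aU.
  split=> t.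
    apply: (@continuous_dominated _ (fun s => e * L * (norm1 (fun i => Y i e m U t - Y i e m U s)
        + `|Z e m U t - Z e m U s|))).
    - by move=> s; exact: HLe.
    - apply: cvgM; first exact: cvg_cst.
      apply: cvgD; last first.
        by apply: cvg_norm; apply: cvgB; [exact: cvg_cst|exact: cZ].
      apply: continuous_bigsum => i s; apply: cvg_norm; apply: cvgB; first exact: cvg_cst.
      by have [_ /(_ e e01)[/(_ m U aU)[cY _] _]] := hY i; exact: cY.
    - rewrite /norm1 big1 ?subrr ?normr0 ?addr0 ?mulr0// => i _.
      by rewrite subrr normr0.
  have -> : H (fun=> 0) 0 = H (fun i : I => e * 0) (e ^+ 2 * 0).
    by rewrite !mulr0.
  rewrite (le_trans (HLe _ _ _ _ e01))// /C mulrA ler_wpM2l ?mulr_ge0//; first exact: ltW.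
  rewrite subr0 lerD// /norm1; apply: ler_sum => i _; rewrite subr0.
  by have [_ /(_ e e01)[/(_ m U aU)[_ dY] _]] := hY i; exact: dY.
rewrite (le_trans (HLe _ _ _ _ e01))// /C -[e * L * _]mulrA ler_wpM2l ?(ltW e0)//.
rewrite -mulrA ler_wpM2l// mulrDl lerD//; last exact: lZ.
rewrite mulr_suml /norm1; apply: ler_sum => i _.
by have [_ /(_ e e01)[_ lY]] := hY i; exact: lY.
Qed.

Lemma nice_comp : nice comp.
Proof.
have [C C0 hC] := comp_lip; exists (`|H (fun=> 0) 0| + C) => [|e e01]; first exact: addr_ge0.
have [b1 l1] := hC e e01; have /andP[e0 e1] := e01.
split=> [m U aU|m m' U U' d aU aU' md UU' t].
  have [c1 d1] := b1 m U aU; split=> // t.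
  rewrite -[comp e m U t](subrK (H (fun=> 0) 0)) addrC (le_trans (ler_normD _ _))// lerD//.
  by rewrite (le_trans (d1 t))// ler_piMl.
have d0 : 0 <= d by rewrite (le_trans _ md).
rewrite (le_trans (l1 _ _ _ _ _ aU aU' md UU' t))// (@le_trans _ _ (C * d))//.
  by rewrite ler_piMl// mulr_ge0.
by rewrite ler_wpM2r// lerDr.
Qed.

(** Precomposition with the dilation gains a factor [e], and [H] vanishes at the origin, so the
    quotient by [e] is still bounded and Lipschitz uniformly in [e]. This lets the metric defect
    [1 - G] enter the source after division by [e]. *)
Lemma nice_comp_div : H (fun=> 0) 0 = 0 -> nice (fun e m U t => comp e m U t / e).
Proof.
move=> H0; have [C C0 hC] := comp_lip; exists C => // e e01.
have [b1 l1] := hC e e01; have /andP[e0 e1] := e01.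
split=> [m U aU|m m' U U' d aU aU' md UU' t].
  have [c1 d1] := b1 m U aU; split=> t; first by apply: cvgM; [exact: c1|exact: cvg_cst].
  rewrite normrM (ger0_norm (ltW (_ : 0 < e^-1))) ?invr_gt0// ler_pdivrMr// mulrC.
  by have := d1 t; rewrite H0 subr0.
rewrite -mulrBl normrM (ger0_norm (ltW (_ : 0 < e^-1))) ?invr_gt0// ler_pdivrMr// mulrC.
exact: l1.
Qed.

End composition.

End functionals.

Section trig_lipschitz.
Context {R : realType}.

Lemma derive_lip1 (f df : R -> R) : (forall x : R, is_derive x 1 f (df x)) ->
  (forall x, `|df x| <= 1) -> forall x y : R, `|f x - f y| <= `|x - y|.
Proof.
move=> fdf df1 x y; wlog yx : x y / y <= x.
  by move=> h; have [/h//|/ltW/h] := leP y x; rewrite distrC (distrC y).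
have cf : continuous f.
  by move=> z; apply/differentiable_continuous/derivable1_diffP; have [] := fdf z.
have [|c _ ->] := @MVT_segment _ f df y x yx; first exact: continuous_subspaceT.
by rewrite normrM ler_piMl.
Qed.

Lemma norm_sin_le1 (x : R) : `|sin x| <= 1.
Proof. by rewrite ler_norml sin_geN1 sin_le1. Qed.

Lemma norm_cos_le1 (x : R) : `|cos x| <= 1.
Proof. by rewrite ler_norml cos_geN1 cos_le1. Qed.

Lemma sin_lip (x y : R) : `|sin x - sin y| <= `|x - y|.
Proof. exact: derive_lip1 norm_cos_le1 x y. Qed.

End trig_lipschitz.

(** * The two-point problem with constant coefficients *)

Section rotation_bvp.
Context {R : realType} (d : nat) (beta : 'I_d -> R) (lo hi : R).
Notation I := ('I_d * bool)%type.
Hypothesis lohi : lo <= hi.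
Hypothesis nopole : forall m, lo <= m <= hi -> forall j, sin (m * beta j / 2) != 0.
Variable X : I -> R.

(** An index [(j, b)] names an axis of the [j]-th plane. The quarter turn of that plane exchanges an
    axis with its [partner], up to the sign [sgnb]. *)
Definition sgnb (b : bool) : R := if b then -1 else 1.
Definition partner (i : I) : I := (i.1, ~~ i.2).

Lemma sgnbN b : sgnb (~~ b) = - sgnb b. Proof. by case: b; rewrite /= ?opprK. Qed.
Lemma sgnb2 b : sgnb b * sgnb b = 1. Proof. by case: b; rewrite /= ?mulrNN mulr1. Qed.
Lemma partnerK : involutive partner. Proof. by case=> j b; rewrite /partner /= negbK. Qed.

Definition angle (m : R) (i : I) : R := m * beta i.1.
Definition cs m i t : R := cos (angle m i * clamp01 t).
Definition sn m i t : R := sin (angle m i * clamp01 t).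
(* [unrot m F] is the curve [F] seen in the frame rotating with speed
   [angle m], on each plane. *)
Definition unrot m (F : I -> R -> R) i t : R :=
  cs m i t * F i t + sgnb i.2 * (sn m i t * F (partner i) t).
Definition rot m (F : I -> R -> R) i t : R :=
  cs m i t * F i t - sgnb i.2 * (sn m i t * F (partner i) t).
(** Variation of constants for [y' = V + Omega y + r] and [y 0 = 0], where [Omega] generates the
    rotation. In the rotating frame [Qop] is the contribution of [r] alone; [Dop] is the
    displacement left to the constant vector, [Vop] the constant vector for which [y 1 = X], [Yop]
    the solution and [Lop] its velocity. *)
Definition Qop m (r : I -> R -> R) i : R -> R := prim (unrot m r i).
Definition Dop m r i : R := X i - rot m (Qop m r) i 1.
Definition Vop m r i : R := angle m i / 2 *
  (cos (angle m i / 2) / sin (angle m i / 2) * Dop m r i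
   + sgnb i.2 * Dop m r (partner i)).
Definition Pop m r i : R -> R :=
  prim (fun t => unrot m (fun i s => Vop m r i + r i s) i t).
Definition Yop m r i t : R := rot m (Pop m r) i t.
Definition Lop m r i t : R :=
  Vop m r i - sgnb i.2 * (angle m i * Yop m r (partner i) t) + r i t.

Lemma cs_continuous m i : continuous (cs m i).
Proof.
move=> t; apply: (@continuous_comp _ _ _ (fun t => angle m i * clamp01 t) cos).
  by apply: cvgM; [exact: cvg_cst|exact: clampr_continuous].
exact: continuous_cos.
Qed.

Lemma sn_continuous m i : continuous (sn m i).
Proof.
move=> t; apply: (@continuous_comp _ _ _ (fun t => angle m i * clamp01 t) sin).
  by apply: cvgM; [exact: cvg_cst|exact: clampr_continuous].
exact: continuous_sin.
Qed.

Lemma near_clamp01 (t : R) : 0 < t < 1 -> \forall s \near t, clamp01 s = s.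
Proof.
move=> t01; have t01' : t \in `]0, 1[ by rewrite in_itv.
have := near_in_itvoo t01'; apply: filterS => s; rewrite in_itv/= => /andP[s0 s1].
by rewrite clamp01_id// !ltW.
Qed.

Lemma cs_derive m i (t : R) : 0 < t < 1 ->
  is_derive t 1 (cs m i) (- angle m i * sn m i t).
Proof.
move=> t01.
have t0 : clamp01 t = t by case/andP: t01 => ? ?; rewrite clamp01_id// !ltW.
have d1 : is_derive t 1 (fun s : R => angle m i *: (s : R)) (angle m i *: 1) by exact: is_deriveZ.
have d2 : is_derive t 1 (cos \o (fun s : R => angle m i *: (s : R)))
    (- sin (angle m i *: t) * (angle m i *: 1)).
  apply: is_derive1_comp; exact: is_derive_cos.
rewrite /sn t0; have -> : - angle m i * sin (angle m i * t) =
  - sin (angle m i *: t) * (angle m i *: 1) by rewrite /GRing.scale /=; ring.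
apply: near_eq_is_derive d2; have := near_clamp01 t01.
by apply: filterS => s; rewrite /cs /= => ->.
Qed.

Lemma sn_derive m i (t : R) : 0 < t < 1 ->
  is_derive t 1 (sn m i) (angle m i * cs m i t).
Proof.
move=> t01.
have t0 : clamp01 t = t by case/andP: t01 => ? ?; rewrite clamp01_id// !ltW.
have d1 : is_derive t 1 (fun s : R => angle m i *: (s : R)) (angle m i *: 1) by exact: is_deriveZ.
have d2 : is_derive t 1 (sin \o (fun s : R => angle m i *: (s : R)))
    (cos (angle m i *: t) * (angle m i *: 1)).
  apply: is_derive1_comp; exact: is_derive_sin.
rewrite /cs t0; have -> : angle m i * cos (angle m i * t) =
  cos (angle m i *: t) * (angle m i *: 1) by rewrite /GRing.scale /=; ring.
apply: near_eq_is_derive d2; have := near_clamp01 t01.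
by apply: filterS => s; rewrite /sn /= => ->.
Qed.

Lemma cs2sn2 m i t : cs m i t ^+ 2 + sn m i t ^+ 2 = 1.
Proof. exact: cos2Dsin2. Qed.

Lemma cs_partner m i : cs m (partner i) = cs m i. Proof. by []. Qed.
Lemma sn_partner m i : sn m (partner i) = sn m i. Proof. by []. Qed.

Section fixed_source.
Variables (m : R) (r : I -> R -> R).
Hypothesis mitv : lo <= m <= hi.
Hypothesis cr : forall i, continuous (r i).

Lemma unrot_continuous (F : I -> R -> R) i :
  (forall i, continuous (F i)) -> continuous (unrot m F i).
Proof.
move=> cF t; apply: cvgD; first by apply: cvgM; [exact: cs_continuous|exact: cF].
apply: cvgM; first exact: cvg_cst.
by apply: cvgM; [exact: sn_continuous|exact: cF].
Qed.

Lemma rot_continuous (F : I -> R -> R) i :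
  (forall i, continuous (F i)) -> continuous (rot m F i).
Proof.
move=> cF t; apply: cvgB; first by apply: cvgM; [exact: cs_continuous|exact: cF].
apply: cvgM; first exact: cvg_cst.
by apply: cvgM; [exact: sn_continuous|exact: cF].
Qed.

Let cVr i : continuous (fun s => Vop m r i + r i s).
Proof. by move=> t; apply: cvgD; [exact: cvg_cst|exact: cr]. Qed.

Lemma Pop_continuous i : continuous (Pop m r i).
Proof. by apply: prim_continuous; apply: unrot_continuous => j; exact: cVr. Qed.

Lemma Yop_continuous i : continuous (Yop m r i).
Proof. by apply: rot_continuous => j; exact: Pop_continuous. Qed.

Lemma Lop_continuous i : continuous (Lop m r i).
Proof.
move=> t; apply: cvgD; last exact: cr.
apply: cvgB; first exact: cvg_cst.
apply: cvgM; first exact: cvg_cst.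
by apply: cvgM; [exact: cvg_cst|exact: Yop_continuous].
Qed.

Lemma Yop0 i : Yop m r i 0 = 0.
Proof.
by rewrite /Yop /rot /Pop !prim0 ?mulr0 ?subrr//; apply: unrot_continuous => j; exact: cVr.
Qed.

Lemma Yop_derive i (t : R) : 0 < t < 1 -> is_derive t 1 (Yop m r i) (Lop m r i t).
Proof.
move=> t01.
have dP j : is_derive t 1 (Pop m r j) (unrot m (fun i s => Vop m r i + r i s) j t).
  by apply: (prim_derive _ t01); apply: unrot_continuous => k; exact: cVr.
have d1 := is_deriveM (cs_derive m i t01) (dP i).
have d2 := is_deriveZ (sgnb i.2) (is_deriveM (sn_derive m i t01) (dP (partner i))).
have d3 := is_deriveB d1 d2.
apply: (is_derive_eq d3).
rewrite /GRing.scale /= /Lop /Yop /rot /unrot cs_partner sn_partner partnerK /= sgnbN.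
have := cs2sn2 m i t; have := sgnb2 i.2.
set s := sgnb i.2; set c := cs m i t; set S := sn m i t => ss cc.
set A := Pop _ _ _ _; set B := Pop _ _ _ _; set v := Vop m r i + r i t.
set v' := Vop m r (partner i) + r (partner i) t.
have -> : Vop m r i = v - r i t by rewrite /v; ring.
have -> : c * (c * v + s * (S * v')) + A * (- angle m i * S) -
    s * (S * (c * v' + - s * (S * v)) + B * (angle m i * c)) =
  (c ^+ 2 + s * s * S ^+ 2) * v - (A * angle m i * S + s * (B * (angle m i * c))) by ring.
rewrite ss mul1r cc mul1r.
have -> : s * (angle m i * (c * B - - s * (S * A))) =
   s * (B * (angle m i * c)) + s * s * (A * angle m i * S) by ring.
by rewrite ss; ring.
Qed.

Lemma angle_neq0 i : angle m i != 0.
Proof.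
apply/eqP => a0; have := nopole mitv i.1; rewrite /angle in a0.
by rewrite a0 mul0r sin0 eqxx.
Qed.

Let clamp1 : clamp01 (1 : R) = 1. Proof. by rewrite clamp01_id// ler01 lexx. Qed.

(** The constant part integrates in closed form against the rotation, at the price of a division by
    the angle. *)
Let Pop1 i : Pop m r i 1 = Qop m r i 1
  + (sn m i 1 * Vop m r i + sgnb i.2 * ((1 - cs m i 1) * Vop m r (partner i))) / angle m i.
Proof.
have a0 := angle_neq0 i.
pose F : R -> R := Qop m r i + (fun t => (angle m i)^-1 *:
   (Vop m r i *: sn m i t + (sgnb i.2 * Vop m r (partner i)) *: (1 - cs m i t) : R)).
have cu : continuous (unrot m r i) by exact: unrot_continuous.
have cF : continuous F.
  move=> t; apply: cvgD; first exact: prim_continuous.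
  apply: cvgM; first exact: cvg_cst.
  apply: cvgD; (apply: cvgM; first exact: cvg_cst); first exact: sn_continuous.
  by apply: cvgB; [exact: cvg_cst|exact: cs_continuous].
have -> : Pop m r i 1 = F 1; last by rewrite /F !fctE /GRing.scale /=; congr (_ + _); field.
symmetry; apply: prim_unique => //.
- by apply: unrot_continuous => k; exact: cVr.
- rewrite /F !fctE /Qop prim0// add0r /GRing.scale /= /sn /cs clamp01_id ?lexx ?ler01//.
  by rewrite mulr0 sin0 cos0 subrr !mulr0 addr0 mulr0.
- move=> t t01.
  have d1 := prim_derive cu t01.
  have d2 := is_deriveZ (Vop m r i) (sn_derive m i t01).
  have d3 := is_deriveZ (sgnb i.2 * Vop m r (partner i))
    (is_deriveB (is_derive_cst (1 : R) t 1) (cs_derive m i t01)).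
  have d4 := is_deriveD d1 (is_deriveZ (angle m i)^-1 (is_deriveD d2 d3)).
  apply: (is_derive_eq d4); rewrite /unrot /GRing.scale /=; field.
  exact: a0.
- by rewrite ler01 lexx.
Qed.

(** A constant [V] contributes to [Pop] at time [1] through a matrix of determinant
    [4 sin^2 (angle / 2) / angle^2]. [Vop] is obtained by inverting it in half angles, so that [Pop]
    at time [1] is [Qop] plus [Dop] seen in the rotating frame; rotating back yields [X]. *)
Lemma Yop1 i : Yop m r i 1 = X i.
Proof.
have a0 := angle_neq0 i; have s0 := nopole mitv i.1.
have E : sn m i 1 = 2 * sin (angle m i / 2) * cos (angle m i / 2).
  rewrite /sn clamp1 mulr1 [in LHS](splitr (angle m i)) sinD; ring.
have E' : cs m i 1 = 1 - 2 * sin (angle m i / 2) ^+ 2.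
  rewrite /cs clamp1 mulr1 [in LHS](splitr (angle m i)) cosD.
  by have := cos2Dsin2 (angle m i / 2); lra.
have E2 : cs m i 1 = cos (angle m i / 2) ^+ 2 - sin (angle m i / 2) ^+ 2.
  by rewrite E'; have := cos2Dsin2 (angle m i / 2); lra.
have h j : j.1 = i.1 -> Pop m r j 1 =
    Qop m r j 1 + (cs m i 1 * Dop m r j + sgnb j.2 * (sn m i 1 * Dop m r (partner j))).
  move=> ji; rewrite Pop1 /Vop partnerK.
  have -> : angle m (partner j) = angle m i by rewrite /angle /= ji.
  have -> : angle m j = angle m i by rewrite /angle ji.
  have -> : sn m j 1 = sn m i 1 by rewrite /sn /angle ji.
  have -> : cs m j 1 = cs m i 1 by rewrite /cs /angle ji.
  congr (_ + _); rewrite /= sgnbN E {1}E' E2.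
  have ss := sgnb2 j.2; set s := sgnb j.2 in ss *.
  set D := Dop m r j; set D' := Dop m r (partner j).
  set S := sin (angle m i / 2); set c := cos (angle m i / 2).
  have -> : 1 - (1 - 2 * S ^+ 2) = 2 * S ^+ 2 by ring.
  have -> : (2 * S * c * (angle m i / 2 * (c / S * D + s * D')) +
     s * (2 * S ^+ 2 * (angle m i / 2 * (c / S * D' + - s * D)))) / angle m i =
     (c ^+ 2 - s * s * S ^+ 2) * D + s * (2 * S * c * D') by field; rewrite a0 s0.
  by rewrite ss mul1r.
rewrite /Yop /rot (h i erefl) (h (partner i) erefl) partnerK /= sgnbN.
have := cs2sn2 m i 1; have := sgnb2 i.2.
have := erefl (Dop m r i); rewrite {2}/Dop /rot.
set s := sgnb i.2; set c := cs m i 1; set S := sn m i 1 => ED ss cc.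
set D := Dop m r i in ED *; set D' := Dop m r (partner i).
set Q := Qop m r i 1 in ED *; set Q' := Qop m r (partner i) 1 in ED *.
have -> : X i = D + c * Q - s * (S * Q') by rewrite ED; ring.
have -> : c * (Q + (c * D + s * (S * D'))) - s * (S * (Q' + (c * D' + - s * (S * D)))) =
  (c ^+ 2 + s * s * S ^+ 2) * D + c * Q - s * (S * Q') by ring.
by rewrite ss mul1r cc mul1r.
Qed.

End fixed_source.

Let mbound (m : R) : lo <= m <= hi -> `|m| <= `|lo| + `|hi|.
Proof.
move=> /andP[h1 h2]; have := ler_norm lo; have := ler_norm hi.
have := ler_norm (- lo); have := ler_norm (- hi); rewrite !normrN ler_norml.
have := normr_ge0 lo; have := normr_ge0 hi; move=> *; apply/andP; split; lra.
Qed.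

Variable rad : R.
Notation nice := (@nice R ('I_d * bool)%type rad lo hi).

Let nice_trig (f df : R -> R) (b : R) : (forall x : R, is_derive x 1 f (df x)) ->
  (forall x, `|f x| <= 1) -> (forall x, `|df x| <= 1) ->
  nice (fun _ m _ t => f (m * b * clamp01 t)).
Proof.
move=> dff f1 df1.
have cf : continuous f.
  by move=> z; apply/differentiable_continuous/derivable1_diffP; have [] := dff z.
apply: (@nice_fun _ _ _ _ _ (fun m t => f (m * b * t)) (1 + `|b|)) => //.
- move=> m _; split=> t.
    apply: continuous_comp; last exact: cf.
    by apply: cvgM; [exact: cvg_cst|exact: cvg_id].
  by rewrite (le_trans (f1 _))// lerDl.
- move=> m m' _ _ t /andP[t0 t1]; rewrite (le_trans (derive_lip1 dff df1 _ _))//.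
  rewrite -!mulrBl !normrM mulrDl mul1r (ger0_norm t0) mulrC.
  have := normr_ge0 (m - m'); have := normr_ge0 b => b0 m0.
  rewrite (@le_trans _ _ (`|m - m'| * `|b|))//; last by lra.
  by rewrite ler_piMl// mulr_ge0.
Qed.

Lemma nice_cs i : nice (fun _ m _ => cs m i).
Proof.
apply: (@nice_trig cos (fun x => - sin x)) => x; first exact: norm_cos_le1.
by rewrite normrN norm_sin_le1.
Qed.

Lemma nice_sn i : nice (fun _ m _ => sn m i).
Proof.
apply: (@nice_trig sin cos) => x; [exact: norm_sin_le1|exact: norm_cos_le1].
Qed.

Lemma nice_angle i : nice (fun _ m _ _ => angle m i).
Proof.
apply: (@nice_fun _ _ _ _ _ (fun m _ => angle m i) ((`|lo| + `|hi| + 1) * `|beta i.1|)).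
- by rewrite mulr_ge0// !addr_ge0.
- move=> m /mbound mb; split=> t; first exact: cst_continuous.
  by rewrite normrM ler_wpM2r// (le_trans mb)// lerDl.
- move=> m m' _ _ t _; rewrite /angle -mulrBl normrM mulrC ler_wpM2r//.
  by rewrite ler_peMl// lerDr addr_ge0.
Qed.

(** Compactness turns the absence of poles into a positive lower bound [s0] for the sine. The
    constants of [Vop], [Yop] and [Lop] degenerate near a pole only through this one. *)
Lemma nice_invsin i : nice (fun _ m _ _ => (sin (angle m i / 2))^-1).
Proof.
have cs2 : continuous (fun m : R => `|sin (angle m i / 2)|).
  move=> m; apply: cvg_norm; apply: (@continuous_comp _ _ _ (fun m => angle m i / 2) sin).
    by do 2 (apply: cvgM; last exact: cvg_cst); exact: cvg_id.
  exact: continuous_sin.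
have [|c] := @EVT_min _ (fun m : R => `|sin (angle m i / 2)|) lo hi lohi.
  exact: continuous_subspaceT.
rewrite in_itv/= => chl hmin.
set s0 := `|sin (angle c i / 2)| in hmin.
have s0p : 0 < s0 by rewrite normr_gt0; exact: nopole.
have smin m : lo <= m <= hi -> s0 <= `|sin (angle m i / 2)|.
  by move=> mh; apply: hmin; rewrite in_itv.
apply: (@nice_fun _ _ _ _ _ (fun m _ => (sin (angle m i / 2))^-1)
   (s0^-1 + `|beta i.1| / (s0 * s0))).
- by rewrite addr_ge0 ?invr_ge0 ?mulr_ge0 ?invr_ge0 ?mulr_ge0// ltW.
- move=> m mh; split=> t; first exact: cst_continuous.
  rewrite normfV (@le_trans _ _ s0^-1)//; first by rewrite lef_pV2 ?posrE ?smin// (lt_le_trans s0p)// smin.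
  by rewrite lerDl mulr_ge0 ?invr_ge0 ?mulr_ge0// ltW.
- move=> m m' mh m'h t _.
  have n0 := nopole mh i.1; have n0' := nopole m'h i.1.
  have -> : (sin (angle m i / 2))^-1 - (sin (angle m' i / 2))^-1 =
     (sin (angle m' i / 2) - sin (angle m i / 2)) / (sin (angle m i / 2) * sin (angle m' i / 2)).
    by field; rewrite n0 n0'.
  rewrite normrM normfV (@le_trans _ _ (`|beta i.1| * `|m - m'| / (s0 * s0)))//; last first.
    by rewrite mulrDl -[leRHS]addrC mulrAC lerDl mulr_ge0 ?invr_ge0// ltW.
  apply: ler_pM => //.
    rewrite (le_trans (sin_lip _ _))// /angle -!mulrBl !normrM distrC (mulrC `|beta _|).
    by rewrite ler_piMr ?mulr_ge0// ger0_norm ?invr_ge0// invf_le1// ler1n.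
  rewrite lef_pV2 ?posrE ?normrM ?mulr_gt0//; first by apply: ler_pM; rewrite ?smin// ltW.
    by rewrite (lt_le_trans s0p)// smin.
  by rewrite (lt_le_trans s0p)// smin.
Qed.

Let nice_eq (Th Th' : R -> R -> (I -> R -> R) -> R -> R) :
  (forall e m U t, Th e m U t = Th' e m U t) -> nice Th -> nice Th'.
Proof.
move=> E; congr nice; apply/funext => e; apply/funext => m; apply/funext => U.
by apply/funext => t; exact: E.
Qed.

Let nice_unrot (F : R -> (I -> R -> R) -> I -> R -> R) i :
  (forall i, nice (fun _ m r => F m r i)) ->
  nice (fun _ m r => unrot m (F m r) i).
Proof.
move=> nF; apply: nice_add; first by apply: nice_mul; [exact: nice_cs|exact: nF].
by apply: nice_scale; apply: nice_mul; [exact: nice_sn|exact: nF].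
Qed.

Let nice_rot (F : R -> (I -> R -> R) -> I -> R -> R) i :
  (forall i, nice (fun _ m r => F m r i)) ->
  nice (fun _ m r => rot m (F m r) i).
Proof.
move=> nF; apply: nice_sub; first by apply: nice_mul; [exact: nice_cs|exact: nF].
by apply: nice_scale; apply: nice_mul; [exact: nice_sn|exact: nF].
Qed.

Let nice_Q i : nice (fun _ m r => Qop m r i).
Proof. 
apply: (@nice_prim _ _ _ _ _ (fun _ m r => unrot m r i)).
by apply: (@nice_unrot (fun _ r => r) i) => j; exact: nice_arg.
Qed.

Let nice_D i : nice (fun _ m r _ => Dop m r i).
Proof.
apply: nice_sub; first exact: nice_cst.
apply: (@nice_eval _ _ _ _ _ (fun _ m r => rot m (Qop m r) i)).
by apply: (@nice_rot Qop); exact: nice_Q.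
Qed.

Let nice_half i : nice (fun _ m _ _ => cos (angle m i / 2)).
Proof.
(* The cosine of the half angle is [cs] at time [1/2]. *)
have h : clamp01 (2^-1 : R) = 2^-1 by rewrite clamp01_id// invr_ge0 ler0n invf_le1// ler1n.
by apply: nice_eq (nice_eval 2^-1 (nice_cs i)) => e m U t; rewrite /cs h.
Qed.

Lemma nice_Vop i : nice (fun _ m r _ => Vop m r i).
Proof.
apply: nice_mul; first by apply: nice_mul; [exact: nice_angle|exact: nice_cst].
apply: nice_add; last by apply: nice_scale; exact: nice_D.
apply: nice_mul; last exact: nice_D.
by apply: nice_mul; [exact: nice_half|exact: nice_invsin].
Qed.

Lemma nice_Yop i : nice (fun _ m r => Yop m r i).
Proof.
apply: (@nice_rot Pop) => j.
apply: (@nice_prim _ _ _ _ _ (fun _ m r => unrot m (fun i s => Vop m r i + r i s) j)).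
apply: (@nice_unrot (fun m r i s => Vop m r i + r i s)) => k.
by apply: nice_add; [exact: nice_Vop|exact: nice_arg].
Qed.

Lemma nice_Lop i : nice (fun _ m r => Lop m r i).
Proof.
apply: nice_add; last exact: nice_arg.
apply: nice_sub; first exact: nice_Vop.
by apply: nice_scale; apply: nice_mul; [exact: nice_angle|exact: nice_Yop].
Qed.

End rotation_bvp.

(** Strict opposite signs survive perturbations smaller than both distances to [zt]. The minimum and
    the maximum are those of the intermediate value theorem, which does not ask which end is
    lower. *)
Lemma stable_sign_change {R : realType} (p q zt : R) : (p - zt) * (q - zt) < 0 ->
  exists2 gap : R, 0 < gap & forall p' q', `|p' - p| < gap -> `|q' - q| < gap ->
    Num.min p' q' <= zt <= Num.max p' q'.
Proof.
move=> hz; exists (Num.min `|p - zt| `|q - zt|).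
  by rewrite lt_min !normr_gt0 -negb_or -mulf_eq0 lt_eqF.
move=> p' q'; rewrite !lt_min ge_min le_max => /andP[h1 _] /andP[_ h2].
have [a0|a0] := ltP (p - zt) 0.
  have b0 : 0 < q - zt by rewrite -(nmulr_rlt0 _ a0).
  move: h1 h2; rewrite (ltr0_norm a0) (gtr0_norm b0) !ltr_norml => /andP[? ?] /andP[? ?].
  by apply/andP; split; apply/orP; [left|right]; lra.
have a0' : 0 < p - zt.
  by rewrite lt_def a0 andbT; apply: contraTneq hz => ->; rewrite mul0r ltxx.
have b0 : q - zt < 0 by rewrite -(pmulr_rlt0 _ a0').
move: h1 h2; rewrite (gtr0_norm a0') (ltr0_norm b0) !ltr_norml => /andP[? ?] /andP[? ?].
by apply/andP; split; apply/orP; [right|left]; lra.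
Qed.

Lemma lipschitz_IVT {R : realType} (phi : R -> R) (lo hi zt C : R) : lo <= hi -> 0 <= C ->
  (forall m m', lo <= m <= hi -> lo <= m' <= hi -> `|phi m - phi m'| <= C * `|m - m'|) ->
  Num.min (phi lo) (phi hi) <= zt <= Num.max (phi lo) (phi hi) ->
  exists2 c, lo <= c <= hi & phi c = zt.
Proof.
move=> lohi C0 lphi hz.
have cphi : continuous (fun m => phi (clampr lo hi m)).
  move=> m; apply: (@continuous_dominated _ _ (fun s => C * `|m - s|)).
  - move=> s; rewrite (le_trans (lphi _ _ (clampr_itv _ lohi) (clampr_itv _ lohi)))//.
    by rewrite ler_wpM2l// clampr_lip.
  - apply: cvgM; first exact: cvg_cst.
    by apply: cvg_norm; apply: cvgB; [exact: cvg_cst|exact: cvg_id].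
  - by rewrite subrr normr0 mulr0.
have [|c] := @IVT _ (fun m => phi (clampr lo hi m)) lo hi zt lohi (continuous_subspaceT cphi).
  by rewrite !clampr_id// lexx lohi.
by rewrite in_itv/= => ch; rewrite clampr_id//; exists c.
Qed.

Section geodesic_equations.
Context {R : realType} {I : finType}.

(* [u] is the velocity, [mu] the multiplier of the contact constraint; [D] and
   [Dz] are the partial derivatives of the metric coefficients [G]. *)
Definition geodesic_eqs (W : I -> I -> R) (G : I -> I -> (I -> R) -> R -> R)
    (D : I -> I -> I -> (I -> R) -> R -> R) (Dz : I -> I -> (I -> R) -> R -> R)
    (y : R -> I -> R) (z : R -> R) (u : R -> I -> R) (mu : R -> R) :=
  [/\ forall i, continuous (fun t => y t i), continuous z,
      forall i, continuous (fun t => u t i), continuous mu &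
  forall t : R, 0 < t < 1 ->
  [/\ forall i, is_derive t 1 (fun s => y s i) (u t i),
      is_derive t 1 z (2^-1 * bil W (y t) (u t)),
      is_derive t 1 mu (2^-1 * bil (fun i j => Dz i j (y t) (z t)) (u t) (u t)) &
      forall k, is_derive t 1 (fun s => momentum (fun i j => G i j (y s) (z s)) (u s) k)
       (2^-1 * bil (fun i j => D i j k (y t) (z t)) (u t) (u t)
        + 2^-1 * (2^-1 * bil (fun i j => Dz i j (y t) (z t)) (u t) (u t)) * contrW W (y t) k
        + mu t * contrW W (u t) k)]].

End geodesic_equations.

(** * The rescaled geodesic equations *)

Section geodesic_bvp.
Context {R : realType} (d : nat) (beta : 'I_d -> R).
Notation I := ('I_d * bool)%type.

Definition planeW (i k : I) : R :=
  if (i.1 == k.1) && (k.2 == ~~ i.2) then sgnb i.2 * beta i.1 else 0.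

Lemma planeW_asym i k : planeW i k = - planeW k i.
Proof.
rewrite /planeW; case: i k => [j b] [j' b'] /=; rewrite (eq_sym j').
case: eqVneq => [->|_]/=; last by rewrite oppr0.
by case: b b' => -[] /=; rewrite ?oppr0// ?mulN1r ?mul1r ?opprK.
Qed.

Lemma contr_planeW (y : I -> R) k :
  contrW planeW y k = - (sgnb k.2 * (beta k.1 * y (partner k))).
Proof.
rewrite /contrW (bigD1 (partner k))//= big1 ?addr0; last first.
  move=> i /eqP ik; rewrite /planeW; case: ifPn => [/andP[/eqP h1 /eqP h2]|]; last by rewrite mul0r.
  by case: ik; case: i k h1 h2 => [j b] [j' b'] /= -> ->; rewrite /partner /= negbK.
by rewrite /planeW /= eqxx negbK eqxx /= sgnbN; ring.
Qed.

Variables (G : I -> I -> (I -> R) -> R -> R).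
Variables (D : I -> I -> I -> (I -> R) -> R -> R) (Dz : I -> I -> (I -> R) -> R -> R).
Variable L : R.
Hypothesis L0 : 0 <= L.
Definition lip_yz (H : (I -> R) -> R -> R) := forall y z y' z',
  `|H y z - H y' z'| <= L * (norm1 (fun i => y i - y' i) + `|z - z'|).
Hypotheses (GL : forall i j, lip_yz (G i j)) (DL : forall i j k, lip_yz (D i j k))
  (DzL : forall i j, lip_yz (Dz i j)).
Hypothesis G0 : forall i j, G i j (fun=> 0) 0 = (i == j)%:R.

(** [U] is the velocity after rescaling: the geodesic itself is [(e * Ys, e ^+ 2 * Zs)], with
    multiplier [m + e * mus]. The next definitions are the terms of its equations with powers of [e]
    divided out. *)
Definition Ys (U : I -> R -> R) i : R -> R := prim (U i).
Definition Zs (U : I -> R -> R) : R -> R :=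
  prim (fun t => 2^-1 * bil planeW (fun i => Ys U i t) (fun i => U i t)).
Definition along (H : (I -> R) -> R -> R) (e : R) U (t : R) : R :=
  H (fun i => e * Ys U i t) (e ^+ 2 * Zs U t).
Definition dmus (e : R) U (t : R) : R :=
  2^-1 * (e * bil (fun i j => along (Dz i j) e U t) (fun i => U i t) (fun i => U i t)).
Definition mus (e : R) U : R -> R := prim (dmus e U).
Definition force (e : R) U k (t : R) : R :=
  2^-1 * bil (fun i j => along (D i j k) e U t) (fun i => U i t) (fun i => U i t)
  + 2^-1 * (dmus e U t * contrW planeW (fun i => Ys U i t) k)
  + mus e U t * contrW planeW (fun i => U i t) k.
(** Integrating the momentum equation once gives [U = V + m * contrW Y + e * rhat]: the source is
    the integrated force plus the metric defect [(1 - G) / e] applied to [U]. In this form no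
    derivative of [U] appears. *)
Definition rhat (e : R) U k (t : R) : R :=
  prim (force e U k) t
  + \sum_i along (fun y z => (i == k)%:R - G i k y z) e U t / e * U i t.

Section niceness.
Variables rad lo hi : R.
Notation nice := (@nice R ('I_d * bool)%type rad lo hi).

Let nice_bil (B : I -> I -> R -> R -> (I -> R -> R) -> R -> R) a b :
  (forall i j, nice (B i j)) -> (forall i, nice (a i)) -> (forall i, nice (b i)) ->
  nice (fun e m U t => bil (fun i j => B i j e m U t) (fun i => a i e m U t) (fun i => b i e m U t)).
Proof.
move=> nB na nb; apply: nice_sum => i; apply: nice_sum => j.
by apply: nice_mul => //; exact: nice_mul.
Qed.

Let nice_contr a k : (forall i, nice (a i)) ->
  nice (fun e m U t => contrW planeW (fun i => a i e m U t) k).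
Proof. by move=> na; apply: nice_sum => i; exact: nice_scale. Qed.

Lemma nice_Ys i : nice (fun _ _ U => Ys U i).
Proof. exact/nice_prim/nice_arg. Qed.

Lemma nice_dZs : nice (fun _ _ U t => 2^-1 * bil planeW (fun i => Ys U i t) (fun i => U i t)).
Proof.
apply: nice_scale; apply: (@nice_bil (fun i j _ _ _ _ => planeW i j)
  (fun i _ _ U => Ys U i) (fun i _ _ U => U i)) => [i j|i|i].
- exact: nice_cst.
- exact: nice_Ys.
- exact: nice_arg.
Qed.

Lemma nice_Zs : nice (fun _ _ U => Zs U).
Proof. exact: nice_prim nice_dZs. Qed.

Let nice_along H : lip_yz H -> nice (fun e _ U => along H e U).
Proof.
move=> HL; apply: (@nice_comp _ _ _ _ _ H L L0 HL (fun i _ _ U => Ys U i) (fun _ _ U => Zs U)).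
  exact: nice_Ys.
exact: nice_Zs.
Qed.

Lemma nice_dmus : nice (fun e _ U => dmus e U).
Proof.
apply: nice_scale; apply: nice_mul; first exact: nice_eps.
apply: (@nice_bil (fun i j e _ U => along (Dz i j) e U)
  (fun i _ _ U => U i) (fun i _ _ U => U i)) => [i j|i|i]; last 2 first.
- exact: nice_arg.
- exact: nice_arg.
exact: nice_along.
Qed.

Lemma nice_mus : nice (fun e _ U => mus e U).
Proof. exact: nice_prim nice_dmus. Qed.

Lemma nice_force k : nice (fun e _ U => force e U k).
Proof.
apply: nice_add; last first.
  apply: nice_mul; first exact: nice_mus.
  by apply: (@nice_contr (fun i _ _ U => U i)) => i; exact: nice_arg.
apply: nice_add; last first.
  apply: nice_scale; apply: nice_mul; first exact: nice_dmus.
  by apply: (@nice_contr (fun i _ _ U => Ys U i)) => i; exact: nice_Ys.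
apply: nice_scale; apply: (@nice_bil (fun i j e _ U => along (D i j k) e U)
  (fun i _ _ U => U i) (fun i _ _ U => U i)) => [i j|i|i]; last 2 first.
- exact: nice_arg.
- exact: nice_arg.
exact: nice_along.
Qed.

Lemma nice_rhat k : nice (fun e _ U => rhat e U k).
Proof.
apply: nice_add; first exact: nice_prim (nice_force k).
apply: nice_sum => i; apply: nice_mul; last exact: nice_arg.
have HL : lip_yz (fun y z => (i == k)%:R - G i k y z).
  move=> y z y' z'; have -> : (i == k)%:R - G i k y z - ((i == k)%:R - G i k y' z') =
    - (G i k y z - G i k y' z') by ring.
  by rewrite normrN; exact: GL.
apply: (@nice_comp_div _ _ _ _ _ _ L L0 HL (fun i _ _ U => Ys U i) (fun _ _ U => Zs U)).
- exact: nice_Ys.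
- exact: nice_Zs.
- by rewrite G0 subrr.
Qed.

End niceness.

Section existence.
Variables (lo hi : R) (X : I -> R).
Hypothesis lohi : lo <= hi.
Hypothesis nopole : forall m, lo <= m <= hi -> forall j, sin (m * beta j / 2) != 0.

Definition modelU (m : R) : I -> R -> R := Lop beta X m (fun _ _ => 0).
Definition source e U : I -> R -> R := fun k t => e * rhat e U k t.

(** For small [e] the map sending [U] to [Lop] of its source preserves a ball and halves distances,
    with constants independent of [e] and [m]. Comparing fixed points gives both the distance to the
    model and the Lipschitz dependence on [m]. *)
Lemma scaled_solutions : exists rad e0 C : R, [/\ 0 <= rad, 0 < e0 <= 1, 0 <= C &
  forall e : R, 0 < e <= e0 -> exists Us : R -> I -> R -> R,
   (forall m, lo <= m <= hi -> [/\ cball rad (Us m), cball rad (modelU m),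
      forall i t, Lop beta X m (source e (Us m)) i t = Us m i t &
      within_dist (C * e) (Us m) (modelU m)]) /\
   (forall m m', lo <= m <= hi -> lo <= m' <= hi ->
      within_dist (C * `|m - m'|) (Us m) (Us m'))].
Proof.
have /choice[CL' hL'] : forall i, exists C : R, 0 <= C /\ forall e : R, 0 < e <= 1 ->
   (forall m U, admissible 1 lo hi m U ->
      continuous (Lop beta X m U i) /\ forall t, `|Lop beta X m U i t| <= C) /\
   (forall m m' U U' (d : R), admissible 1 lo hi m U -> admissible 1 lo hi m' U' ->
      `|m - m'| <= d -> within_dist d U U' ->
      forall t, `|Lop beta X m U i t - Lop beta X m' U' i t| <= C * d).
  by move=> i; have [C ? ?] := nice_Lop lohi nopole X 1 i; exists C.
pose CL := \sum_i CL' i.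
have CL0 : 0 <= CL by apply: sumr_ge0 => i _; exact: (hL' i).1.
have leCL i : CL' i <= CL.
  by rewrite /CL (bigD1 i)//= lerDl sumr_ge0// => j _; exact: (hL' j).1.
have h01 : (0 < 1 :> R) && (1 <= 1 :> R) by rewrite ltr01 lexx.
have Lb m r : lo <= m <= hi -> cball 1 r -> cball CL (Lop beta X m r).
  move=> mh cr i; have [_ /(_ 1 h01)[/(_ m r (conj mh cr))[h1 h2] _]] := hL' i.
  by split=> // t; rewrite (le_trans (h2 t)).
have Ll m m' r r' (d' : R) : lo <= m <= hi -> lo <= m' <= hi -> cball 1 r -> cball 1 r' ->
    `|m - m'| <= d' -> within_dist d' r r' ->
    within_dist (CL * d') (Lop beta X m r) (Lop beta X m' r').
  move=> mh mh' cr cr' md rd i t.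
  have [_ /(_ 1 h01)[_ /(_ m m' r r' d' (conj mh cr) (conj mh' cr') md rd t)]] := hL' i.
  by move=> /le_trans; apply; rewrite ler_wpM2r// (le_trans _ md).
have /choice[Cr' hr'] : forall i, exists C : R, 0 <= C /\ forall e : R, 0 < e <= 1 ->
   (forall m U, admissible CL lo hi m U ->
      continuous (rhat e U i) /\ forall t, `|rhat e U i t| <= C) /\
   (forall m m' U U' (d : R), admissible CL lo hi m U -> admissible CL lo hi m' U' ->
      `|m - m'| <= d -> within_dist d U U' ->
      forall t, `|rhat e U i t - rhat e U' i t| <= C * d).
  by move=> i; have [C ? ?] := nice_rhat CL lo hi i; exists C.
pose Cr := \sum_i Cr' i.
have Cr0 : 0 <= Cr by apply: sumr_ge0 => i _; exact: (hr' i).1.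
have leCr i : Cr' i <= Cr.
  by rewrite /Cr (bigD1 i)//= lerDl sumr_ge0// => j _; exact: (hr' j).1.
have lolo : lo <= lo <= hi by rewrite lexx lohi.
have rb (e : R) U : 0 < e <= 1 -> cball CL U -> cball (e * Cr) (source e U).
  move=> e01 cU i; have [_ /(_ e e01)[/(_ lo U (conj lolo cU))[h1 h2] _]] := hr' i.
  split=> t; first by apply: cvgM; [exact: cvg_cst|exact: h1].
  have /andP[e0 _] := e01; rewrite normrM (ger0_norm (ltW e0)) ler_wpM2l ?(ltW e0)//.
  by rewrite (le_trans (h2 t)).
have rl (e : R) U U' (d' : R) : 0 < e <= 1 -> 0 <= d' -> cball CL U -> cball CL U' -> within_dist d' U U' ->
    within_dist (e * Cr * d') (source e U) (source e U').
  move=> e01 d'0 cU cU' UU' i t.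
  have [_ /(_ e e01)[_ /(_ lo lo U U' d' (conj lolo cU) (conj lolo cU'))]] := hr' i.
  rewrite subrr normr0 => /(_ d'0 UU' t) h.
  have /andP[e0 _] := e01; rewrite -mulrBr normrM (ger0_norm (ltW e0)) -mulrA ler_wpM2l ?(ltW e0)//.
  by rewrite (le_trans h)// ler_wpM2r.
pose e0 := (2 * ((1 + CL) * (1 + Cr)))^-1.
have den : 1 <= (1 + CL) * (1 + Cr) by rewrite -[leLHS]mulr1 ler_pM// lerDl.
have e0p : 0 < e0 by rewrite invr_gt0 mulr_gt0// (lt_le_trans ltr01).
have e01 : e0 <= 1 by rewrite /e0 invf_le1; lra.
have es (e : R) : 0 < e <= e0 -> e * Cr <= 1 /\ CL * (e * Cr) <= 2^-1.
  move=> /andP[ep ee0].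
  have h : e * ((1 + CL) * (1 + Cr)) <= 2^-1.
    have := ler_wpM2r (le_trans ler01 den) ee0.
    rewrite /e0 invfM mulfVK//.
    by rewrite gt_eqF// (lt_le_trans ltr01).
  have k1 : 0 <= e * CL by rewrite mulr_ge0// ltW.
  have k2 : 0 <= e * Cr by rewrite mulr_ge0// ltW.
  have k3 : 0 <= e * CL * Cr by rewrite mulr_ge0.
  split; lra.
exists CL, e0, (2 * CL * (1 + Cr)); split=> //; first by rewrite e0p.
  by rewrite !mulr_ge0// addr_ge0.
move=> e ee0; have /andP[ep ele] := ee0; have [es1 es2] := es e ee0.
have e1 : 0 < e <= 1 by rewrite ep (le_trans ele).
have rb1 U : cball CL U -> cball 1 (source e U).
  move=> /(rb e U e1) h i; split; first exact: (h i).1.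
  by move=> t; rewrite (le_trans ((h i).2 t)).
have /choice[Us hUs] : forall m, exists U, lo <= m <= hi ->
    cball CL U /\ forall i t, Lop beta X m (source e U) i t = U i t.
  move=> m; have [mh|] := pselect (lo <= m <= hi); last by exists (fun _ _ => 0).
  have [||U cU hU] := @uniform_fixed_point _ _ (fun U => Lop beta X m (source e U)) CL CL0.
  - by move=> U /rb1 h; exact: Lb.
  - move=> U U' d' cU cU' UU' i t.
    have d'0 : 0 <= d' by rewrite (le_trans _ (UU' i t)).
    have := Ll m m _ _ (e * Cr * d') mh mh (rb1 _ cU) (rb1 _ cU').
    rewrite subrr normr0 !mulr_ge0// ?(ltW ep)// => /(_ isT (rl _ _ _ _ e1 d'0 cU cU' UU') i t).
    move=> /le_trans; apply; rewrite mulrA (mulrC d'); exact: ler_wpM2r.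
  by exists U.
have zc : cball 1 (fun (_ : I) (_ : R) => 0 : R).
  by move=> i; split=> t; [exact: cst_continuous|rewrite normr0].
exists Us; split.
  move=> m mh; have [cU hU] := hUs m mh; split=> //; first exact: Lb.
  move=> i t; rewrite -hU.
  have := Ll m m _ _ (e * Cr) mh mh (rb1 _ cU) zc.
  rewrite subrr normr0 mulr_ge0// ?(ltW ep)// => /(_ isT) h.
  apply: (le_trans (h _ i t)); last first.
    by have := mulr_ge0 CL0 (ltW ep); have := mulr_ge0 (mulr_ge0 CL0 Cr0) (ltW ep); lra.
  by move=> k s; rewrite subr0; have := (rb e _ e1 cU k).2 s.
move=> m m' mh mh'; have [cU hU] := hUs m mh; have [cU' hU'] := hUs m' mh'.
(* A distance [d'] between the two fixed points improves to [CL * |m - m'| + d' / 2]; iterating from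
   the crude bound [2 * CL] leaves [2 * CL * |m - m'|]. *)
have step (d' : R) : within_dist d' (Us m) (Us m') ->
    within_dist (CL * `|m - m'| + d' / 2) (Us m) (Us m').
  move=> UU' i t; have d'0 : 0 <= d' by rewrite (le_trans _ (UU' i t)).
  rewrite -hU -hU'.
  have := Ll m m' _ _ (`|m - m'| + e * Cr * d') mh mh' (rb1 _ cU) (rb1 _ cU').
  rewrite lerDl !mulr_ge0// ?(ltW ep)// => /(_ isT) h.
  apply: (le_trans (h _ i t)).
    move=> k s; rewrite (le_trans (rl _ _ _ _ e1 d'0 cU cU' UU' k s))//.
    by rewrite lerDr.
  rewrite mulrDr lerD2l mulrA (mulrC d'); exact: ler_wpM2r.
have it k : within_dist (2 * (CL * `|m - m'|) + (2 * CL) / 2 ^+ k) (Us m) (Us m').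
  elim: k => [|k IH].
    move=> i t; rewrite expr0 divr1.
    have := (cU i).2 t; have := (cU' i).2 t; have := ler_normB (Us m i t) (Us m' i t).
    have := mulr_ge0 CL0 (normr_ge0 (m - m')); lra.
  move=> i t; apply: (le_trans (step _ IH i t)); rewrite exprSr invfM; lra.
move=> i t; rewrite leNgt; apply/negP => hlt.
have c0 : 0 <= 2 * CL by rewrite mulr_ge0.
have m0 := normr_ge0 (m - m').
have k0 : 0 <= CL * Cr * `|m - m'| by rewrite !mulr_ge0.
have pos : 0 < `|Us m i t - Us m' i t| - 2 * (CL * `|m - m'|).
  by move: hlt; lra.
have [k hk] := half_pow_small c0 pos; have := it k i t; lra.
Qed.

Lemma nice_continuous rad (Th : R -> R -> (I -> R -> R) -> R -> R) e m U :
  @nice R ('I_d * bool)%type rad lo hi Th -> 0 < e <= 1 -> lo <= m <= hi ->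
  cball rad U -> continuous (Th e m U).
Proof. by move=> [C C0 h] /h[h1 _] mh cU; have [] := h1 m U (conj mh cU). Qed.

Section one_solution.
Variables (rad e m : R) (U : I -> R -> R).
Hypotheses (e01 : 0 < e <= 1) (mh : lo <= m <= hi) (cU : cball rad U).
Hypothesis fixU : forall i t, Lop beta X m (source e U) i t = U i t.

Let e0 : 0 < e. Proof. by case/andP: e01. Qed.
Let cont Th : @nice R ('I_d * bool)%type rad lo hi Th -> continuous (Th e m U).
Proof. by move=> h; exact: (nice_continuous h e01 mh cU). Qed.
Let cUi i : continuous (U i). Proof. exact: (cU i).1. Qed.
Let cforce k : continuous (force e U k). Proof. exact: (cont (nice_force rad lo hi k)). Qed.
Let cdmus : continuous (dmus e U). Proof. exact: (cont (nice_dmus rad lo hi)). Qed.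
Let csource i : continuous (source e U i).
Proof. by move=> t; apply: cvgM; [exact: cvg_cst|exact: (cont (nice_rhat rad lo hi i))]. Qed.
Let cYs i : continuous (Ys U i). Proof. exact: (cont (nice_Ys rad lo hi i)). Qed.
Let cZs : continuous (Zs U). Proof. exact: (cont (nice_Zs rad lo hi)). Qed.
Let cmus : continuous (mus e U). Proof. exact: (cont (nice_mus rad lo hi)). Qed.
Let cZ' : continuous (fun t => 2^-1 * bil planeW (fun i => Ys U i t) (fun i => U i t)).
Proof. exact: (cont (nice_dZs rad lo hi)). Qed.

Lemma sol_Yop i (t : R) : 0 <= t <= 1 -> Yop beta X m (source e U) i t = Ys U i t.
Proof.
move=> t01; apply: prim_unique => //.
- by apply: Yop_continuous => j; exact: csource.
- by apply: Yop0 => j; exact: csource.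
- move=> s s01; rewrite -fixU; apply: Yop_derive => // j; exact: csource.
Qed.

Lemma sol_Y1 i : Ys U i 1 = X i.
Proof.
by rewrite -sol_Yop ?ler01 ?lexx// (Yop1 nopole)// => j; exact: csource.
Qed.

(** The defect term in [rhat] turns [U] into the momentum [G U]. Every term on the right is
    differentiable, so the momentum is too, although [U] is only known to be continuous. *)
Lemma sol_momentum k (t : R) : 0 <= t <= 1 ->
  \sum_i along (G i k) e U t * U i t =
  Vop beta X m (source e U) k + m * contrW planeW (fun i => Ys U i t) k
  + e * prim (force e U k) t.
Proof.
move=> t01.
have Ek : U k t = Vop beta X m (source e U) k + m * contrW planeW (fun i => Ys U i t) k
     + e * rhat e U k t.
  by rewrite -[LHS]fixU /Lop sol_Yop// contr_planeW /source /angle; ring.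
have Es : e * \sum_i along (fun y z => (i == k)%:R - G i k y z) e U t / e * U i t =
    U k t - \sum_i along (G i k) e U t * U i t.
  rewrite mulr_sumr (eq_bigr (fun i => (i == k)%:R * U i t - along (G i k) e U t * U i t)).
    rewrite sumrB; congr (_ - _); rewrite (bigD1 k)//= eqxx mul1r big1 ?addr0//.
    by move=> j /negPf ->; rewrite mul0r.
  by move=> j _; rewrite /along; field; rewrite gt_eqF.
by move: Ek; rewrite /rhat mulrDr Es; lra.
Qed.

Lemma sol_geodesic_eqs : geodesic_eqs planeW G D Dz (fun t i => e * Ys U i t)
  (fun t => e ^+ 2 * Zs U t) (fun t i => e * U i t) (fun t => m + e * mus e U t).
Proof.
split.
- by move=> i t; apply: cvgM; [exact: cvg_cst|exact: cYs].
- by move=> t; apply: cvgM; [exact: cvg_cst|exact: cZs].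
- by move=> i t; apply: cvgM; [exact: cvg_cst|exact: cUi].
- by move=> t; apply: cvgD; [exact: cvg_cst|apply: cvgM; [exact: cvg_cst|exact: cmus]].
move=> t t01.
have t01' : 0 <= t <= 1 by case/andP: t01 => ? ?; rewrite !ltW.
have dY i : is_derive t 1 (Ys U i) (U i t) by apply: prim_derive.
have bilZ B (a b : I -> R) : bil B (fun i => e * a i) (fun i => e * b i) = e ^+ 2 * bil B a b.
  rewrite /bil mulr_sumr; apply: eq_bigr => i _; rewrite mulr_sumr.
  by apply: eq_bigr => j _; ring.
have contrZ (a : I -> R) k : contrW planeW (fun i => e * a i) k = e * contrW planeW a k.
  by rewrite /contrW mulr_sumr; apply: eq_bigr => i _; ring.
have Emu : 2^-1 * bil (fun i j => along (Dz i j) e U t) (fun i => e * U i t)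
    (fun i => e * U i t) = e * dmus e U t by rewrite bilZ /dmus; ring.
split.
- by move=> i; exact: (is_deriveZ e (dY i)).
- have d1 := is_deriveZ (e ^+ 2) (prim_derive cZ' t01).
  by apply: (is_derive_eq d1); rewrite bilZ /GRing.scale /=; ring.
- have d1 := is_deriveD (is_derive_cst m t 1) (is_deriveZ e (prim_derive cdmus t01)).
  by apply: (is_derive_eq d1); rewrite add0r; exact/esym/Emu.
move=> k.
have dc : is_derive t 1 (fun s => contrW planeW (fun i => Ys U i s) k)
    (contrW planeW (fun i => U i t) k).
  have -> : (fun s => contrW planeW (fun i => Ys U i s) k) =
     - ((sgnb k.2 * beta k.1) *: Ys U (partner k)).
    by apply/funext => s; rewrite contr_planeW !fctE /GRing.scale /=; ring.
  have d1 := is_deriveN (is_deriveZ (sgnb k.2 * beta k.1) (dY (partner k))).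
  by apply: (is_derive_eq d1); rewrite contr_planeW /GRing.scale /=; ring.
have d1 := is_deriveD (is_deriveD (is_derive_cst (Vop beta X m (source e U) k) t 1)
  (is_deriveZ m dc)) (is_deriveZ e (prim_derive (cforce (k := k)) t01)).
have d2 := is_deriveZ e d1.
have d3 : is_derive t 1 (fun s => momentum (fun i j => G i j (fun i => e * Ys U i s) (e ^+ 2 * Zs U s))
    (fun i => e * U i s) k) (e *: (0 + m *: contrW planeW (fun i => U i t) k + e *: force e U k t)).
  apply: near_eq_is_derive d2; have := near_clamp01 t01; apply: filterS => s hs.
  have s01 : 0 <= s <= 1 by rewrite -hs; exact: clamp01_itv.
  transitivity (e * (Vop beta X m (source e U) k
    + m * contrW planeW (fun i => Ys U i s) k + e * prim (force e U k) s)); first by [].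
  rewrite -sol_momentum// mulr_sumr /momentum.
  by apply: eq_bigr => i _; rewrite /along mulrCA.
apply: (is_derive_eq d3); rewrite /GRing.scale /= Emu bilZ !contrZ /force; ring.
Qed.

End one_solution.

(* The [z]-coordinate at time [1] of the constant-coefficient geodesic of
   multiplier [m] whose other coordinates reach [X]. *)
Definition phi0 (m : R) : R := Zs (modelU m) 1.

Lemma geodesic_bvp (zt : R) : (phi0 lo - zt) * (phi0 hi - zt) < 0 ->
  exists e0 B : R, [/\ 0 < e0 <= 1, 0 <= B & forall e : R, 0 < e <= e0 ->
  exists m y z u mu, lo <= m <= hi /\ geodesic_eqs planeW G D Dz y z u mu /\
    [/\ forall i, y 0 i = 0, z 0 = 0, mu 0 = m, forall i, y 1 i = e * X i & z 1 = e ^+ 2 * zt] /\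
    forall t, (forall i, `|y t i| <= B * e) /\ `|z t| <= B * e].
Proof.
move=> hz.
have [rad [e1 [C [rad0 e1p C0 hsol]]]] := scaled_solutions.
have [CZ CZ0 hZ] := nice_Zs rad lo hi.
have h01 : (0 < 1 :> R) && (1 <= 1 :> R) by rewrite ltr01 lexx.
have /(_ 1 h01)[bZ lZ] := hZ.
have lolo : lo <= lo <= hi by rewrite lexx lohi.
have hihi : lo <= hi <= hi by rewrite lexx lohi.
have [gap gap0 hgap] := stable_sign_change hz.
(* Below [e2] the heights of the perturbed solutions are within [gap] of those of the model at both
   ends. *)
pose e2 := gap / (2 * (CZ * C + 1)).
have den : 0 < CZ * C + 1 by rewrite ltr_wpDl// mulr_ge0.
have e2p : 0 < e2 by rewrite divr_gt0// mulr_gt0.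
have /andP[e1p' e1le] := e1p.
exists (Num.min e1 e2), (rad + CZ); split; first by rewrite lt_min e1p' e2p/= ge_min e1le.
  exact: addr_ge0.
move=> e /andP[ep]; rewrite le_min => /andP[ee1 ee2].
have ee : 0 < e <= 1 by rewrite ep (le_trans ee1).
have [|Us [hU lU]] := hsol e; first by rewrite ep.
pose phi m := Zs (Us m) 1.
have close m : lo <= m <= hi -> `|phi m - phi0 m| <= CZ * (C * e).
  move=> mh; have [cU cM _ wd] := hU m mh.
  by apply: (lZ m m _ _ _ (conj mh cU) (conj mh cM)) => //; rewrite subrr normr0 mulr_ge0// ltW.
have lphi m m' : lo <= m <= hi -> lo <= m' <= hi -> `|phi m - phi m'| <= CZ * ((C + 1) * `|m - m'|).
  move=> mh mh'; have [cU _ _ _] := hU m mh; have [cU' _ _ _] := hU m' mh'.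
  apply: (lZ m m' _ _ _ (conj mh cU) (conj mh' cU')).
    by rewrite mulrDl mul1r lerDr mulr_ge0.
  by move=> i t; rewrite (le_trans (lU m m' mh mh' i t))// ler_wpM2r// lerDl.
have small : CZ * (C * e) < gap.
  have h := ler_wpM2l (ltW den) ee2.
  have E : (CZ * C + 1) * e2 = gap / 2 by rewrite /e2; field; rewrite gt_eqF.
  apply: (@le_lt_trans _ _ ((CZ * C + 1) * e)).
    by rewrite mulrDl mul1r mulrA lerDl ltW.
  by rewrite (le_lt_trans h)// E ltr_pdivrMr// ltr_pMr// ltr1n.
have C10 : 0 <= CZ * (C + 1) by rewrite mulr_ge0// addr_ge0.
have lphi' m m' : lo <= m <= hi -> lo <= m' <= hi -> `|phi m - phi m'| <= CZ * (C + 1) * `|m - m'|.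
  by move=> mh mh'; rewrite -mulrA; exact: lphi.
have hmm := hgap _ _ (le_lt_trans (close lo lolo) small) (le_lt_trans (close hi hihi) small).
have [c ch phic] := lipschitz_IVT lohi C10 lphi' hmm.
have [cU cM fixU _] := hU c ch.
exists c, (fun t i => e * Ys (Us c) i t), (fun t => e ^+ 2 * Zs (Us c) t),
  (fun t i => e * Us c i t), (fun t => c + e * mus e (Us c) t).
split=> //; split; first exact: sol_geodesic_eqs ee ch cU fixU.
have cY i : continuous (Us c i) by exact: (cU i).1.
split; last first.
  move=> t; have e_ge0 := ltW ep; split=> [i|].
    rewrite normrM (ger0_norm e_ge0) mulrC ler_wpM2r//.
    by rewrite (le_trans (prim_bound (cY i) (cU i).2 t))// lerDl.
  rewrite normrM ger0_norm ?sqr_ge0// expr2 mulrC mulrA ler_wpM2r//.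
  have [_ h] := bZ c _ (conj ch cU); rewrite (le_trans (ler_pM _ _ (h t) (_ : e <= 1)))//.
    by case/andP: ee.
  by rewrite mulr1 lerDr.
have cZ' : continuous (fun t => 2^-1 * bil planeW (fun i => Ys (Us c) i t) (fun i => Us c i t)).
  exact: (nice_continuous (nice_dZs rad lo hi) ee ch cU).
split.
- by move=> i; rewrite /Ys prim0// mulr0.
- by rewrite /Zs prim0// mulr0.
- by rewrite /mus prim0 ?mulr0 ?addr0//; exact: (nice_continuous (nice_dmus rad lo hi) ee ch cU).
- by move=> i; rewrite (sol_Y1 ee ch cU fixU).
- by rewrite -phic.
Qed.

End existence.

End geodesic_bvp.

(** * The height reached by the model *)

Section model_endpoint.
Context {R : realType} (d : nat) (beta : 'I_d -> R).
Notation I := ('I_d * bool)%type.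
Variables (X : I -> R) (m : R).
Hypothesis nopole : forall j, sin (m * beta j / 2) != 0.
Hypothesis m0 : m != 0.

(** The results on a segment of multipliers are used on the degenerate segment [[m, m]]. *)
Let nopole' (m' : R) : m <= m' <= m -> forall j, sin (m' * beta j / 2) != 0.
Proof. by move=> mm'; have -> : m' = m by apply/eqP; rewrite eq_le andbC. Qed.
Let mm : m <= m <= m. Proof. by rewrite lexx. Qed.
Let r0 : I -> R -> R := fun _ _ => 0.
Let cr0 i : continuous (r0 i). Proof. by move=> t; exact: cst_continuous. Qed.

Let V i := Vop beta X m r0 i.
Let U := modelU beta X m.

Let VE i : V i = angle beta m i / 2 *
  (cos (angle beta m i / 2) / sin (angle beta m i / 2) * X i + sgnb i.2 * X (partner i)).
Proof.
have u0 j : unrot beta m r0 j = cst 0.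
  by apply/funext => t; rewrite /unrot /r0 !mulr0 addr0.
have Q0 j t : Qop beta m r0 j t = 0.
  apply/eqP; rewrite -normr_le0 /Qop u0; apply: prim_bound => s; first exact: cst_continuous.
  by rewrite normr0.
have D0 j : Dop beta X m r0 j = X j.
  by rewrite /Dop /rot !Q0 !mulr0 subrr subr0.
by rewrite /V /Vop !D0.
Qed.

Let cU i : continuous (U i).
Proof. exact: Lop_continuous. Qed.

Let YU i (t : R) : 0 <= t <= 1 -> Yop beta X m r0 i t = Ys U i t.
Proof.
move=> t01; apply: prim_unique => //.
- exact: Yop_continuous.
- exact: Yop0.
- by move=> s s01; exact: Yop_derive.
Qed.

Let UE k (t : R) : 0 <= t <= 1 -> U k t = V k + m * contrW (planeW beta) (fun i => Ys U i t) k.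
Proof.
move=> t01; rewrite /U /modelU /Lop contr_planeW -YU// /V /angle /r0; ring.
Qed.

Let Y1 i : Ys U i 1 = X i.
Proof. by rewrite -YU ?ler01 ?lexx// (Yop1 nopole'). Qed.

Let contrD (f : I -> R -> R) (df : I -> R) (t : R) k :
  (forall i, is_derive t 1 (f i) (df i)) ->
  is_derive t 1 (fun s => contrW (planeW beta) (fun i => f i s) k) (contrW (planeW beta) df k).
Proof.
move=> ddf; have -> : (fun s => contrW (planeW beta) (fun i => f i s) k) =
     - ((sgnb k.2 * beta k.1) *: f (partner k)).
  by apply/funext => s; rewrite contr_planeW !fctE /GRing.scale /=; ring.
have d1 := is_deriveN (is_deriveZ (sgnb k.2 * beta k.1) (ddf (partner k))).
by apply: (is_derive_eq d1); rewrite contr_planeW /GRing.scale /=; ring.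
Qed.

Let dU k (t : R) : 0 < t < 1 ->
  is_derive t 1 (U k) (m * contrW (planeW beta) (fun i => U i t) k).
Proof.
move=> t01.
have dc := contrD k (fun i => prim_derive (@cU i) t01).
have d1 := is_deriveD (is_derive_cst (V k) t 1) (is_deriveZ m dc).
rewrite add0r in d1.
apply: near_eq_is_derive d1; have := near_clamp01 t01; apply: filterS => s hs.
by rewrite UE//= -hs; exact: clamp01_itv.
Qed.

Lemma is_derive_bigsum (J : Type) (s : seq J) (f : J -> R -> R) (df : J -> R) (t : R) :
  (forall j, is_derive t 1 (f j) (df j)) ->
  is_derive t 1 (fun x => \sum_(j <- s) f j x) (\sum_(j <- s) df j).
Proof.
move=> ddf; elim: s => [|j s IH].
  under eq_fun do rewrite big_nil; rewrite big_nil; exact: is_derive_cst.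
by under eq_fun do rewrite big_cons; rewrite big_cons; exact: is_deriveD.
Qed.

Let bil_contr (a b : I -> R) : bil (planeW beta) a b = \sum_k contrW (planeW beta) a k * b k.
Proof. by rewrite sum_contrW. Qed.

(** [U' = m * contrW U] and [W] is skew, so the squared norm of [U] keeps its initial value, that of
    [V]. *)
Let energy_const (t : R) : 0 <= t <= 1 -> \sum_k U k t ^+ 2 = \sum_k V k ^+ 2.
Proof.
move=> t01.
have cE : continuous (fun t => \sum_k U k t ^+ 2).
  by apply: continuous_bigsum => k s; apply: cvgM; exact: cU.
rewrite (derive0_constant cE _ t01).
  apply: eq_bigr => k _; rewrite UE ?lexx ?ler01// /contrW big1 ?mulr0 ?addr0//.
  by move=> i _; rewrite /Ys prim0 ?mulr0.
move=> s s01; have h k : is_derive s 1 (fun t => U k t ^+ 2)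
   (2 * (m * (contrW (planeW beta) (fun i => U i s) k * U k s))).
  have d1 := is_deriveM (dU k s01) (dU k s01).
  by apply: (is_derive_eq d1); rewrite /GRing.scale /=; ring.
have d2 := is_derive_bigsum (index_enum I) h.
apply: (is_derive_eq d2); rewrite -!mulr_sumr sum_contrW.
have h0 := bil_asym (fun i => U i s) (fun i => U i s) (planeW_asym beta).
by have -> : bil (planeW beta) (fun i => U i s) (fun i => U i s) = 0; [lra|rewrite !mulr0].
Qed.

Let cZ' : continuous (fun t => 2^-1 * bil (planeW beta) (fun i => Ys U i t) (fun i => U i t)).
Proof.
move=> t; apply: cvgM; first exact: cvg_cst.
apply: continuous_bigsum => i; apply: continuous_bigsum => j s.
apply: cvgM; last exact: cU; apply: cvgM; first exact: cvg_cst.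
exact: prim_continuous.
Qed.

(** Since [m * contrW Y = U - V], the rate of the height times [2 * m] is [|U|^2 - V . U]. The norm
    of [U] is constant and [Y 1 = X], so integration gives [|V|^2 - V . X]. *)
Let phi0_V : phi0 beta X m = (2 * m)^-1 * \sum_k (V k ^+ 2 - V k * X k).
Proof.
pose c := (2 * m)^-1.
pose F : R -> R := Zs beta U - c *: ((\sum_k V k ^+ 2) *: id - (fun t => \sum_k V k *: Ys U k t)).
have FE t : F t = Zs beta U t - c * ((\sum_k V k ^+ 2) * t - \sum_k V k * Ys U k t) by [].
have cF : continuous F.
  move=> t; apply: cvgB; first exact: prim_continuous.
  apply: cvgM; first exact: cvg_cst.
  apply: cvgB; first by apply: cvgM; [exact: cvg_cst|exact: cvg_id].
  by apply: continuous_bigsum => k s; apply: cvgM; [exact: cvg_cst|exact: prim_continuous].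
have dF (t : R) : 0 < t < 1 -> is_derive t 1 F 0.
  move=> t01; have t01' : 0 <= t <= 1 by case/andP: t01 => ? ?; rewrite !ltW.
  have d1 := prim_derive cZ' t01.
  have d2 := is_derive_bigsum (index_enum I) (fun k => is_deriveZ (V k) (prim_derive (@cU k) t01)).
  have d3 := is_deriveB d1 (is_deriveZ c
     (is_deriveB (is_deriveZ (\sum_k V k ^+ 2) (is_derive_id t 1)) d2)).
  apply: (is_derive_eq d3); rewrite /GRing.scale /= mulr1 -(energy_const t01') bil_contr.
  have E : \sum_k (U k t ^+ 2 - V k * U k t) =
      m * \sum_k contrW (planeW beta) (fun i => Ys U i t) k * U k t.
    by rewrite mulr_sumr; apply: eq_bigr => k _; rewrite (UE k t01'); ring.
  by rewrite -sumrB E /c; field; exact: m0.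
have := derive0_constant cF dF (_ : 0 <= 1 <= 1); rewrite ler01 lexx => /(_ isT).
have -> : F 0 = 0.
  rewrite FE /Zs prim0// mulr0 big1 ?subrr ?mulr0 ?subrr//.
  by move=> k _; rewrite /Ys prim0 ?mulr0.
rewrite FE mulr1 => /eqP; rewrite subr_eq0 => /eqP.
rewrite /phi0 -/U => ->; congr (_ * _); rewrite sumrB; congr (_ - _).
by apply: eq_bigr => k _; rewrite Y1.
Qed.

Lemma phi0E : phi0 beta X m = \sum_j beta j * (X (j, false) ^+ 2 + X (j, true) ^+ 2) *
  (m * beta j - sin (m * beta j)) / (8 * sin (m * beta j / 2) ^+ 2).
Proof.
rewrite phi0_V.
have -> : \sum_k (V k ^+ 2 - V k * X k) =
   \sum_j \sum_b (V (j, b) ^+ 2 - V (j, b) * X (j, b)).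
  by rewrite pair_bigA /=; apply: eq_bigr => -[j b] _.
rewrite mulr_sumr; apply: eq_bigr => j _; rewrite big_bool /= !VE /angle /partner /=.
have s0 := nopole j.
have -> : sin (m * beta j) = 2 * (sin (m * beta j / 2) * cos (m * beta j / 2)).
  by rewrite [in LHS](splitr (m * beta j)) sinD; ring.
have c2 : cos (m * beta j / 2) ^+ 2 = 1 - sin (m * beta j / 2) ^+ 2.
  by have := cos2Dsin2 (m * beta j / 2); lra.
set S := sin (m * beta j / 2) in s0 c2 *; set c := cos (m * beta j / 2) in c2 *.
set x := X (j, false); set y := X (j, true).
have -> : (m * beta j / 2 * (c / S * y + -1 * x)) ^+ 2 - m * beta j / 2 * (c / S * y + -1 * x) * y +
   ((m * beta j / 2 * (c / S * x + 1 * y)) ^+ 2 - m * beta j / 2 * (c / S * x + 1 * y) * x) =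
   m * beta j / 4 * (x ^+ 2 + y ^+ 2) * (m * beta j * (c ^+ 2 + S ^+ 2) - 2 * (S * c)) / S ^+ 2.
  by field.
by rewrite c2 subrK mulr1; field; rewrite s0 m0.
Qed.

End model_endpoint.

(** * Multipliers at which the model crosses a given height *)

Section model_count.
Context {R : realType}.

Lemma norm_sinDnpi (x : R) (n : nat) : `|sin (x + n%:R * pi)| = `|sin x|.
Proof.
elim: n => [|n IH]; first by rewrite mul0r addr0.
by rewrite -natr1 mulrDl mul1r addrA sinDpi normrN.
Qed.

Lemma norm_sinDzpi (x : R) (p : int) : `|sin (x + p%:~R * pi)| = `|sin x|.
Proof.
case: p => n; first exact: norm_sinDnpi.
rewrite NegzE mulrNz mulNr -(norm_sinDnpi (x - n.+1%:R * pi) n.+1) subrK//.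
Qed.

Lemma sin_neq0_gap (x : R) (p : int) : p%:~R * pi < x < (p + 1)%:~R * pi -> sin x != 0.
Proof.
move=> /andP[h1 h2]; rewrite -normr_eq0 -(norm_sinDzpi x (- p)) normr_eq0 gt_eqF//.
apply: sin_gt0_pi; move: h2; rewrite intrD mulrDl mul1r mulrNz mulNr; lra.
Qed.

Lemma sin_lower (eta : R) : 0 < eta -> exists2 s : R, 0 < s &
  forall x, (forall p : int, eta <= `|x - p%:~R * pi|) -> s <= `|sin x|.
Proof.
move=> eta0.
(* If [eta > pi / 2], no point is that far from all multiples of [pi], and any [s] works. *)
have [le_eta|gt_eta] := leP eta (pi - eta); last first.
  exists 1 => // x hx; exfalso.
  have := floor_itv (x / pi); set p := Num.floor _ => /andP[h1 h2].
  rewrite ler_pdivlMr ?pi_gt0// in h1; rewrite ltr_pdivrMr ?pi_gt0// in h2.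
  have k1 := hx p; have k2 := hx (p + 1); rewrite intrD mulrDl mul1r in h2 k2.
  rewrite ger0_norm in k1; last by lra.
  rewrite ler0_norm in k2; last by lra.
  lra.
have [|c] := @EVT_min _ (@sin R) eta (pi - eta) le_eta.
  by apply: continuous_subspaceT; exact: continuous_sin.
rewrite in_itv/= => /andP[c1 c2] hmin; exists (sin c).
  by apply: sin_gt0_pi; rewrite (lt_le_trans eta0)//= (le_lt_trans c2)// ltrBlDr ltrDl.
move=> x hx; have := floor_itv (x / pi); set p := Num.floor _ => /andP[h1 h2].
rewrite ler_pdivlMr ?pi_gt0// in h1; rewrite ltr_pdivrMr ?pi_gt0// in h2.
have k1 := hx p; have k2 := hx (p + 1); rewrite intrD mulrDl mul1r in h2 k2.
rewrite ger0_norm in k1; last by lra.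
rewrite ler0_norm in k2; last by lra.
rewrite -(norm_sinDzpi x (- p)) mulrNz mulNr (le_trans _ (ler_norm _))// hmin// in_itv/=.
apply/andP; split; lra.
Qed.

Variables (d : nat) (beta : 'I_d -> R) (j0 : 'I_d).
Hypothesis beta0 : forall j, 0 < beta j.
Hypothesis bmax : forall j, beta j <= beta j0.

Definition model_z (Xn : 'I_d -> R) (m : R) : R := \sum_j beta j * Xn j *
  (m * beta j - sin (m * beta j)) / (8 * sin (m * beta j / 2) ^+ 2).

Let period : R := 2 * pi / beta j0.
Let delta : R := period / (2 * d.+1%:R).
Let period0 : 0 < period. Proof. by rewrite divr_gt0// mulr_gt0// pi_gt0. Qed.
Let delta0 : 0 < delta. Proof. by rewrite divr_gt0// mulr_gt0. Qed.
Let periodE : period = 2 * d.+1%:R * delta.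
Proof. by rewrite /delta mulrC divfK// mulf_neq0// pnatr_eq0. Qed.

(* Poles of each plane are at least a period apart, so a plane is close to at
   most one of [d + 1] equally spaced points: some point is far from all. *)
Let far_point (k : nat) : exists2 m : R, period * k%:R + delta <= m <= period * k.+1%:R - delta &
  forall j (p : int), delta <= `|m - 2 * pi / beta j * p%:~R|.
Proof.
(* Centres of the [d + 1] cells of width [2 * delta] that divide the [k]-th period. *)
pose c (i : 'I_d.+1) : R := period * k%:R + (2 * i%:R + 1) * delta.
have [[i hi]|hno] := pselect (exists i, forall j (p : int), delta <= `|c i - 2 * pi / beta j * p%:~R|).
  exists (c i) => //; rewrite /c.
  have h1 : 0 <= (i : nat)%:R * delta by rewrite mulr_ge0// ltW.
  have h2 : (i : nat)%:R * delta <= d%:R * delta by rewrite ler_pM2r// ler_nat -ltnS.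
  apply/andP; split; first by lra.
  have E1 : k.+1%:R = k%:R + 1 :> R by rewrite natr1.
  have E2 : d.+1%:R = d%:R + 1 :> R by rewrite natr1.
  have P := periodE; rewrite E2 in P; rewrite E1 mulrDr mulr1; lra.
exfalso; have /choice[f hf] : forall i, exists j, exists p : int, `|c i - 2 * pi / beta j * p%:~R| < delta.
  move=> i; apply: contrapT => h; apply: hno; exists i => j p.
  by rewrite leNgt; apply/negP => h'; apply: h; exists j, p.
have : ~ injective f.
  by move=> /leq_card; rewrite !card_ord ltnn.
apply=> i i' fii'; apply: contrapT => ii'.
wlog lt_ii : i i' fii' ii' / (i < i')%N.
  move=> wl; have /eqP : (i : nat) <> i' by move=> /val_inj.
  rewrite neq_ltn => /orP[h|h]; first exact: wl fii' ii' h.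
  by apply: (wl i' i) => //; exact: nesym.
have [p hp] := hf i; have [p' hp'] := hf i'; rewrite -fii' in hp'.
set g := 2 * pi / beta (f i) in hp hp'.
have gper : period <= g.
  by rewrite /period /g ler_pM2l ?mulr_gt0 ?pi_gt0// lef_pV2 ?posrE.
have g0 : 0 < g by exact: lt_le_trans gper.
have k1 : c i + 2 * delta <= c i'.
  rewrite /c -addrA lerD2l; have : (i : nat)%:R + 1 <= (i' : nat)%:R :> R by rewrite natr1 ler_nat.
  move=> /(ler_wpM2r (ltW delta0)); lra.
have k2 : c i' - c i <= 2 * d%:R * delta.
  rewrite /c; have : (i' : nat)%:R <= d%:R :> R by rewrite ler_nat -ltnS.
  move=> /(ler_wpM2r (ltW delta0)).
  have : 0 <= (i : nat)%:R * delta by rewrite mulr_ge0// ltW.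
  lra.
(* The two points are between [2 * delta] and [2 * d%:R * delta] apart. Each is within [delta] of a
   pole of the same plane, so they are less than [2 * delta] apart if [p' <= p], and more than
   [g - 2 * delta] apart otherwise: both are impossible. *)
move: hp hp'; rewrite !ltr_norml => /andP[a1 a2] /andP[b1 b2].
have [pp|pp] := leP p' p.
  have : g * p'%:~R <= g * p%:~R by rewrite ler_pM2l// ler_int.
  lra.
have : g * (p + 1)%:~R <= g * p'%:~R by rewrite ler_pM2l// ler_int lezD1.
have E2 : d.+1%:R = d%:R + 1 :> R by rewrite natr1.
have := periodE; rewrite intrD mulrDr mulr1 E2; lra.
Qed.

Lemma sin_lt_id_ge (x : R) : 0 <= x -> 0 <= x - sin x.
Proof.
by move=> x0; have := sin_lip x 0; rewrite sin0 !subr0 (ger0_norm x0); have := ler_norm (sin x); lra.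
Qed.

Lemma model_intervals : exists2 C : R, 0 < C & forall (Xn : 'I_d -> R) (z : R),
  (forall j, 0 < Xn j) -> forall k : nat, C * k.+1%:R * (\sum_j Xn j) < z ->
  exists lo hi, [/\ period * k%:R < lo, lo <= hi, hi < period * k.+1%:R,
    (forall m, lo <= m <= hi -> forall j, sin (m * beta j / 2) != 0) &
    model_z Xn lo < z < model_z Xn hi].
Proof.
have eta0 j : 0 < delta * beta j / 2 by rewrite divr_gt0// mulr_gt0.
have /choice[s hs] : forall j, exists s : R, 0 < s /\
    forall x, (forall p : int, delta * beta j / 2 <= `|x - p%:~R * pi|) -> s <= `|sin x|.
  by move=> j; have [s ? ?] := sin_lower (eta0 j); exists s.
(* Far from the poles the numerator is at most [(2 * pi + 1) * k.+1%:R] and the sine is at least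
   [s j]. *)
pose C : R := \sum_j beta j * (2 * pi + 1) / (8 * s j ^+ 2).
have s0 j : 0 < s j by exact: (hs j).1.
have pi0 := @pi_gt0 R.
have Cj0 j : 0 < beta j * (2 * pi + 1) / (8 * s j ^+ 2).
  by rewrite divr_gt0 ?mulr_gt0 ?exprn_gt0// ltr_wpDl// mulr_ge0// ltW.
have Cj j : beta j * (2 * pi + 1) / (8 * s j ^+ 2) <= C.
  by rewrite /C (bigD1 j)//= lerDl sumr_ge0// => i _; exact: ltW.
have C0 : 0 < C by rewrite (lt_le_trans (Cj0 j0)).
exists C => // Xn z Xn0 k hz.
have [lo /andP[lo1 lo2] hlo] := far_point k.
have kp : 0 <= period * k%:R by rewrite mulr_ge0// ltW.
have lo0 : 0 < lo by rewrite (lt_le_trans _ lo1)// ltr_wpDl.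
have sinlo j : s j <= `|sin (lo * beta j / 2)|.
  apply: (hs j).2 => p.
  have -> : lo * beta j / 2 - p%:~R * pi = (lo - 2 * pi / beta j * p%:~R) * (beta j / 2).
    by field; rewrite gt_eqF.
  rewrite normrM (ger0_norm (ltW (_ : 0 < beta j / 2))) ?divr_gt0//.
  by rewrite -mulrA ler_pM2r ?divr_gt0.
have zlo : model_z Xn lo < z.
  apply: (le_lt_trans _ hz); rewrite /model_z mulr_sumr; apply: ler_sum => j _.
  have th : lo * beta j - sin (lo * beta j) <= (2 * pi + 1) * k.+1%:R.
    have : lo * beta j <= 2 * pi * k.+1%:R.
      have : lo * beta j <= period * k.+1%:R * beta j0.
        apply: ler_pM; [exact: ltW|exact/ltW/beta0| |exact: bmax].
        by rewrite (le_trans lo2)// lerBlDr lerDl ltW.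
      have -> : period * k.+1%:R * beta j0 = 2 * pi * k.+1%:R; last by [].
      by rewrite /period; field; rewrite gt_eqF.
    have := sin_geN1 (lo * beta j); have : 1 <= k.+1%:R :> R by rewrite ler1n.
    lra.
  have sj : s j ^+ 2 <= sin (lo * beta j / 2) ^+ 2.
    by rewrite -[leRHS]real_normK ?num_real// ler_sqr ?nnegrE ?(ltW (s0 j)).
  have bX : 0 < beta j * Xn j by rewrite mulr_gt0.
  apply: (@le_trans _ _ (beta j * Xn j * ((2 * pi + 1) * k.+1%:R) / (8 * s j ^+ 2))).
    apply: ler_pM.
    - by rewrite mulr_ge0 ?(ltW bX)// sin_lt_id_ge// mulr_ge0// ltW.
    - by rewrite invr_ge0 mulr_ge0// sqr_ge0.
    - by rewrite ler_pM2l.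
    - have s2p : 0 < s j ^+ 2 by rewrite exprn_gt0.
      have sn2p := lt_le_trans s2p sj.
      by rewrite lef_pV2 ?posrE ?ler_pM2l// mulr_gt0.
  have -> : beta j * Xn j * ((2 * pi + 1) * k.+1%:R) / (8 * s j ^+ 2) =
     beta j * (2 * pi + 1) / (8 * s j ^+ 2) * (k.+1%:R * Xn j) by ring.
  by rewrite -[C * _ * _]mulrA ler_pM2r ?mulr_gt0.
(* [2 * pi * fl j] is the last multiple of [2 * pi] before [lo * beta j], and [nxt j] the next pole
   of the [j]-th plane in the variable [m]. The smallest of these, [r], ends the interval without
   poles. *)
pose fl j := Num.floor (lo * beta j / (2 * pi)).
pose nxt j : R := 2 * pi / beta j * (fl j + 1)%:~R.
have tpi0 : 0 < 2 * pi :> R by rewrite mulr_gt0.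
have fl_itv j : 2 * pi * (fl j)%:~R < lo * beta j < 2 * pi * (fl j + 1)%:~R.
  have := floor_itv (lo * beta j / (2 * pi)); rewrite -/(fl j) => /andP[h1 h2].
  rewrite ler_pdivlMr// in h1; rewrite ltr_pdivrMr// in h2.
  rewrite ![2 * pi * _]mulrC h2 andbT lt_neqAle h1 andbT.
  apply/eqP => h; have := hlo j (fl j).
  have -> : lo - 2 * pi / beta j * (fl j)%:~R = 0; last by rewrite normr0 leNgt delta0.
  by apply: (@mulIf _ (beta j)); rewrite ?gt_eqF// mul0r mulrBl -h; field; rewrite gt_eqF.
have nxtE j : nxt j * beta j = 2 * pi * (fl j + 1)%:~R by rewrite /nxt; field; rewrite gt_eqF.
have lo_nxt j : lo < nxt j by rewrite -(ltr_pM2r (beta0 j)) nxtE; case/andP: (fl_itv j).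
have [j1 _ hj1] := @arg_minP _ _ _ j0 xpredT nxt isT.
pose r := nxt j1.
have nopole m : lo <= m < r -> forall j, sin (m * beta j / 2) != 0.
  move=> /andP[m1 m2] j; apply: (@sin_neq0_gap _ (fl j)).
  have /andP[f1 f2] := fl_itv j.
  have g1 : lo * beta j <= m * beta j by rewrite ler_pM2r.
  have g2 : m * beta j < nxt j * beta j.
    by rewrite ltr_pM2r// (lt_le_trans m2)// hj1.
  rewrite nxtE in g2; apply/andP; split; lra.
have fl0 j : (0 <= fl j)%R by rewrite /fl floor_ge0 divr_ge0 ?mulr_ge0// ltW.
(* The end of the period is a pole of the plane [j0], and [far_point] places [lo] strictly before
   it. *)
have r_le : r <= period * k.+1%:R.
  apply: (le_trans (hj1 j0 isT)).
  rewrite /nxt -/period ler_pM2l// -[k.+1%:R]/((Posz k.+1)%:~R) ler_int lezD1 -(@ltr_int R).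
  have /andP[f1 _] := fl_itv j0.
  have : lo * beta j0 < 2 * pi * k.+1%:R.
    have -> : 2 * pi * k.+1%:R = period * k.+1%:R * beta j0 by rewrite /period; field; rewrite gt_eqF.
    by rewrite ltr_pM2r// (le_lt_trans lo2)// ltrBlDr ltrDl.
  by move=> /(lt_trans f1); rewrite ltr_pM2l.
pose b := beta j1; pose x := Xn j1.
have b0 : 0 < b by exact: beta0.
have x0 : 0 < x by exact: Xn0.
have z0 : 0 < z.
  rewrite (lt_trans _ hz)// mulr_gt0 ?mulr_gt0// (bigD1 j0)//= ltr_wpDr// sumr_ge0// => i _.
  exact: ltW.
(* The four bounds on [t] serve in turn for [lo <= hi], for [t ^+ 2 <= t], for a numerator at least
   [1] next to the pole, and for [z * (8 * (t * b / 2) ^+ 2) < b * x]. *)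
pose t : R := Num.min (Num.min (r - lo) 1) (Num.min b^-1 (x / (2 * b * z + 1))).
have bz : 0 < 2 * b * z + 1 by rewrite ltr_wpDl// !mulr_ge0// ltW.
have rlo : 0 < r - lo by rewrite subr_gt0 lo_nxt.
have t0 : 0 < t by rewrite /t !lt_min rlo ltr01 invr_gt0 b0 divr_gt0.
have t1 : t <= r - lo by rewrite /t !ge_min lexx.
have t2 : t <= 1 by rewrite /t !ge_min lexx !orbT.
have t3 : t * b <= 1 by rewrite -ler_pdivlMr// mul1r /t !ge_min lexx !orbT.
have t4 : t * (2 * b * z + 1) <= x by rewrite -ler_pdivlMr// /t !ge_min lexx !orbT.
exists lo, (r - t); split=> //.
- by rewrite (lt_le_trans _ lo1)// ltrDl.
- by rewrite lerBrDr -lerBrDl.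
- by rewrite (lt_le_trans _ r_le)// ltrBlDr ltrDl.
- move=> m /andP[m1 m2]; apply: nopole; rewrite m1 (le_lt_trans m2)// ltrBlDr ltrDl//.
rewrite zlo /=; set hi := r - t.
have hi0 : 0 < hi by rewrite (lt_le_trans lo0)// /hi lerBrDr -lerBrDl.
have term_ge0 j : 0 <= beta j * Xn j * (hi * beta j - sin (hi * beta j)) / (8 * sin (hi * beta j / 2) ^+ 2).
  apply: divr_ge0; last by rewrite mulr_ge0// sqr_ge0.
  apply: mulr_ge0; first by rewrite mulr_ge0// ltW.
  by rewrite sin_lt_id_ge// mulr_ge0// ltW.
(* All terms are nonnegative, so the plane whose pole is approached suffices. *)
rewrite /model_z (bigD1 j1)//= ltr_wpDr//; first by apply: sumr_ge0 => j _.
rewrite -/b -/x.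
have sn0 : sin (hi * b / 2) != 0.
  apply: nopole; rewrite /hi ltrBlDr ltrDl t0 andbT lerBrDr -lerBrDl//.
have sle : sin (hi * b / 2) ^+ 2 <= (t * b / 2) ^+ 2.
  rewrite -[leLHS]real_normK ?num_real// ler_sqr ?nnegrE ?divr_ge0 ?mulr_ge0 ?(ltW t0) ?(ltW b0)//.
  rewrite -(norm_sinDzpi _ (- (fl j1 + 1))).
  have -> : hi * b / 2 + (- (fl j1 + 1))%:~R * pi = - (t * b / 2).
    by rewrite /hi mulrBl mulrBl /r /b nxtE mulrNz; field.
  rewrite sinN normrN; have tb : 0 <= t * b / 2 by rewrite divr_ge0// mulr_ge0// ltW.
  by have := sin_lip (t * b / 2) 0; rewrite sin0 !subr0 (ger0_norm tb).
have num1 : 1 <= hi * b - sin (hi * b).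
  have : 2 * pi <= r * b.
    rewrite /r /b nxtE ler_peMr ?(ltW tpi0)// -[1]/(1%:~R) ler_int.
    by rewrite lerDr.
  have := sin_le1 (hi * b); have := @pi_ge2 R; rewrite /hi mulrBl; lra.
have s2 : 0 < sin (hi * b / 2) ^+ 2 by rewrite lt_def sqr_ge0 sqrf_eq0 sn0.
rewrite ltr_pdivlMr; last by rewrite mulr_gt0.
apply: (@lt_le_trans _ _ (b * x)); last by rewrite ler_peMr// mulr_ge0// ltW.
apply: (@le_lt_trans _ _ (z * (8 * (t * b / 2) ^+ 2))); first by rewrite ler_pM2l// ler_pM2l.
have -> : z * (8 * (t * b / 2) ^+ 2) = b * (t * (2 * b * z) * t) by field.
rewrite ltr_pM2l// (@le_lt_trans _ _ (t * (2 * b * z)))//.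
  by rewrite ler_piMr// !mulr_ge0// ltW.
by rewrite (lt_le_trans _ t4)// ltr_pM2l// ltrDl.
Qed.

End model_count.

(** * Local minimality in coordinates *)

Section lipschitz_on_segment.
Context {R : realType} (a b : R).
Hypothesis ab : a <= b.
Implicit Types f g : R -> R.

Definition lipb f := exists k : R, lipschitz_within k a b f.

Lemma lipb_ge0 f : lipb f -> exists2 k : R, 0 <= k & lipschitz_within k a b f.
Proof.
move=> [k h]; exists `|k| => // s t hs ht.
by rewrite (le_trans (h s t hs ht))// ler_wpM2r// ler_norm.
Qed.

Lemma lipb_bounded f : lipb f -> exists2 m : R, 0 <= m & forall t, a <= t <= b -> `|f t| <= m.
Proof.
move=> /lipb_ge0[k k0 h]; exists (`|f a| + k * (b - a)).
  by rewrite addr_ge0// mulr_ge0// subr_ge0.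
move=> t atb; have aab : a <= a <= b by rewrite lexx ab.
rewrite -[f t](subrK (f a)) addrC (le_trans (ler_normD _ _))// lerD2l.
rewrite (le_trans (h _ _ atb aab))// ler_wpM2l//; case/andP: atb => h1 h2.
by rewrite ger0_norm ?subr_ge0// lerD2r.
Qed.

Lemma lipb_cst (c : R) : lipb (fun=> c).
Proof. by exists 0 => s t _ _; rewrite subrr normr0 mul0r. Qed.

Lemma lipb_id : lipb id.
Proof. by exists 1 => s t _ _; rewrite mul1r. Qed.

Lemma lipb_add f g : lipb f -> lipb g -> lipb (fun t => f t + g t).
Proof.
move=> [k hk] [l hl]; exists (k + l) => s t hs ht; rewrite opprD addrACA mulrDl.
by rewrite (le_trans (ler_normD _ _))// lerD// ?hk ?hl.
Qed.

Lemma lipb_mul f g : lipb f -> lipb g -> lipb (fun t => f t * g t).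
Proof.
move=> lf lg; have [mf mf0 bf] := lipb_bounded lf; have [mg mg0 bg] := lipb_bounded lg.
have [k k0 hk] := lipb_ge0 lf; have [l l0 hl] := lipb_ge0 lg.
exists (mf * l + k * mg) => s t hs ht.
have -> : f s * g s - f t * g t = f s * (g s - g t) + (f s - f t) * g t by ring.
rewrite (le_trans (ler_normD _ _))// !normrM mulrDl lerD//.
  by rewrite -mulrA ler_pM// ?bf ?hl.
by rewrite mulrAC ler_pM// ?bg ?hk.
Qed.

Lemma lipb_opp f : lipb f -> lipb (fun t => - f t).
Proof.
by move=> [k hk]; exists k => s t hs ht; rewrite -opprD normrN; exact: hk.
Qed.

Lemma lipb_sub f g : lipb f -> lipb g -> lipb (fun t => f t - g t).
Proof. by move=> lf /lipb_opp; exact: lipb_add. Qed.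

Lemma lipb_sum (J : Type) (r : seq J) (F : J -> R -> R) :
  (forall j, lipb (F j)) -> lipb (fun t => \sum_(j <- r) F j t).
Proof.
move=> lF; elim: r => [|j r [k hk]].
  by exists 0 => s t _ _; rewrite !big_nil subrr normr0 mul0r.
have [l hl] := lipb_add (lF j) (ex_intro _ k hk).
by exists l => s t hs ht; rewrite !big_cons; exact: hl.
Qed.

End lipschitz_on_segment.

Lemma continuous_bounded01 {R : realType} (f : R -> R) : continuous f ->
  exists2 m : R, 0 <= m & forall t : R, 0 <= t <= 1 -> `|f t| <= m.
Proof.
move=> cf.
have [|c _ hc] := @EVT_max _ (fun t : R => `|f t|) 0 1 ler01.
  by apply: continuous_subspaceT => t; apply: cvg_norm; exact: cf.
by exists `|f c| => // t t01; apply: hc; rewrite in_itv.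
Qed.

Lemma finite_bound {R : realType} (J : finType) (P : J -> R -> Prop) :
  (forall j m m', P j m -> m <= m' -> P j m') ->
  (forall j, exists2 m : R, 0 <= m & P j m) -> exists2 m : R, 0 <= m & forall j, P j m.
Proof.
move=> Pm h; have /choice[f hf] : forall j, exists m : R, 0 <= m /\ P j m.
  by move=> j; have [m ? ?] := h j; exists m.
exists (\sum_j f j); first by apply: sumr_ge0 => j _; exact: (hf j).1.
move=> j; apply: (Pm j (f j)); first exact: (hf j).2.
by rewrite (bigD1 j)//= lerDl sumr_ge0// => i _; exact: (hf i).1.
Qed.

Section local_minimality.
Context {R : realType} {I : finType}.
Notation mu := (@lebesgue_measure R).
Variables (W : I -> I -> R) (w0 : R).
Variables (G : I -> I -> (I -> R) -> R -> R) (D : I -> I -> I -> (I -> R) -> R -> R)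
  (Dz : I -> I -> (I -> R) -> R -> R) (rho L : R).
Hypotheses (aW : forall i j, W i j = - W j i) (Ww : forall i j, `|W i j| <= w0).
Hypotheses (rho0 : 0 < rho) (L0 : 0 <= L).

Definition inbox (r : R) (y : I -> R) (z : R) := (forall i, `|y i| <= r) /\ `|z| <= r.
Definition dist1 (y y' : I -> R) (z z' : R) : R :=
  norm1 (fun i => y' i - y i) + `|z' - z|.

(** The threshold in the first clause is that of [bil_lower], so the metric is at least half the
    Euclidean one. The fourth clause is a Taylor expansion whose quadratic remainder is absorbed by
    the correction in [K]. *)
Definition regular_metric := forall i j,
  [/\ forall y z, inbox rho y z -> `|G i j y z - (i == j)%:R| <= (2 * #|I|%:R)^-1,
      forall y z, inbox rho y z -> G i j y z = G j i y z,
      forall y z y' z', inbox rho y z -> inbox rho y' z' ->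
        `|G i j y' z' - G i j y z| <= L * dist1 y y' z z',
      forall y z y' z', inbox rho y z -> inbox rho y' z' ->
        `|G i j y' z' - G i j y z
          - (\sum_k D i j k y z * (y' k - y k) + Dz i j y z * (z' - z))| <=
        L * dist1 y y' z z' ^+ 2 &
      forall y z, inbox rho y z -> (forall k, `|D i j k y z| <= L) /\ `|Dz i j y z| <= L].
Hypothesis regG : regular_metric.

Variables (y : R -> I -> R) (z : R -> R) (u : R -> I -> R) (nu : R -> R).
Hypothesis geod : geodesic_eqs W G D Dz y z u nu.
Hypothesis box : forall t, inbox rho (y t) (z t).

Let Gt t i j := G i j (y t) (z t).
Definition speed2 t : R := bil (Gt t) (u t) (u t).

Let w00 (i0 : I) : 0 <= w0. Proof. by rewrite (le_trans _ (Ww i0 i0)). Qed.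

Let cy i : continuous (fun t => y t i). Proof. by case: geod. Qed.
Let cz : continuous z. Proof. by case: geod. Qed.
Let cu i : continuous (fun t => u t i). Proof. by case: geod. Qed.
Let cnu : continuous nu. Proof. by case: geod. Qed.

Let cG i j : continuous (fun t => Gt t i j).
Proof.
move=> t; apply: (@continuous_dominated _ _ (fun s => L * dist1 (y t) (y s) (z t) (z s))).
- by move=> s; rewrite distrC; have [_ _ h _ _] := regG i j; exact: h.
- apply: cvgM; first exact: cvg_cst.
  apply: cvgD; last by apply: cvg_norm; apply: cvgB; [exact: cz|exact: cvg_cst].
  apply: continuous_bigsum => k s; apply: cvg_norm.
  by apply: cvgB; [exact: cy|exact: cvg_cst].
- by rewrite /dist1 /norm1 big1 ?subrr ?normr0 ?addr0 ?mulr0// => k _; rewrite subrr normr0.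
Qed.

Let c_momentum k : continuous (fun t => momentum (Gt t) (u t) k).
Proof. by apply: continuous_bigsum => i t; apply: cvgM; [exact: cG|exact: cu]. Qed.

Lemma speed2_continuous : continuous speed2.
Proof.
apply: continuous_bigsum => i; apply: continuous_bigsum => j t.
by apply: cvgM; [apply: cvgM; [exact: cG|exact: cu]|exact: cu].
Qed.

Let in01 (a b t : R) : 0 <= a -> b <= 1 -> a <= t <= b -> 0 <= t <= 1.
Proof. by move=> a0 b1 /andP[h1 h2]; rewrite (le_trans a0)// (le_trans h2). Qed.

Lemma lipb_of_derive (a b : R) (f df : R -> R) (m : R) : 0 <= a -> a <= b -> b <= 1 -> continuous f ->
  (forall t : R, 0 < t < 1 -> is_derive t 1 f (df t)) ->
  (forall t : R, 0 < t < 1 -> `|df t| <= m) -> lipb a b f.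
Proof.
move=> a0 ab b1 cf dff dfm; exists m => s t hs ht.
have /andP[s0 s1] := in01 a0 b1 hs; have /andP[t0 t1] := in01 a0 b1 ht.
have h := derive_bound_le cf dff dfm.
have [st|/ltW ts] := leP s t.
  by rewrite distrC (distrC s) (ger0_norm (_ : 0 <= t - s)) ?subr_ge0// h.
by rewrite (ger0_norm (_ : 0 <= s - t)) ?subr_ge0// h.
Qed.

Lemma is_derive_bil (B : I -> I -> R) (p q : R -> I -> R) (dp dq : I -> R) (t : R) :
  (forall i, is_derive t 1 (fun s => p s i) (dp i)) ->
  (forall i, is_derive t 1 (fun s => q s i) (dq i)) ->
  is_derive t 1 (fun s => bil B (p s) (q s)) (bil B dp (q t) + bil B (p t) dq).
Proof.
move=> hp hq.
have h i j : is_derive t 1 (fun s => B i j * p s i * q s j)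
    (B i j * dp i * q t j + B i j * p t i * dq j).
  have d0 : is_derive t 1 (fun s => B i j * p s i) (B i j * dp i) by exact: is_deriveZ.
  have d1 := is_deriveM d0 (hq j).
  by apply: (is_derive_eq d1); rewrite /GRing.scale /=; ring.
have d := is_derive_bigsum (index_enum I) (fun i => is_derive_bigsum (index_enum I) (h i)).
apply: (is_derive_eq d); rewrite /bil -big_split /=; apply: eq_bigr => i _.
by rewrite -big_split.
Qed.

(** [2 * Phi] vanishes at both ends, where the competitor meets the geodesic, and its derivative
    plus the squared speed is at most that of the competitor by [calibration_inequality]. [K], hence
    [del], does not depend on the competitor. *)
Lemma geodesic_locally_minimal : exists2 del : R, 0 < del &
  forall (a b : R), 0 <= a -> a < b -> b <= 1 -> b - a < del ->
  forall (yh : R -> I -> R) (zh : R -> R) (N : set R) (fh : R -> R),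
  (forall i, lipb a b (fun t => yh t i)) -> lipb a b zh ->
  (forall t, a <= t <= b -> inbox rho (yh t) (zh t)) ->
  measurable N -> mu N = 0%E ->
  (forall t : R, a < t < b -> ~ N t -> exists uh : I -> R,
    [/\ forall i, is_derive t 1 (fun s => yh s i) (uh i),
        is_derive t 1 zh (2^-1 * bil W (yh t) uh) &
        bil (fun i j => G i j (yh t) (zh t)) uh uh <= fh t]) ->
  (forall i, yh a i = y a i /\ yh b i = y b i) -> zh a = z a -> zh b = z b ->
  (\int[mu]_(t in `]a, b[) (speed2 t)%:E <= \int[mu]_(t in `]a, b[) (fh t)%:E)%E.
Proof.
have [Bu Bu0 hBu] : exists2 m : R, 0 <= m & forall i, forall t : R, 0 <= t <= 1 -> `|u t i| <= m.
  apply: finite_bound => [i m m' h mm' t ht|i]; last exact: continuous_bounded01.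
  by rewrite (le_trans (h t ht)).
have [Bn Bn0 hBn] := continuous_bounded01 cnu.
(* [Ww] gives [0 <= w0] only if there is an index; otherwise all speeds vanish. *)
have [[i0]|I0] := pselect (inhabited I); last first.
  have noI (P : Prop) : I -> P by move=> i; case: I0.
  exists 1 => // a b _ ab _ _ yh zh N fh _ _ _ mN N0 h _ _ _.
  have sp0 t : speed2 t = 0 by rewrite /speed2 /bil big1// => i; exact: noI.
  have := @lipschitz_integral_lower_bound R 0 a b N (fun=> 0) speed2 fh ab.
  rewrite subrr adde0; apply => //.
  - by move=> s t _ _; rewrite subrr normr0 mul0r.
  - exact: speed2_continuous.
  - move=> t tab tN; have [uh [_ _ hf]] := h t tab tN; split; first exact: derivable_cst.
    rewrite derive_cst addr0 sp0; apply: le_trans hf.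
    by rewrite /bil big1// => i; exact: noI.
have w_ge0 := w00 i0.
pose B := #|I|%:R * Bu + #|I|%:R * (rho + rho) + Bn.
have cI : (0 : R) <= #|I|%:R by [].
have rr : 0 <= rho + rho by rewrite addr_ge0// ltW.
have B0 : 0 <= B by rewrite !addr_ge0// !mulr_ge0.
have [K K0 hK] := @calibration_inequality R I w0 L B w_ge0 L0 B0.
(* This keeps [kappa = K * (t - a)] at most [1]. *)
exists (K + 1)^-1; first by rewrite invr_gt0 ltr_wpDl.
move=> a b a0 ab b1 ba yh zh N fh lyh lzh hbox mN N0 hN ybd za zb.
have abW := ltW ab.
have [_ _ _ _ dgeo] := geod.
pose dnu t := 2^-1 * bil (fun i j => Dz i j (y t) (z t)) (u t) (u t).
pose dpi k t := 2^-1 * bil (fun i j => D i j k (y t) (z t)) (u t) (u t)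
   + 2^-1 * dnu t * contrW W (y t) k + nu t * contrW W (u t) k.
have uB (t : R) : 0 <= t <= 1 -> norm1 (u t) <= B.
  move=> t01; rewrite (le_trans (norm1_sum_le (fun i => hBu i t t01)))//.
  by rewrite /B -addrA lerDl addr_ge0// mulr_ge0.
have boxB (p : I -> R) : (forall i, `|p i| <= rho + rho) -> norm1 p <= B.
  move=> hp; rewrite (le_trans (norm1_sum_le hp))// /B -addrA addrCA lerDl addr_ge0// mulr_ge0//.
have yB t : norm1 (y t) <= B.
  by apply: boxB => i; rewrite (le_trans ((box t).1 i))// lerDl ltW.
have nuB (t : R) : 0 <= t <= 1 -> `|nu t| <= B.
  by move=> t01; rewrite (le_trans (hBn t t01))// /B lerDr addr_ge0// mulr_ge0.
have oo (t : R) : 0 < t < 1 -> 0 <= t <= 1 by move=> /andP[h1 h2]; rewrite !ltW.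
have contr_le (p : I -> R) k : norm1 p <= B -> `|contrW W p k| <= w0 * B.
  move=> pB; rewrite /contrW (le_trans (ler_norm_sum _ _ _))//.
  rewrite (@le_trans _ _ (w0 * norm1 p))//; last exact: ler_wpM2l.
  by rewrite /norm1 mulr_sumr; apply: ler_sum => i _; rewrite normrM ler_wpM2r.
have dnuB (t : R) : 0 < t < 1 -> `|dnu t| <= 2^-1 * (L * (B * B)).
  move=> /oo t01; rewrite /dnu normrM ger0_norm ?invr_ge0// ler_wpM2l ?invr_ge0//.
  have hd i j : `|Dz i j (y t) (z t)| <= L by have [_ _ _ _ h] := regG i j; exact: (h _ _ (box t)).2.
  by rewrite (le_trans (bil_le _ _ hd))// ler_wpM2l// ler_pM ?norm1_ge0// uB.
have dpiB k (t : R) : 0 < t < 1 ->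
    `|dpi k t| <= 2^-1 * (L * (B * B)) + 2^-1 * (2^-1 * (L * (B * B))) * (w0 * B) + B * (w0 * B).
  move=> t01; have t01' := oo _ t01.
  rewrite /dpi (le_trans (ler_normD _ _))// lerD//; last first.
    by rewrite normrM ler_pM// ?nuB// contr_le// uB.
  rewrite (le_trans (ler_normD _ _))// lerD//.
    rewrite normrM ger0_norm ?invr_ge0// ler_wpM2l ?invr_ge0//.
    have hd i j : `|D i j k (y t) (z t)| <= L by have [_ _ _ _ h] := regG i j; exact: (h _ _ (box t)).1.
    by rewrite (le_trans (bil_le _ _ hd))// ler_wpM2l// ler_pM ?norm1_ge0// uB.
  rewrite (normrM (2^-1 * dnu t)) (normrM 2^-1 (dnu t)) (ger0_norm (_ : 0 <= 2^-1)) ?invr_ge0//.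
  rewrite ler_pM ?mulr_ge0 ?invr_ge0//; last exact: contr_le.
  by apply: ler_wpM2l; [rewrite invr_ge0|exact: dnuB].
have ly i : lipb a b (fun t => y t i).
  apply: (@lipb_of_derive a b _ (fun t => u t i) Bu) => // [t t01|t t01].
    by have [] := dgeo t t01.
  by apply: hBu; exact: oo.
have lz : lipb a b z.
  apply: (@lipb_of_derive a b _ (fun t => 2^-1 * bil W (y t) (u t)) (2^-1 * (w0 * (B * B)))) => // [t t01|t t01].
    by have [] := dgeo t t01.
  rewrite normrM ger0_norm ?invr_ge0// ler_wpM2l ?invr_ge0// (le_trans (bil_le _ _ Ww))//.
  by rewrite ler_wpM2l// ler_pM ?norm1_ge0// uB// oo.
have lnu : lipb a b nu.
  apply: (@lipb_of_derive a b _ dnu _ a0 abW b1 cnu _ dnuB) => t t01.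
  by have [] := dgeo t t01.
have lpi k : lipb a b (fun t => momentum (Gt t) (u t) k).
  apply: (@lipb_of_derive a b _ (dpi k) _ a0 abW b1 _ _ (dpiB k)) => [|t t01]; first exact: c_momentum.
  by have [_ _ _] := dgeo t t01; exact.
pose eta t i := yh t i - y t i; pose zeta t := zh t - z t.
have leta i : lipb a b (fun t => eta t i) by exact: lipb_sub.
have lzeta : lipb a b zeta by exact: lipb_sub.
(* The first three terms evaluate on the displacement the covector of the extremal, namely [G u]
   plus [nu] times the contact form at the point of the geodesic. The derivative of the last one is
   [K] times the squared displacement plus [K * (t - a)] times its rate: this is the origin of
   [kappa]. *)
pose Phi t := \sum_k momentum (Gt t) (u t) k * eta t k + nu t * zeta t
  - 2^-1 * (nu t * bil W (y t) (eta t))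
  - K * ((t - a) * (\sum_k eta t k ^+ 2 + zeta t ^+ 2)).
have lPhi : lipb a b (fun t => 2 * Phi t).
  apply: lipb_mul => //; first exact: lipb_cst.
  apply: lipb_sub; last first.
    apply: lipb_mul => //; first exact: lipb_cst.
    apply: lipb_mul => //; first by apply: lipb_sub; [exact: lipb_id|exact: lipb_cst].
    apply: lipb_add; last exact: lipb_mul.
    by apply: lipb_sum => k; exact: lipb_mul.
  apply: lipb_sub; last first.
    apply: lipb_mul => //; first exact: lipb_cst.
    apply: lipb_mul => //; apply: lipb_sum => i; apply: lipb_sum => j.
    by apply: lipb_mul => //; apply: lipb_mul => //; exact: lipb_cst.
  apply: lipb_add; last exact: lipb_mul.
  by apply: lipb_sum => k; exact: lipb_mul.
have [kk lkk] := lPhi.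
have Phi0 t : (forall i, eta t i = 0) -> zeta t = 0 -> Phi t = 0.
  move=> h1 h2; rewrite /Phi /bil h2 !big1 ?(mulr0, expr0n, addr0, subrr)//= ?(mulr0, subr0)//.
  - by move=> k _; rewrite h1 expr0n.
  - by move=> i _; rewrite big1// => j _; rewrite h1 mulr0.
  - by move=> k _; rewrite h1 mulr0.
have Phia : Phi a = 0.
  by apply: Phi0 => [i|]; rewrite /eta /zeta ?za ?(ybd i).1 subrr.
have Phib : Phi b = 0.
  by apply: Phi0 => [i|]; rewrite /eta /zeta ?zb ?(ybd i).2 subrr.
have := lipschitz_integral_lower_bound ab lkk speed2_continuous mN N0.
rewrite Phia Phib !mulr0 subrr => /(_ fh); rewrite adde0; apply => t tab tN.
have t01 : 0 < t < 1.
  by case/andP: tab => h1 h2; rewrite (le_lt_trans a0)// (lt_le_trans h2).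
have t01' := oo _ t01; have tab' : a <= t <= b by case/andP: tab => ? ?; rewrite !ltW.
have [uh [dyh dzh hf]] := hN t tab tN.
have [dy dz dn dp] := dgeo t t01.
pose w i := uh i - u t i.
pose zeta' := 2^-1 * bil W (yh t) uh - 2^-1 * bil W (y t) (u t).
have deta i : is_derive t 1 (fun s => eta s i) (w i) by exact: is_deriveB.
have dzeta : is_derive t 1 zeta zeta' by exact: is_deriveB.
have d1 : is_derive t 1 (fun s => \sum_k momentum (Gt s) (u s) k * eta s k)
    (\sum_k (dpi k t * eta t k + momentum (Gt t) (u t) k * w k)).
  apply: is_derive_bigsum => k; have dd := is_deriveM (dp k) (deta k).
  by apply: (is_derive_eq dd); rewrite /GRing.scale /= /dpi /dnu /Gt; ring.
have d2 : is_derive t 1 (fun s => nu s * zeta s) (dnu t * zeta t + nu t * zeta').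
  have dd := is_deriveM dn dzeta.
  by apply: (is_derive_eq dd); rewrite /GRing.scale /= /dnu; ring.
have d3 : is_derive t 1 (fun s => 2^-1 * (nu s * bil W (y s) (eta s)))
    (2^-1 * (dnu t * bil W (y t) (eta t) + nu t * (bil W (u t) (eta t) + bil W (y t) w))).
  have dd := is_deriveZ 2^-1 (is_deriveM dn (is_derive_bil W dy deta)).
  by apply: (is_derive_eq dd); rewrite /GRing.scale /= /dnu; ring.
have d4 : is_derive t 1 (fun s => \sum_k eta s k ^+ 2) (\sum_k 2 * (eta t k * w k)).
  apply: is_derive_bigsum => k; have dd := is_deriveM (deta k) (deta k).
  by apply: (is_derive_eq dd); rewrite /GRing.scale /=; ring.
have d5 : is_derive t 1 (fun s => \sum_k eta s k ^+ 2 + zeta s ^+ 2)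
    (\sum_k 2 * (eta t k * w k) + 2 * (zeta t * zeta')).
  have dd := is_deriveD d4 (is_deriveM dzeta dzeta).
  by apply: (is_derive_eq dd); rewrite /GRing.scale /=; ring.
have d6 : is_derive t 1 (fun s => K * ((s - a) * (\sum_k eta s k ^+ 2 + zeta s ^+ 2)))
    (K * ((\sum_k eta t k ^+ 2 + zeta t ^+ 2)
      + (t - a) * (\sum_k 2 * (eta t k * w k) + 2 * (zeta t * zeta')))).
  have ds : is_derive t 1 (fun s : R => s - a) (1 - 0) by exact: is_deriveB.
  have dd := is_deriveZ K (is_deriveM ds d5).
  by apply: (is_derive_eq dd); rewrite /GRing.scale /=; ring.
have dPhi : is_derive t 1 (fun s => 2 * Phi s) _ :=
  is_deriveZ 2 (is_deriveB (is_deriveB (is_deriveD d1 d2) d3) d6).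
split; first by have [] := dPhi.
rewrite (@derive_val _ _ _ _ _ _ _ dPhi).
apply: le_trans hf.
have hb := hbox t tab'.
have Eyh : (fun i => y t i + eta t i) = yh t by apply/funext => i; rewrite /eta addrC subrK.
have Euh : (fun i => u t i + w i) = uh by apply/funext => i; rewrite /w addrC subrK.
have etaB : norm1 (eta t) <= B.
  apply: boxB => i; rewrite (le_trans (ler_normB _ _))// lerD//; first exact: hb.1.
  exact: (box t).1.
have kap : 0 <= K * (t - a) <= 1.
  case/andP: tab' => h1 h2; rewrite mulr_ge0 ?subr_ge0//=.
  rewrite (@le_trans _ _ (K * (K + 1)^-1))//.
    by rewrite ler_wpM2l// (le_trans _ (ltW ba))// lerD2r.
  by rewrite ler_pdivrMr ?ltr_wpDl// mul1r lerDl.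
have := hK W (Gt t) (fun i j => G i j (yh t) (zh t)) (fun i j k => D i j k (y t) (z t))
  (fun i j => Dz i j (y t) (z t)) (y t) (u t) (eta t) w (zeta t) (nu t) (K * (t - a)) aW Ww
  (fun i j => let: And5 _ h _ _ _ := regG i j in h _ _ hb)
  (fun i j => let: And5 h _ _ _ _ := regG i j in h _ _ hb)
  (fun i j => let: And5 _ _ h _ _ := regG i j in h _ _ _ _ (box t) hb)
  (fun i j => let: And5 _ _ _ h _ := regG i j in h _ _ _ _ (box t) hb)
  (uB t t01') (yB t) etaB (nuB t t01') kap (dnu t) zeta' (dpi ^~ t) erefl.
rewrite Eyh Euh => /(_ erefl (fun=> erefl)).
rewrite -mulr_sumr /GRing.scale /= /speed2; lra.
Qed.

(** Cauchy-Schwarz in linearized form, [c * p'^2 >= 2 * c * m * p' - c * m^2] with [m] the increment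
    of [p] over [b - a]: a pointwise inequality, which suits an integrand of unknown measurability.
    [p] is frozen after the exit time [s], where only [0 <= fh] is known. *)
Lemma exit_energy (a b s c : R) (p : R -> R) (N : set R) (fh : R -> R) :
  a < s -> s <= b -> 0 <= c -> lipb a s p -> measurable N -> mu N = 0%E ->
  (forall t : R, a < t < s -> ~ N t -> derivable p t 1 /\ c * ('D_1 p t) ^+ 2 <= fh t) ->
  (forall t : R, a < t < b -> ~ N t -> 0 <= fh t) ->
  ((c * (p s - p a) ^+ 2 / (b - a))%:E <= \int[mu]_(t in `]a, b[) (fh t)%:E)%E.
Proof.
move=> las sb c0 [k lk] mN N0 hp hf.
have ab : a < b by exact: lt_le_trans sb.
have ba0 : 0 < b - a by rewrite subr_gt0.
pose m := (p s - p a) / (b - a).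
pose Phi t := 2 * c * m * p (Num.min t s).
have k0 : 0 <= k.
  have := lk a s; rewrite !lexx (ltW las) => /(_ erefl erefl).
  by move=> /(le_trans (normr_ge0 _)); rewrite pmulr_lge0// normr_gt0 subr_eq0 lt_eqF.
have lPhi : lipschitz_within (`|2 * c * m| * k) a b Phi.
  move=> t t' /andP[h1 h2] /andP[h3 h4]; rewrite /Phi -mulrBr normrM.
  rewrite -[_ * k * _]mulrA ler_wpM2l//.
  rewrite (le_trans (lk _ _ _ _))//.
  - by rewrite le_min h1 (ltW las)/= ge_min lexx orbT.
  - by rewrite le_min h3 (ltW las)/= ge_min lexx orbT.
  rewrite ler_wpM2l//.
  have g1 := ler_norm (t - t'); have g2 : t' - t <= `|t - t'| by rewrite distrC ler_norm.
  by rewrite ler_norml; case: (leP t s) => ?; case: (leP t' s) => ?; apply/andP; split; lra.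
have cst : continuous (fun _ : R => - (c * m ^+ 2)) by move=> t; exact: cst_continuous.
(* The corner of [Phi] at [s] joins the null set. *)
have mN' : measurable (N `|` [set s]) by exact: measurableU.
have N0' : mu (N `|` [set s]) = 0%E.
  by rewrite null_set_setU//; (exact: measurable_set1 || exact: lebesgue_measure_set1).
have := @lipschitz_integral_lower_bound R _ a b _ Phi _ fh ab lPhi cst mN' N0'.
have -> : (\int[mu]_(t in `]a, b[) (- (c * m ^+ 2))%:E = (- (c * m ^+ 2) * (b - a))%:E)%E.
  rewrite integral_cst//= lebesgue_measure_itv/= lte_fin ab -EFinD -EFinM//.
rewrite -EFinD.
have -> : - (c * m ^+ 2) * (b - a) + (Phi b - Phi a) = c * (p s - p a) ^+ 2 / (b - a).
  rewrite /Phi (min_r sb) (min_l (ltW las)) /m; field; rewrite gt_eqF//.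
apply=> t tab /not_orP[tN ts].
have [t_s|s_t] := ltP t s.
  have tas : a < t < s by case/andP: tab => -> _.
  have [dp hpt] := hp t tas tN.
  have dd : is_derive t 1 (fun t => 2 * c * m * p t) (2 * c * m * 'D_1 p t).
    exact: (is_deriveZ (2 * c * m) (derivableP dp)).
  have dd' : is_derive t 1 Phi (2 * c * m * 'D_1 p t).
    apply: near_eq_is_derive dd; have tas' : t \in `]a, s[ by rewrite in_itv.
    have := near_in_itvoo tas'; apply: filterS => x; rewrite in_itv/= => /andP[_ xs].
    by rewrite /Phi min_l// ltW.
  split; first by have [] := dd'.
  rewrite (@derive_val _ _ _ _ _ _ _ dd'); apply: le_trans hpt.
  have := mulr_ge0 c0 (sqr_ge0 ('D_1 p t - m)); lra.
have {}s_t : s < t by rewrite lt_neqAle s_t andbT; apply/eqP => st; exact: ts.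
have dd' : is_derive t 1 Phi 0.
  have dd := is_derive_cst (2 * c * m * p s) t 1.
  apply: near_eq_is_derive dd.
  have ts' : t \in `]s, t + 1[ by rewrite in_itv/= s_t ltrDl ltr01.
  have := near_in_itvoo ts'; apply: filterS => x; rewrite in_itv/= => /andP[sx _].
  by rewrite /Phi min_r// ltW.
split; first by have [] := dd'.
rewrite (@derive_val _ _ _ _ _ _ _ dd') addr0 (le_trans _ (hf t tab tN))//.
by rewrite oppr_le0 mulr_ge0// sqr_ge0.
Qed.

Lemma speed2_energy_bound : exists2 B : R, 0 <= B & forall a b : R, 0 <= a -> a < b -> b <= 1 ->
  (\int[mu]_(t in `]a, b[) (speed2 t)%:E <= (B * (b - a))%:E)%E.
Proof.
have [B B0 hB] := continuous_bounded01 speed2_continuous.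
exists B => // a b a0 ab b1.
have -> : ((B * (b - a))%:E = \int[mu]_(t in `]a, b[) B%:E)%E.
  by rewrite integral_cst//= lebesgue_measure_itv/= lte_fin ab -EFinD -EFinM.
apply: le_integral => //.
- have i : mu.-integrable `[a, b]%classic (EFin \o speed2).
    apply: continuous_compact_integrable; first exact: segment_compact.
    exact/continuous_subspaceT/speed2_continuous.
  by apply: integrableS i => //; exact: subset_itv_oo_cc.
- have i : mu.-integrable `[a, b]%classic (EFin \o (fun=> B)).
    apply: continuous_compact_integrable; first exact: segment_compact.
    by apply: continuous_subspaceT => t; exact: cst_continuous.
  by apply: integrableS i => //; exact: subset_itv_oo_cc.
move=> t; rewrite inE/= in_itv/= => /andP[h1 h2]; rewrite lee_fin (le_trans (ler_norm _))// hB//.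
by rewrite (le_trans a0 (ltW h1)) (le_trans (ltW h2)).
Qed.

End local_minimality.

(** * Symplectic normal form *)

Section symplectic_frame.
Context {R : realType} {m : nat}.
Implicit Types (x y : 'rV[R]_m) (g J : 'M[R]_m).

Definition mform g x y : R := bil (fun i j => g i j) (fun i => x 0 i) (fun j => y 0 j).

Lemma mformE g x y : mform g x y = (x *m g *m y^T) 0 0.
Proof.
rewrite /mform /bil exchange_big !mxE; apply: eq_bigr => j _.
rewrite !mxE mulr_suml; apply: eq_bigr => i _; ring.
Qed.

Lemma mformDl g x x' y : mform g (x + x') y = mform g x y + mform g x' y.
Proof. by rewrite !mformE !mulmxDl !mxE. Qed.
Lemma mformDr g x y y' : mform g x (y + y') = mform g x y + mform g x y'.
Proof. by rewrite !mformE linearD/= mulmxDr !mxE. Qed.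
Lemma mformZl g c x y : mform g (c *: x) y = c * mform g x y.
Proof. by rewrite !mformE -!scalemxAl !mxE. Qed.
Lemma mformZr g c x y : mform g x (c *: y) = c * mform g x y.
Proof. by rewrite !mformE linearZ/= -scalemxAr !mxE. Qed.
Lemma mformNl g x y : mform g (- x) y = - mform g x y.
Proof. by rewrite -scaleN1r mformZl mulN1r. Qed.
Lemma mform0l g y : mform g 0 y = 0.
Proof. by rewrite -(scale0r (0 : 'rV[R]_m)) mformZl mul0r. Qed.
Lemma mform_suml g (J : finType) (f : J -> 'rV[R]_m) y :
  mform g (\sum_k f k) y = \sum_k mform g (f k) y.
Proof. by rewrite (big_morph (mform g ^~ y) (fun a b => mformDl g a b y) (mform0l g y)). Qed.

Let coord_cont (i : 'I_m) : continuous (fun x => x 0 i). Proof. exact: coord_continuous. Qed.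

Let term_cont (a : R) (i : 'I_m) : continuous (fun x => a * x 0 i).
Proof.
move=> x; apply: (@continuousM R _ (cst a) (fun x : 'rV[R]_m => x 0 i)); last exact: coord_cont.
exact: cst_continuous.
Qed.

Lemma mform_continuous g : continuous (fun x => mform g x x).
Proof.
apply: continuous_bigsum => i; apply: continuous_bigsum => j x.
apply: (@continuousM R _ (fun x : 'rV[R]_m => g i j * x 0 i) (fun x : 'rV[R]_m => x 0 j)).
  exact: term_cont.
exact: coord_cont.
Qed.

Variables (g J : 'M[R]_m).
Hypotheses (gsym : g^T = g) (gpos : forall x, x != 0 -> 0 < mform g x x).
Hypotheses (Jasym : J^T = - J) (Junit : J \in unitmx).

Lemma mform_sym x y : mform g x y = mform g y x.
Proof. by apply: bil_sym => i j; rewrite -{1}gsym mxE. Qed.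

Lemma mform_asym x y : mform J x y = - mform J y x.
Proof.
apply: bil_asym => i j; have := congr1 (fun A : 'M[R]_m => A j i) Jasym.
by rewrite !mxE.
Qed.

Let mform_ge0 x : 0 <= mform g x x.
Proof. by have [->|/gpos/ltW//] := eqVneq x 0; rewrite mform0l. Qed.

Let mform_eq0 x : mform g x x = 0 -> x = 0.
Proof. by move=> h; apply/eqP; apply: contraT => /gpos; rewrite h ltxx. Qed.

Let gunit : g \in unitmx.
Proof.
rewrite -row_free_unit -kermx_eq0; apply/eqP/row_matrixP => i.
rewrite row0; apply: mform_eq0; rewrite mformE.
by have /sub_kermxP -> := row_sub i (kermx g); rewrite mul0mx mxE.
Qed.

(** Operator representing [J] with respect to [g]. It is invertible and [g]-skew, so the orthogonal
    of an invariant plane is invariant. *)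
Let K := J *m invmx g.

Let mformK x y : mform g (x *m K) y = mform J x y.
Proof. by rewrite !mformE /K !mulmxA mulmxKV. Qed.

Let Kunit : K \in unitmx. Proof. by rewrite unitmx_mul Junit unitmx_inv gunit. Qed.

Let K_eq0 x : x *m K = 0 -> x = 0.
Proof. by move=> h; rewrite -(mulmxK Kunit x) h mul0mx. Qed.

Let skewK x y : mform g (x *m K) y = - mform g x (y *m K).
Proof. by rewrite mformK mform_asym -mformK mform_sym. Qed.

(** Orthonormal pairs spanning planes on which [K] is a quarter turn times [beta]. Natural numbers
    below a bound, rather than ordinals, allow a pair to be appended without a change of type. *)
Definition skew_frame (d : nat) (e : nat -> bool -> 'rV[R]_m) (beta : nat -> R) :=
  forall j b, (j < d)%N -> [/\ 0 < beta j,
    e j b *m K = (sgnb b * beta j) *: e j (~~ b) &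
    forall j' b', (j' < d)%N -> mform g (e j b) (e j' b') = ((j == j') && (b == b'))%:R].

(** Orthonormality gives the matrix of the vectors [e i false] a right inverse. The bound makes a
    frame of maximal size exist. *)
Let frame_size d e beta : skew_frame d e beta -> (d <= m)%N.
Proof.
move=> fr; pose E : 'M[R]_(d, m) := \matrix_(i < d) e i false.
have : E *m (g *m E^T) = 1%:M.
  apply/matrixP => i k; rewrite mulmxA !mxE.
  have [_ _ /(_ k false (ltn_ord k))] := fr i false (ltn_ord i).
  rewrite mformE andbT => h; transitivity ((e i false *m g *m (e k false)^T) 0 0).
    rewrite !mxE; apply: eq_bigr => j _; rewrite !mxE; congr (_ * _).
    by apply: eq_bigr => l _; rewrite !mxE.
  by rewrite h.
exact: mulmx1_min.
Qed.

(* On the [g]-orthogonal of the frame, a maximizer [x0] of [|x K|^2 / |x|^2]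
   spans with [x0 K] a further invariant plane. *)
Let frame_extend d e beta x : skew_frame d e beta -> x != 0 ->
  (forall j b, (j < d)%N -> mform g x (e j b) = 0) ->
  exists e' beta', skew_frame d.+1 e' beta'.
Proof.
move=> fr xn0 xo.
pose V := [set v : 'rV[R]_m | forall j b, (j < d)%N -> mform g v (e j b) = 0].
have VK v : V v -> V (v *m K).
  move=> Vv j b jd; rewrite skewK; have [_ -> _] := fr j b jd.
  by rewrite mformZr Vv// mulr0 oppr0.
have VZ c v : V v -> V (c *: v) by move=> Vv j b jd; rewrite mformZl Vv// mulr0.
have VD v w : V v -> V w -> V (v + w) by move=> Vv Vw j b jd; rewrite mformDl Vv// Vw// addr0.
(* The quotient to maximize is homogeneous of degree [0], so the sphere of the sup norm serves as
   the compact domain. *)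
pose S := [set v : 'rV[R]_m | V v /\ `|v| = 1].
have S0 : S !=set0.
  exists (`|x|^-1 *: x); split; first exact: VZ.
  by rewrite normrZ normfV normr_id mulVf// normr_eq0.
have cS : compact S.
  apply: bounded_closed_compact.
    exists 1; split => // r r1 v [_ v1]; have v1' : `|v| <= 1 by rewrite v1.
    exact: le_trans v1' (ltW r1).
  have -> : S = (\bigcap_(k in [set k : nat * bool | (k.1 < d)%N])
      [set v | mform g v (e k.1 k.2) = 0]) `&` [set v | `|v| = 1].
    apply/seteqP; split => v /= [h1 h2]; split => //; first by move=> k; exact: h1.
    by move=> j b jd; exact: (h1 (j, b)).
  apply: closedI; last first.
    apply: (@closed_comp _ _ (fun v : 'rV[R]_m => `|v|) [set 1]); last exact: closed_eq.
    by move=> v _; exact: norm_continuous.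
  apply: closed_bigI => k _.
  apply: (@closed_comp _ _ (fun v : 'rV[R]_m => mform g v (e k.1 k.2)) [set 0]); last exact: closed_eq.
  move=> v _; move: v; apply: continuous_bigsum => i; apply: continuous_bigsum => j v.
  apply: (@continuousM R _ (fun x : 'rV[R]_m => g i j * x 0 i) (cst (e k.1 k.2 0 j))).
    exact: term_cont.
  exact: cst_continuous.
pose h := K *m g *m K^T.
have hE v : mform h v v = mform g (v *m K) (v *m K).
  by rewrite !mformE trmx_mul /h !mulmxA.
have Sn0 v : S v -> v != 0 by move=> [_ v1]; rewrite -normr_eq0 v1 oner_eq0.
have cr : {within S, continuous (fun v => mform h v v / mform g v v)}.
  rewrite continuous_subspace_in => v /set_mem Sv.
  apply: continuous_subspaceT_for => //.
  apply: (@continuousM R _ (fun v : 'rV[R]_m => mform h v v) (fun v => (mform g v v)^-1)).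
    exact: mform_continuous.
  apply: continuousV; last exact: mform_continuous.
  by rewrite gt_eqF// gpos// Sn0.
have [x0 /set_mem Sx0 hmax] := EVT_max_rV S0 cS cr.
have x0n := Sn0 _ Sx0; have [Vx0 _] := Sx0.
pose M := mform h x0 x0 / mform g x0 x0.
have gx0 := gpos x0n.
have M0 : 0 < M.
  by rewrite divr_gt0// hE gpos//; apply: contra_neq x0n; exact: K_eq0.
have hM v : V v -> mform h v v <= M * mform g v v.
  move=> Vv; have [->|vn0] := eqVneq v 0; first by rewrite !mform0l mulr0.
  have nv : `|v| != 0 by rewrite normr_eq0.
  have Sv : S (`|v|^-1 *: v).
    by split; [exact: VZ|rewrite normrZ normfV normr_id mulVf].
  have := hmax _ (mem_set Sv); rewrite !mformZl !mformZr -/M.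
  rewrite -[_ / _](_ : mform h v v / mform g v v = _); last first.
    by field; rewrite nv gt_eqF// gpos.
  by rewrite ler_pdivrMr// gpos.
(* Stationarity of the quotient at [x0] in the direction [w]. *)
have key w : V w -> mform g (x0 *m K) (w *m K) = M * mform g x0 w.
  move=> Vw.
  pose c := M * mform g x0 w - mform g (x0 *m K) (w *m K).
  pose q := M * mform g w w - mform h w w.
  have q0 : 0 <= q by rewrite subr_ge0 hM.
  have ineq t : 0 <= 2 * t * c + t ^+ 2 * q.
    have := hM _ (VD _ _ Vx0 (VZ t _ Vw)); rewrite -subr_ge0.
    rewrite hE mulmxDl -scalemxAl !(mformDl, mformDr, mformZl, mformZr) -!hE.
    rewrite (mform_sym (w *m K)) (mform_sym w).
    have -> : mform h x0 x0 = M * mform g x0 x0 by rewrite /M divfK// gt_eqF.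
    by rewrite /c /q; lra.
  have : c = 0; last by rewrite /c; lra.
  apply/eqP; apply: contraT => cn0.
  have q1 : 0 < q + 1 by rewrite ltr_wpDl.
  (* At this [t] the quadratic [2 * t * c + t ^+ 2 * q] is negative unless [c = 0]. *)
  have := ineq (- c / (q + 1)).
  have -> : 2 * (- c / (q + 1)) * c + (- c / (q + 1)) ^+ 2 * q =
      - (c ^+ 2 / (q + 1) ^+ 2 * (q + 2)) by field; rewrite gt_eqF.
  rewrite oppr_ge0 leNgt => /negP; case.
  apply: mulr_gt0; last by lra.
  by apply: divr_gt0; [rewrite lt_def sqr_ge0 sqrf_eq0 cn0|exact: exprn_gt0].
(* By [key] and skewness the difference [v] of the two sides, which lies in [V], is orthogonal to
   itself. *)
have KK : x0 *m K *m K = - M *: x0.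
  apply/eqP; rewrite -subr_eq0 scaleNr opprK; apply/eqP; apply: mform_eq0.
  set v := _ + _; have Vv : V v by apply: VD; [exact/VK/VK|exact: VZ].
  rewrite {1}/v mformDl mformZl -(key v Vv) skewK; ring.
pose s := Num.sqrt (mform g x0 x0); pose r := Num.sqrt M.
have s0 : 0 < s by rewrite sqrtr_gt0.
have r0 : 0 < r by rewrite sqrtr_gt0.
have s2 : s ^+ 2 = mform g x0 x0 by rewrite sqr_sqrtr// ltW.
have r2 : r ^+ 2 = M by rewrite sqr_sqrtr// ltW.
pose e1 := s^-1 *: x0; pose f1 := (s * r)^-1 *: (x0 *m K).
exists (fun j b => if (j < d)%N then e j b else if b then f1 else e1).
exists (fun j => if (j < d)%N then beta j else r).
have Ve1 : V e1 by exact: VZ.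
have Vf1 : V f1 by apply: VZ; exact: VK.
have gKK : mform g (x0 *m K) (x0 *m K) = r ^+ 2 * s ^+ 2 by rewrite key// r2 s2.
have gxK : mform g x0 (x0 *m K) = 0.
  have := skewK x0 x0; rewrite (mform_sym (x0 *m K)); lra.
have n1 (b b' : bool) : mform g (if b then f1 else e1) (if b' then f1 else e1) = (b == b')%:R.
  case: b b' => -[]; rewrite /e1 /f1 !(mformZl, mformZr) ?gKK ?gxK ?(mform_sym (x0 *m K)) ?gxK -?s2 ?mulr0//.
    by rewrite /=; field; rewrite !gt_eqF.
  by rewrite /=; field; rewrite !gt_eqF.
move=> j b; rewrite ltnS leq_eqVlt => /predU1P[->|jd].
  rewrite ltnn; split=> //.
    case: b => /=; rewrite /f1 /e1 -scalemxAl ?KK scalerA.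
      by rewrite scalerA -r2; congr (_ *: _); field; rewrite !gt_eqF.
    by congr (_ *: _); field; rewrite !gt_eqF.
  move=> j' b'; rewrite ltnS leq_eqVlt => /predU1P[->|j'd].
    by rewrite ltnn eqxx n1.
  rewrite j'd gtn_eqF//=; case: b; [exact: Vf1|exact: Ve1].
rewrite jd; have [b0 eK on] := fr j b jd; split=> //.
move=> j' b'; rewrite ltnS leq_eqVlt => /predU1P[->|j'd].
  rewrite ltnn ltn_eqF//= mform_sym; case: b'; [exact: Vf1|exact: Ve1].
by rewrite j'd on.
Qed.

(** A frame of maximal size spans the space: otherwise the component of some vector orthogonal to it
    would extend it. *)
Lemma symplectic_frame : exists (d : nat) (e : 'I_d * bool -> 'rV[R]_m) (beta : 'I_d -> R),
  [/\ forall j, 0 < beta j, forall i k, mform g (e i) (e k) = (i == k)%:R,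
      forall i k, mform J (e i) (e k) = planeW beta i k &
      forall x, x = \sum_i mform g x (e i) *: e i].
Proof.
pose P d := `[< exists e beta, skew_frame d e beta >].
have P0 : exists d, P d by exists 0; apply/asboolP; exists (fun _ _ => 0), (fun=> 0).
have Pb d : P d -> (d <= m)%N by move=> /asboolP[e [beta]]; exact: frame_size.
have [d /asboolP[e [beta fr]] dmax] := ex_maxnP P0 Pb.
exists d, (fun i : 'I_d * bool => e i.1 i.2), (fun j : 'I_d => beta j).
have on i k : mform g (e (i : 'I_d * bool).1 i.2) (e (k : 'I_d * bool).1 k.2) = (i == k)%:R.
  have [_ _ ->//] := fr i.1 i.2 (ltn_ord i.1).
split=> //.
- by move=> j; have [] := fr j false (ltn_ord j).
- move=> i k; rewrite -mformK; have [_ -> h] := fr i.1 i.2 (ltn_ord i.1).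
  rewrite mformZl; have [_ _ ->//] := fr i.1 (~~ i.2) (ltn_ord i.1).
  rewrite /planeW -val_eqE (eq_sym k.2).
  by case: ((val i.1 == val k.1) && _); rewrite ?mulr1 ?mulr0.
move=> x; apply/eqP; rewrite -subr_eq0; set x' := x - _.
apply: contraT => x'n0; have [//|e' [beta' fr']] := @frame_extend d e beta x' fr x'n0.
  move=> j b jd; rewrite /x' mformDl mformNl mform_suml.
  rewrite (bigD1 (Ordinal jd, b))//= mformZl (on (Ordinal jd, b) (Ordinal jd, b)) eqxx mulr1.
  rewrite big1 ?addr0 ?subrr// => k kj.
  by rewrite mformZl (on k (Ordinal jd, b)) (negPf kj) mulr0.
by have := dmax d.+1; rewrite ltnn; apply; apply/asboolP; exists e', beta'.
Qed.

End symplectic_frame.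

(** * Calculus in charts *)

Section c1_calculus.
Context {R : realType}.

Lemma rV_coord_le N (v : 'rV[R]_N) i : `|v 0 i| <= `|v|.
Proof.
rewrite [leRHS]/Num.Def.normr/= mx_normrE.
exact: (le_bigmax _ (fun k : 'I_1 * 'I_N => `|v k.1 k.2|) (0, i)).
Qed.

Lemma rV_norm_le N (v : 'rV[R]_N) (r : R) : 0 <= r -> (forall i, `|v 0 i| <= r) -> `|v| <= r.
Proof.
move=> r0 h; rewrite [leLHS]/Num.Def.normr/= mx_normrE; apply/bigmax_leP; split=> // -[i j] _ /=.
by rewrite (ord1 i).
Qed.

Lemma rV_norm_lt N (v : 'rV[R]_N) (r : R) : 0 < r -> (forall i, `|v 0 i| < r) -> `|v| < r.
Proof.
move=> r0 h; rewrite [ltLHS]/Num.Def.normr/= mx_normrE; apply/bigmax_ltP; split=> // -[i j] _ /=.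
by rewrite (ord1 i).
Qed.

Lemma norm_convex_lt (th a b r : R) : 0 <= th <= 1 -> `|a| < r -> `|b| < r ->
  `|(1 - th) * a + th * b| < r.
Proof.
move=> /andP[t0 t1] ar br; apply: (@le_lt_trans _ _ (Num.max `|a| `|b|)); last by rewrite gt_max ar br.
rewrite (le_trans (ler_normD _ _))// !normrM (ger0_norm t0) ger0_norm ?subr_ge0//.
have h1 : `|a| <= Num.max `|a| `|b| by rewrite le_max lexx.
have h2 : `|b| <= Num.max `|a| `|b| by rewrite le_max lexx orbT.
by move: h1 h2; set m := Num.max _ _; nra.
Qed.

Lemma is_derive_line {V W : normedModType R} (f : V -> W) (x v : V) (s : R) :
  derivable f (x + s *: v) v ->
  is_derive s (1 : R) (fun t : R => f (x + t *: v)) ('D_v f (x + s *: v)).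
Proof.
have E : (fun h : R => h^-1 *: (((fun t : R => f (x + t *: v)) \o shift s) (h *: (1 : R)) -
    f (x + s *: v))) =
  (fun h : R => h^-1 *: ((f \o shift (x + s *: v)) (h *: v) - f (x + s *: v))).
  by apply/funext => h /=; rewrite [h *: (1 : R)]mulr1 scalerDl addrCA.
by move=> df; apply: DeriveDef; rewrite /derivable /derive E.
Qed.

Lemma line_increment_le {V : normedModType R} (f : V -> R^o) (x v : V) (l K w : R) :
  (forall t : R, (0 <= t <= w) || (w <= t <= 0) ->
    derivable f (x + t *: v) v /\ `|'D_v f (x + t *: v) - l| <= K) ->
  `|f (x + w *: v) - f x - w * l| <= K * `|w|.
Proof.
move=> h.
pose phi (t : R) : R := f (x + t *: v) - t * l.
have dphi (t : R) : (0 <= t <= w) || (w <= t <= 0) ->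
    is_derive t (1 : R) phi ('D_v f (x + t *: v) - l).
  move=> /h[df _]; have d1 := is_derive_line df.
  have d2 : is_derive t (1 : R) (fun t : R => t * l) l.
    have := is_deriveM (is_derive_id t (1 : R)) (is_derive_cst l t (1 : R)).
    by move=> d; apply: (is_derive_eq d); rewrite scaler0 add0r; exact: mulr1.
  exact: (is_deriveB d1 d2).
have E : f (x + w *: v) - f x - w * l = phi w - phi 0.
  by rewrite /phi scale0r addr0 mul0r subr0; ring.
rewrite E; have [w0|w0] := leP 0 w.
  have [||c cI ->] := @MVT_segment R phi (fun t => 'D_v f (x + t *: v) - l) 0 w w0.
  - by move=> t; rewrite in_itv/= => /andP[/ltW t0 /ltW tw]; apply: dphi; rewrite t0 tw.
  - apply: derivable_within_continuous => t; rewrite in_itv/= => tI.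
    by apply: (@ex_derive _ _ _ _ _ _ _ (dphi t _)); rewrite tI.
  rewrite subr0 normrM ler_wpM2r//; apply: (h c _).2.
  by move: cI; rewrite in_itv/= => ->.
have [||c cI] := @MVT_segment R phi (fun t => 'D_v f (x + t *: v) - l) w 0 (ltW w0).
- by move=> t; rewrite in_itv/= => /andP[/ltW t0 /ltW tw]; apply: dphi; rewrite t0 tw orbT.
- apply: derivable_within_continuous => t; rewrite in_itv/= => tI.
  by apply: (@ex_derive _ _ _ _ _ _ _ (dphi t _)); rewrite tI orbT.
rewrite distrC => ->; rewrite sub0r normrM normrN ler_wpM2r//; apply: (h c _).2.
by move: cI; rewrite in_itv/= => ->; rewrite orbT.
Qed.

(** The coordinates are changed one at a time, each along a line to which the mean value theorem
    applies. [P] has to contain the whole box of intermediate points, since only derivatives along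
    the [b i] are controlled. *)
Lemma increment_le {V : normedModType R} (I : eqType) (b : I -> V) (l : I -> R) (K : R)
    (P : set V) (f : V -> R^o) (w : I -> R) (s : seq I) (x : V) : uniq s ->
  (forall i p, P p -> derivable f p (b i) /\ `|'D_(b i) f p - l i| <= K) ->
  (forall th : I -> R, (forall i, 0 <= th i <= 1) ->
    P (x + \sum_(i <- s) (th i * w i) *: b i)) ->
  `|f (x + \sum_(i <- s) w i *: b i) - f x - \sum_(i <- s) w i * l i| <=
    K * \sum_(i <- s) `|w i|.
Proof.
move=> us hP; elim: s x us => [|i s IH] x /=.
  by move=> _ _; rewrite !big_nil addr0 !subr0 subrr normr0 mulr0.
move=> /andP[is_ us] hx; rewrite !big_cons.
have upd (th : I -> R) (c : R) :
    \sum_(j <- s) ((if j == i then c else th j) * w j) *: b j = \sum_(j <- s) (th j * w j) *: b j.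
  by apply: eq_big_seq => j js; case: eqP => // ji; rewrite -ji js in is_.
have := IH (x + w i *: b i) us; set A := \sum_(j <- s) w j *: b j.
move=> /(_ _)/wrap[].
  move=> th th01; have := hx (fun j => if j == i then 1 else th j).
  rewrite big_cons eqxx upd mul1r addrA; apply=> j; case: eqP => // _.
  by rewrite ler01 lexx.
move=> h2.
have h1 : `|f (x + w i *: b i) - f x - w i * l i| <= K * `|w i|.
  apply: line_increment_le => t tI; apply: hP.
  have [th th01 ->] : exists2 th : R, 0 <= th <= 1 & t = th * w i.
    have [w0|w0] := eqVneq (w i) 0.
      exists 0; first by rewrite lexx ler01.
      by rewrite mul0r; case/orP: tI; rewrite w0 => /andP[t1 t2]; apply/le_anti/andP.
    exists (t / w i); last by rewrite divfK.
    case/orP: tI => /andP[t1 t2].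
      have wp : 0 < w i by rewrite lt_neqAle eq_sym w0 (le_trans t1).
      by rewrite divr_ge0 ?(ltW wp)//= ler_pdivrMr// mul1r.
    have wp : w i < 0 by rewrite lt_neqAle w0 (le_trans t1).
    by rewrite ler_ndivrMr// mul1r t1 andbT; rewrite -mulrNN -invrN divr_ge0// oppr_ge0 // ltW.
  have := hx (fun j => if j == i then th else 0); rewrite big_cons eqxx (upd (fun=> 0)).
  rewrite big1 ?addr0; last by move=> j _; rewrite mul0r scale0r.
  by apply=> j; case: eqP => // _; rewrite lexx ler01.
rewrite mulrDr (addrA x); apply: le_trans (lerD h1 h2); apply: le_trans (ler_normD _ _).
by rewrite le_eqVlt; apply/orP; left; apply/eqP; congr `|_|; ring.
Qed.

(** [Ck_on] speaks of directional derivatives only. Continuity of the partial derivatives makes [f]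
    differentiable, which a chain rule along an arbitrary curve requires. *)
Lemma C1_increment N (W : set 'rV[R]_N) (f : 'rV[R]_N -> R^o) (x : 'rV[R]_N) (e : R) :
  open W -> Ck_on 1 W f -> W x -> 0 < e ->
  \forall p \near x, `|f p - f x - \sum_i (p - x) 0 i * 'D_('e_i) f x| <=
    e * \sum_i `|(p - x) 0 i|.
Proof.
move=> oW [cf df] Wx e0.
have : \forall p \near x, W p /\ forall i : 'I_N, `|'D_('e_i) f p - 'D_('e_i) f x| <= e.
  near=> p; split; first by near: p; apply: open_nbhs_nbhs.
  near: p; apply: filter_forall => i.
  have [_ [cD _]] := df 'e_i; have := cD x Wx; move/cvgrPdist_le => /(_ e e0).
  by apply: filterS => p; rewrite distrC.
move=> /nbhs_ballP[r /= r0 hr].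
apply/nbhs_ballP; exists r => //= p; rewrite -ball_normE /ball_/= distrC.
have -> : f p = f (x + (p - x)) by congr f; rewrite addrC subrK.
move: (p - x) => {p} h hr'; rewrite [X in f (x + X)]row_sum_delta.
apply: (@increment_le _ _ (fun i : 'I_N => 'e_i) (fun i => 'D_('e_i) f x) e
  (fun p => ball x r p) f (fun i => h 0 i) (index_enum 'I_N) x).
- exact: index_enum_uniq.
- by move=> i p /hr[Wp hp]; split; [exact: (df 'e_i).1|exact: hp].
move=> th th01; rewrite -ball_normE /ball_/= opprD addrA subrr sub0r normrN.
apply: rV_norm_lt => // i.
have -> : \sum_j (th j * h 0 j) *: 'e_j = \row_j (th j * h 0 j) :> 'rV[R]_N.
  by rewrite [RHS]row_sum_delta; apply: eq_bigr => j _; rewrite mxE.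
rewrite mxE.
rewrite normrM (le_lt_trans _ hr')// (le_trans _ (rV_coord_le _ i))//.
by have /andP[t0 t1] := th01 i; rewrite ler_piMl// ger0_norm.
Unshelve. all: by end_near. Qed.

Lemma C1_chain_coord N (W : set 'rV[R]_N) (f : 'rV[R]_N -> R^o) (g : R -> 'rV[R]_N) (t : R) :
  open W -> Ck_on 1 W f -> W (g t) -> derivable g t (1 : R) ->
  is_derive t (1 : R) (f \o g) (\sum_i 'D_1 g t 0 i * 'D_('e_i) f (g t)).
Proof.
move=> oW cf Wt dg.
set v := 'D_1 g t; set x := g t.
pose h (s : R) := g (s + t) - x.
have dgi i : (fun s : R => s^-1 * (h s) 0 i) @ 0^' --> v 0 i.
  have /derivable_mxP/(_ 0 i) dgi := dg.
  rewrite /v derive_mx// mxE; move: dgi => /cvg_ex[l hl].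
  have -> : 'D_1 (fun s : R => g s 0 i) t = l by apply/cvg_lim.
  apply: cvg_trans hl; apply: near_eq_cvg; near=> s.
  by rewrite /= /h !mxE [s *: (1 : R)]mulr1.
have /differentiable_continuous ct := (derivable1_diffP g t).1 dg.
have ct' : g (s + t) @[s --> 0^'] --> x.
  apply: (@cvg_trans _ (g (s + t) @[s --> (0 : R)])); first by move=> A hA; exact: (nbhs_dnbhs hA).
  apply: (@cvg_comp _ _ _ (fun s : R => s + t) g _ (nbhs t)); last exact: ct.
  have {2}-> : t = 0 + t by rewrite add0r.
  by apply: cvgD; [exact: cvg_id|exact: cvg_cst].
(* [S] is the quotient of the linearization. [C1_increment] bounds its distance to [q] by a small
   multiple of the difference quotients of [g], which converge. *)
pose S (s : R) : R := \sum_i s^-1 * h s 0 i * 'D_('e_i) f x.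
have cS : S s @[s --> 0^'] --> (\sum_i v 0 i * 'D_('e_i) f x : R).
  apply: cvg_big; first exact: add_continuous.
  by move=> i _; apply: cvgM; [exact: dgi|exact: cvg_cst].
have cA : \sum_i `|s^-1 * h s 0 i| @[s --> 0^'] --> (\sum_i `|v 0 i| : R).
  apply: cvg_big; first exact: add_continuous.
  by move=> i _; apply: cvg_norm; exact: dgi.
pose q (s : R) : R := s^-1 * (f (g (s + t)) - f x).
have cq : q s @[s --> 0^'] --> (\sum_i v 0 i * 'D_('e_i) f x : R).
  have V0 : 0 <= \sum_i `|v 0 i| by apply: sumr_ge0.
  rewrite -[X in _ --> X]addr0.
  rewrite (_ : q = fun s => S s + (q s - S s)); last by apply/funext => s; ring.
  apply: cvgD => //; apply/cvgrPdist_le => e e0.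
  have V1 : 0 < \sum_i `|v 0 i| + 1 by rewrite ltr_wpDl.
  have := C1_increment oW cf Wt (divr_gt0 e0 V1); move/ct' => near1.
  near=> s.
  have s0 : s != 0 by near: s; exact: nbhs_dnbhs_neq.
  have h1 : `|f (g (s + t)) - f x - \sum_i h s 0 i * 'D_('e_i) f x| <=
      e / (\sum_i `|v 0 i| + 1) * \sum_i `|h s 0 i| by near: s.
  have h2 : \sum_i `|s^-1 * h s 0 i| <= \sum_i `|v 0 i| + 1.
    near: s; move/cvgrPdist_le : cA => /(_ 1 ltr01); apply: filterS => s.
    by rewrite ler_distlC => /andP[_].
  have -> : q s - S s = s^-1 * (f (g (s + t)) - f x - \sum_i h s 0 i * 'D_('e_i) f x).
    rewrite /q /S [RHS]mulrBr mulr_sumr; congr (_ - _); apply: eq_bigr => i _; ring.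
  rewrite sub0r normrN normrM (le_trans (ler_wpM2l (normr_ge0 _) h1))//.
  have -> : `|s^-1| * (e / (\sum_i `|v 0 i| + 1) * \sum_i `|h s 0 i|) =
      e / (\sum_i `|v 0 i| + 1) * \sum_i `|s^-1 * h s 0 i|.
    by rewrite mulrCA; congr (_ * _); rewrite mulr_sumr; apply: eq_bigr => i _; rewrite normrM.
  by rewrite (le_trans (ler_wpM2l _ h2)) ?divfK ?gt_eqF// divr_ge0 ?ltW.
have quot : (fun s : R => s^-1 *: (((f \o g) \o shift t) (s *: (1 : R)) - (f \o g) t)) @ 0^' -->
    (\sum_i v 0 i * 'D_('e_i) f x : R^o).
  rewrite (_ : (fun s : R => _) = q); first exact: cq.
  by apply/funext => s; rewrite /q /= [s *: (1 : R)]mulr1.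
apply: DeriveDef; first by apply/cvg_ex; eexists; exact: quot.
by apply/cvg_lim => //; exact: quot.
Unshelve. all: by end_near. Qed.

(** The coordinate form is applied also to the straight line through [g t] with the same velocity;
    the comparison identifies the sum of partial derivatives with the derivative along [v]. *)
Lemma C1_chain N (W : set 'rV[R]_N) (f : 'rV[R]_N -> R^o) (g : R -> 'rV[R]_N) (t : R) :
  open W -> Ck_on 1 W f -> W (g t) -> derivable g t (1 : R) ->
  is_derive t (1 : R) (f \o g) ('D_('D_1 g t) f (g t)).
Proof.
move=> oW cf Wt dg; apply: is_derive_eq (C1_chain_coord oW cf Wt dg) _.
set v := 'D_1 g t; set x := g t.
have dv : derivable f (x + 0 *: v) v by rewrite scale0r addr0; exact: (cf.2 v).1.
have d1 := is_derive_line dv.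
have dl : is_derive (0 : R) (1 : R) (fun s : R => x + s *: v) v.
  have did := is_derive_id (x + 0 *: v) v.
  have := is_derive_line (@ex_derive _ _ _ _ _ _ _ did).
  by rewrite (@derive_val _ _ _ _ _ _ _ did).
have := @C1_chain_coord N W f (fun s : R => x + s *: v) 0 oW cf _ (@ex_derive _ _ _ _ _ _ _ dl).
rewrite scale0r addr0 => /(_ Wt) d2.
have := @derive_val _ _ _ _ _ _ _ d1; rewrite (@derive_val _ _ _ _ _ _ _ d2).
by rewrite (@derive_val _ _ _ _ _ _ _ dl) scale0r addr0.
Qed.

Lemma C1_coord N m (W : set 'rV[R]_N) (f : 'rV[R]_N -> 'rV[R]_m) i :
  open W -> Ck_on 1 W f -> Ck_on 1 W (fun x => f x 0 i : R^o).
Proof.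
move=> oW [cf df]; split=> [x Wx|v].
  by apply: (@continuous_comp _ _ _ f (fun A : 'rV[R]_m => A 0 i)); [exact: cf|exact: coord_continuous].
have [dv [cD _]] := df v; split=> [x Wx|].
  by have /derivable_mxP := dv x Wx; exact.
split=> // x Wx.
have E : \forall y \near x, 'D_v f y 0 i = 'D_v (fun y => f y 0 i : R^o) y.
  have : \forall y \near x, W y by apply: open_nbhs_nbhs.
  by apply: filterS => y Wy; rewrite (derive_mx (dv y Wy)) mxE.
rewrite /prop_for /continuous_at -(nbhs_singleton E).
apply: cvg_trans (near_eq_cvg E) _.
apply: (@continuous_comp _ _ _ ('D_v f) (fun A : 'rV[R]_m => A 0 i)); first exact: cD.
exact: coord_continuous.
Qed.

Lemma C1_chain_rV N m (W : set 'rV[R]_N) (f : 'rV[R]_N -> 'rV[R]_m) (g : R -> 'rV[R]_N) (t : R) :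
  open W -> Ck_on 1 W f -> W (g t) -> derivable g t (1 : R) ->
  is_derive t (1 : R) (f \o g) ('D_('D_1 g t) f (g t)).
Proof.
move=> oW cf Wt dg; have dc i := C1_chain oW (C1_coord i oW cf) Wt dg.
have df : derivable (f \o g) t (1 : R).
  by apply/derivable_mxP => i j; rewrite (ord1 i); exact: (@ex_derive _ _ _ _ _ _ _ (dc j)).
apply: DeriveDef => //; rewrite (derive_mx df) (derive_mx ((cf.2 _).1 _ Wt)).
by apply/matrixP => i j; rewrite !mxE (ord1 i); exact: (@derive_val _ _ _ _ _ _ _ (dc j)).
Qed.

Lemma C1_lipschitz_near N (W : set 'rV[R]_N) (f : 'rV[R]_N -> R^o) (x : 'rV[R]_N) :
  open W -> Ck_on 1 W f -> W x ->
  exists K r : R, [/\ 0 <= K, 0 < r & forall p p', `|x - p| < r -> `|x - p'| < r ->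
    `|f p' - f p| <= K * `|p' - p|].
Proof.
move=> oW [cf df] Wx.
pose K0 := \sum_i `|'D_('e_i) f x| + 1.
have : \forall p \near x, W p /\ forall i : 'I_N, `|'D_('e_i) f p| <= K0.
  near=> p; split; first by near: p; apply: open_nbhs_nbhs.
  near: p; apply: filter_forall => i.
  have [_ [cD _]] := df 'e_i; have := cD x Wx; move/cvgrPdist_le => /(_ 1 ltr01).
  apply: filterS => p; rewrite distrC => h.
  rewrite -[X in `|X|](subrK ('D_('e_i) f x)) addrC (le_trans (ler_normD _ _))// lerD//.
  by rewrite (bigD1 i)//= lerDl sumr_ge0.
move=> /nbhs_ballP[r /= r0 hr]; exists (K0 * N%:R), r; split=> //.
  by rewrite mulr_ge0// addr_ge0// sumr_ge0.
move=> p p' hp hp'.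
have := @increment_le _ _ (fun i : 'I_N => 'e_i) (fun=> 0) K0
  (fun p => ball x r p) f (fun i => (p' - p) 0 i) (index_enum 'I_N) p.
rewrite -row_sum_delta [p + (p' - p)]addrC subrK big1 ?subr0; last by move=> i _; rewrite mulr0.
move=> h; apply: (le_trans (h _ _ _)).
- exact: index_enum_uniq.
- by move=> i y /hr[Wy hy]; rewrite subr0; split; [exact: (df 'e_i).1|exact: hy].
- move=> th th01; rewrite -ball_normE /ball_/=; apply: rV_norm_lt => // i.
  have -> : \sum_j (th j * (p' - p) 0 j) *: 'e_j = \row_j (th j * (p' - p) 0 j) :> 'rV[R]_N.
    by rewrite [RHS]row_sum_delta; apply: eq_bigr => j _; rewrite mxE.
  rewrite !mxE; have := le_lt_trans (rV_coord_le _ i) hp; have := le_lt_trans (rV_coord_le _ i) hp'.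
  rewrite !mxE => h2 h1; rewrite (_ : _ - _ = (1 - th i) * (x 0 i - p 0 i) + th i * (x 0 i - p' 0 i)).
    exact: norm_convex_lt.
  by ring.
rewrite -mulrA ler_wpM2l ?addr_ge0// ?sumr_ge0//.
rewrite (le_trans (ler_sum _ (fun i _ => rV_coord_le (p' - p) i)))// sumr_const card_ord.
by rewrite mulr_natl.
Unshelve. all: by end_near. Qed.

Definition lincomb {N} (J : finType) (b : J -> 'rV[R]_N) (c : J -> R) : 'rV[R]_N :=
  \sum_j c j *: b j.

Lemma norm_convex_le (th a b r : R) : 0 <= th <= 1 -> `|a| <= r -> `|b| <= r ->
  `|a + th * (b - a)| <= r.
Proof.
move=> /andP[t0 t1] ar br; rewrite (_ : a + _ = (1 - th) * a + th * b); last by ring.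
rewrite (le_trans (ler_normD _ _))// !normrM (ger0_norm t0) ger0_norm ?subr_ge0//.
by move: ar br; set x := `|a|; set y := `|b|; nra.
Qed.

Lemma box_increment_le N (J : finType) (b : J -> 'rV[R]_N) (l : J -> R) (K : R)
    (f : 'rV[R]_N -> R^o) (c c' : J -> R) :
  (forall th : J -> R, (forall j, 0 <= th j <= 1) ->
    let p := lincomb b (fun j => c j + th j * (c' j - c j)) in
    forall j, derivable f p (b j) /\ `|'D_(b j) f p - l j| <= K) ->
  `|f (lincomb b c') - f (lincomb b c) - \sum_j (c' j - c j) * l j| <=
    K * \sum_j `|c' j - c j|.
Proof.
move=> h.
have E (th : J -> R) : lincomb b c + \sum_j (th j * (c' j - c j)) *: b j =
    lincomb b (fun j => c j + th j * (c' j - c j)).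
  by rewrite -big_split/=; apply: eq_bigr => j _; rewrite scalerDl.
have := @increment_le _ _ b l K [set p | exists2 th : J -> R, forall j, 0 <= th j <= 1 &
  p = lincomb b (fun j => c j + th j * (c' j - c j))] f (fun j => c' j - c j) (index_enum J) (lincomb b c)
  (index_enum_uniq _).
rewrite (_ : lincomb b c + _ = lincomb b c'); last first.
  by rewrite -big_split/=; apply: eq_bigr => j _; rewrite -scalerDl addrC subrK.
apply; first by move=> j p [th th01 ->]; exact: h.
by move=> th th01; exists th.
Qed.

(** First and second derivatives along the [b j] are bounded near the origin by continuity. The box
    of coefficients is convex in each coordinate, so increments between two of its points are
    controlled inside it; the Taylor remainder is one such estimate nested in another. *)
Lemma smooth_box (A J : finType) N (b : J -> 'rV[R]_N) (W : set 'rV[R]_N)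
    (f : A -> 'rV[R]_N -> R^o) (eta : R) :
  open W -> W 0 -> (forall a, smooth_on W (f a)) -> 0 < eta ->
  exists r L : R, [/\ 0 < r, 0 <= L,
    forall c : J -> R, (forall j, `|c j| <= r) -> W (lincomb b c) /\
      forall a, `|f a (lincomb b c) - f a 0| <= eta /\ forall j, `|'D_(b j) (f a) (lincomb b c)| <= L &
    forall c c' : J -> R, (forall j, `|c j| <= r) -> (forall j, `|c' j| <= r) ->
    forall a, let d := \sum_j `|c' j - c j| in
      [/\ `|f a (lincomb b c') - f a (lincomb b c)| <= L * d,
      forall j, `|'D_(b j) (f a) (lincomb b c') - 'D_(b j) (f a) (lincomb b c)| <= L * d &
      `|f a (lincomb b c') - f a (lincomb b c) -
        \sum_j (c' j - c j) * 'D_(b j) (f a) (lincomb b c)| <= L * d ^+ 2]].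
Proof.
move=> oW W0 sf eta0.
pose g1 (q : A * J) : 'rV[R]_N -> R^o := 'D_(b q.2) (f q.1).
pose g2 (q : A * J * J) : 'rV[R]_N -> R^o := 'D_(b q.2) (g1 q.1).
pose L : R := 1 + \sum_q `|g1 q 0| + \sum_q `|g2 q 0|.
have L0 : 0 <= L by rewrite !addr_ge0// sumr_ge0.
have bound (T : finType) (g : T -> 'rV[R]_N -> R^o) (M : R) :
    (forall q, {for 0, continuous (g q)}) -> 1 + \sum_q `|g q 0| <= M ->
    \forall p \near (0 : 'rV[R]_N), forall q, `|g q p| <= M.
  move=> cg gM.
  apply: (@filter_forall _ T (fun q => [set p | `|g q p| <= M]) (nbhs (0 : 'rV[R]_N))) => q.
  move/cvgrPdist_le : (cg q) => /(_ 1 ltr01); apply: filterS => p hp.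
  apply: le_trans gM; rewrite (bigD1 q)//=.
  have : 0 <= \sum_(q0 | q0 != q) `|g q0 0| by apply: sumr_ge0.
  have := ler_normB (g q 0 : R) ((g q 0 : R) - g q p); rewrite subKr; move: hp.
  set x := `|g q p|; set y := `|g q 0|; lra.
have : \forall p \near (0 : 'rV[R]_N), [/\ W p, forall a, `|f a p - f a 0| <= eta,
    forall q, `|g1 q p| <= L & forall q, `|g2 q p| <= L].
  near=> p; split; near: p.
  - by apply: open_nbhs_nbhs.
  - apply: filter_forall => a; have [ca _] := sf a 0%N.
    by move/cvgrPdist_le : (ca 0 W0) => /(_ eta eta0); apply: filterS => p; rewrite distrC.
  - apply: bound => [q|]; first by have [_ /(_ (b q.2))[_ [h _]]] := sf q.1 1%N; exact: h.
    by rewrite /L lerDl sumr_ge0.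
  - apply: bound => [q|]; last by rewrite /L -addrA lerD2l lerDr sumr_ge0.
    have [_ /(_ (b q.1.2))[_ [_ /(_ (b q.2))[_ [h _]]]]] := sf q.1.1 2%N; exact: h.
move=> /nbhs_ballP[dl /= dl0 hdl].
have B0 : 0 < \sum_j `|b j| + 1 by rewrite ltr_wpDl// sumr_ge0.
pose r : R := dl / (\sum_j `|b j| + 1); have r0 : 0 < r by rewrite divr_gt0.
have inb (c : J -> R) : (forall j, `|c j| <= r) -> [/\ W (lincomb b c),
    forall a, `|f a (lincomb b c) - f a 0| <= eta,
    forall q, `|g1 q (lincomb b c)| <= L & forall q, `|g2 q (lincomb b c)| <= L].
  move=> hc; apply: hdl; rewrite -ball_normE /ball_/= sub0r normrN.
  apply: (@le_lt_trans _ _ (r * \sum_j `|b j|)).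
    rewrite (le_trans (ler_norm_sum _ _ _))// mulr_sumr; apply: ler_sum => j _.
    by rewrite normrZ ler_wpM2r.
  by rewrite /r mulrAC ltr_pdivrMr// ltr_pM2l// ltrDl.
have sub (c c' th : J -> R) : (forall j, `|c j| <= r) -> (forall j, `|c' j| <= r) ->
    (forall j, 0 <= th j <= 1) -> forall j, `|c j + th j * (c' j - c j)| <= r.
  by move=> hc hc' hth j; exact: norm_convex_le.
exists r, L; split => //.
  by move=> c hc; have [h1 h2 h3 _] := inb c hc; split=> // a; split=> // j; exact: (h3 (a, j)).
move=> c c' hc hc' a /=.
have lip1 (x x' : J -> R) j : (forall j, `|x j| <= r) -> (forall j, `|x' j| <= r) ->
    `|'D_(b j) (f a) (lincomb b x') - 'D_(b j) (f a) (lincomb b x)| <= L * \sum_j `|x' j - x j|.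
  move=> hx hx'; have := @box_increment_le N J b (fun=> 0) L ('D_(b j) (f a)) x x'.
  rewrite big1 ?subr0; last by move=> k _; rewrite mulr0.
  apply=> th hth p k; have [Wp _ _ h4] := inb _ (sub _ _ _ hx hx' hth).
  have [_ /(_ (b j))[_ [_ /(_ (b k))[h _]]]] := sf a 2%N.
  by split; [exact: h|rewrite subr0; exact: (h4 (a, j, k))].
split.
- have := @box_increment_le N J b (fun=> 0) L (f a) c c'.
  rewrite big1 ?subr0; last by move=> k _; rewrite mulr0.
  apply=> th hth p k; have [Wp _ h3 _] := inb _ (sub _ _ _ hc hc' hth).
  have [_ /(_ (b k))[h _]] := sf a 1%N.
  by split; [exact: h|rewrite subr0; exact: (h3 (a, k))].
- by move=> j; exact: lip1.
rewrite expr2 mulrA; apply: box_increment_le => th hth p k.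
have [Wp _ _ _] := inb _ (sub _ _ _ hc hc' hth).
have [_ /(_ (b k))[h _]] := sf a 1%N; split; first exact: h.
apply: (le_trans (lip1 _ _ k hc (sub _ _ _ hc hc' hth))).
apply: ler_wpM2l => //; apply: ler_sum => j _; rewrite addrC addKr normrM.
by have /andP[t0 t1] := hth j; rewrite ger0_norm// ler_piMl.
Unshelve. all: by end_near. Qed.

End c1_calculus.

(** * Lipschitz curves and changes of chart *)

Section curves_in_charts.
Context {R : realType}.

(** [T] gathers the times up to which [p] is Lipschitz. Bounds on adjacent segments glue with the
    larger constant, so Lipschitz control passes through the supremum of [T], which must then be
    [b]. *)
Lemma lipb_local (a b : R) (p : R -> R) : a <= b ->
  (forall t : R, a <= t <= b -> exists K r : R, 0 < r /\ forall s s' : R,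
    a <= s <= b -> a <= s' <= b -> `|t - s| < r -> `|t - s'| < r ->
    `|p s - p s'| <= K * `|s - s'|) -> lipb a b p.
Proof.
move=> ab h.
pose T := [set s : R | a <= s <= b /\ lipb a s p].
have Ta : T a.
  split; first by rewrite lexx.
  exists 0 => s t s1 t1; have -> : s = t by apply/le_anti; lra.
  by rewrite subrr normr0 mul0r.
have glue (x y K : R) : T x -> x <= y -> y <= b ->
    (forall s s' : R, x <= s <= y -> x <= s' <= y -> `|p s - p s'| <= K * `|s - s'|) -> T y.
  move=> [/andP[ax xb] [k hk]] xy yb hK; split; first by rewrite (le_trans ax xy).
  pose m := Num.max k K.
  have km : k <= m by rewrite le_max lexx.
  have Km : K <= m by rewrite le_max lexx orbT.
  have main (s t : R) : a <= s -> s <= t -> t <= y -> `|p s - p t| <= m * (t - s).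
    move=> as_ st ty; have [tx|xt] := leP t x.
      have := hk s t; rewrite (distrC s) (ger0_norm (_ : 0 <= t - s)) ?subr_ge0// => hh.
      apply: (le_trans (hh _ _)); [lra|lra|rewrite ler_wpM2r//; lra].
    have [xs|sx] := leP x s.
      have := hK s t; rewrite (distrC s) (ger0_norm (_ : 0 <= t - s)) ?subr_ge0// => hh.
      apply: (le_trans (hh _ _)); [lra|lra|rewrite ler_wpM2r//; lra].
    have h1 : `|p s - p x| <= m * (x - s).
      have := hk s x; rewrite (distrC s) (ger0_norm (_ : 0 <= x - s)) ?subr_ge0 ?(ltW sx)// => hh.
      apply: (le_trans (hh _ _)); [lra|lra|rewrite ler_wpM2r//; lra].
    have h2 : `|p x - p t| <= m * (t - x).
      have := hK x t; rewrite (distrC x) (ger0_norm (_ : 0 <= t - x)) ?subr_ge0 ?(ltW xt)// => hh.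
      apply: (le_trans (hh _ _)); [lra|lra|rewrite ler_wpM2r//; lra].
    have := ler_distD (p x) (p s) (p t); lra.
  exists m => s t /andP[s1 s2] /andP[t1 t2]; have [st|ts] := leP s t.
    by rewrite (distrC s t) (ger0_norm (_ : 0 <= t - s)) ?subr_ge0//; exact: main.
  rewrite (distrC (p s)) (ger0_norm (_ : 0 <= s - t)) ?subr_ge0 ?(ltW ts)//.
  by apply: main => //; exact: ltW.
have hsT : has_sup T by split; [exists a|exists b => s [/andP[]]].
have Tb s : T s -> s <= sup T by move=> Ts; apply: sup_upper_bound.
have supb : sup T <= b by apply: ge_sup; [exists a|move=> s [/andP[]]].
have sI : a <= sup T <= b by rewrite (Tb _ Ta) supb.
have [K [r [r0 hr]]] := h (sup T) sI.
have [x Tx xr] := sup_adherent r0 hsT.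
have xs := Tb x Tx; have /andP[ax xb] := Tx.1.
pose y := Num.min b (sup T + r / 2).
have y1 : y <= b by rewrite ge_min lexx.
have y2 : y <= sup T + r / 2 by rewrite ge_min lexx orbT.
have sy : sup T <= y by rewrite le_min supb; lra.
have Ty : T y.
  apply: (glue x y K Tx) => //; first by exact: le_trans xs sy.
  move=> s s' /andP[s1 s2] /andP[s1' s2'].
  apply: hr; rewrite ?ltr_norml; lra.
have yE : y = b.
  have [E|/ltW E] := leP b (sup T + r / 2); first by rewrite /y min_l.
  by have := Tb y Ty; rewrite /y min_r//; lra.
by rewrite yE in Ty; exact: Ty.2.
Qed.

End curves_in_charts.

Section charts.
Context {R : realType} {N : nat} {M : topologicalType}.
Implicit Types c : chart R N M.

Lemma chart_invK c p : chart_img c p -> chart_map c (chart_inv c p) = p /\ chart_dom c (chart_inv c p).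
Proof. by move=> [m dm <-]; rewrite chart_mapK. Qed.

Lemma transitionE c c' m : chart_dom c m -> transition c c' (chart_map c m) = chart_map c' m.
Proof. by move=> dm; rewrite /transition /= chart_mapK. Qed.

Lemma overlap_open c c' : open (overlap c c').
Proof.
rewrite openE => _ [m [dm dm'] <-].
have n1 : \forall p \near chart_map c m, chart_img c p.
  by apply: open_nbhs_nbhs; split; [exact: chart_img_open|exists m].
have n2 : \forall p \near chart_map c m, (chart_dom c `&` chart_dom c') (chart_inv c p).
  apply: (chart_inv_continuous dm); rewrite chart_mapK//; apply: open_nbhs_nbhs; split=> //.
  by apply: openI; exact: chart_dom_open.
apply: filterS2 n1 n2 => p ip dp; exists (chart_inv c p) => //.
by have [] := chart_invK ip.
Qed.

End charts.

Section manifold_curves.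
Context {R : realType} {n : nat} {M : topologicalType}.
Context {A : connected_manifold R (n + n + 1) M}.
Implicit Types c : chart R (n + n + 1) M.

Lemma transition_C1 c c' : atlas A c -> atlas A c' -> Ck_on 1 (overlap c c') (transition c c').
Proof. by move=> Ac Ac'; have [h _] := atlas_compatible Ac Ac'; exact: h. Qed.

(** Continuity relative to [[a, b]]: the curve is controlled in some chart around [h t], and the
    inverse of that chart is continuous. *)
Lemma lipschitz_curve_near (a b t : R) (h : R -> M) (O : set M) :
  lipschitz_curve (A := A) a b h -> a <= t <= b -> nbhs (h t) O ->
  \forall s \near t, a <= s <= b -> O (h s).
Proof.
move=> lh tab nO; have [c [B [k [Ac nB dB lB]]]] := lh t tab.
have Bt := nbhs_singleton nB; have dt := dB t Bt tab.
have := chart_inv_continuous dt; rewrite /prop_for /continuous_at chart_mapK// => /(_ O nO).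
move=> /nbhs_ballP[r /= r0 hr].
have k0 : 0 < `|k| + 1 by rewrite ltr_wpDl.
have rk : 0 < r / (`|k| + 1) by rewrite divr_gt0.
near=> s => sab.
have Bs : B s by near: s.
have ds := dB s Bs sab.
rewrite -(chart_mapK ds); apply: hr; rewrite -ball_normE /ball_/=.
apply: (le_lt_trans (lB t s Bt Bs tab sab)).
have : `|t - s| < r / (`|k| + 1).
  by near: s; apply/nbhs_ballP; exists (r / (`|k| + 1)) => //= y; rewrite -ball_normE.
rewrite ltr_pdivlMr// => h1.
have h2 : k * `|t - s| <= `|k| * `|t - s| by rewrite ler_wpM2r// ler_norm.
have := normr_ge0 (t - s); move: h1 h2; set u := `|t - s|; lra.
Unshelve. all: by end_near. Qed.

Lemma lipschitz_curve_sub (a b s : R) (h : R -> M) : s <= b ->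
  lipschitz_curve (A := A) a b h -> lipschitz_curve (A := A) a s h.
Proof.
move=> sb lh t /andP[t1 t2]; have sub x : a <= x <= s -> a <= x <= b by move=> /andP[-> /le_trans->].
have [|c [B [k [Ac nB h3 h4]]]] := lh t; first by apply: sub; rewrite t1.
exists c, B, k; split=> // [x Bx /sub|x x' Bx Bx' /sub h5 /sub]; first exact: h3.
exact: h4.
Qed.

(** The definition bounds the curve in charts that vary with time. Changes of chart are [C^1], hence
    locally Lipschitz, and local bounds on a compact segment yield a global one. *)
Lemma lipschitz_curve_chart (a b : R) (h : R -> M) c i : a <= b ->
  lipschitz_curve (A := A) a b h -> atlas A c ->
  (forall t, a <= t <= b -> chart_dom c (h t)) -> lipb a b (fun t => chart_map c (h t) 0 i).
Proof.
move=> ab lh Ac dh; apply: lipb_local => // t tab.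
have [c' [B [k [Ac' nB dB lB]]]] := lh t tab.
have Bt := nbhs_singleton nB; have dt' := dB t Bt tab; have dt := dh t tab.
have Wt : overlap c' c (chart_map c' (h t)) by exists (h t).
have cT := C1_coord i (@overlap_open _ _ _ c' c) (transition_C1 Ac' Ac).
have [K [r [K0 r0 hK]]] := C1_lipschitz_near (@overlap_open _ _ _ c' c) cT Wt.
have n1 : \forall s \near t, a <= s <= b -> `|chart_map c' (h t) - chart_map c' (h s)| < r.
  apply: (@lipschitz_curve_near a b t h [set m | `|chart_map c' (h t) - chart_map c' m| < r] lh tab).
  have := chart_map_continuous dt' => /(_ (ball (chart_map c' (h t)) r)).
  by rewrite -ball_normE; apply; rewrite ball_normE; exact: nbhsx_ballx.
have : \forall s \near t, (a <= s <= b -> `|chart_map c' (h t) - chart_map c' (h s)| < r) /\ B s.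
  by near=> s; split; near: s.
move=> /nbhs_ballP[dl /= dl0 hdl].
exists (K * k), dl; split=> // s s' sab sab' ts ts'.
have [r1 Bs] : (a <= s <= b -> `|chart_map c' (h t) - chart_map c' (h s)| < r) /\ B s.
  by apply: hdl; rewrite -ball_normE.
have [r2 Bs'] : (a <= s' <= b -> `|chart_map c' (h t) - chart_map c' (h s')| < r) /\ B s'.
  by apply: hdl; rewrite -ball_normE.
have := hK _ _ (r2 sab') (r1 sab).
rewrite !transitionE; [|exact: dB..] => h1; apply: (le_trans h1).
by rewrite -mulrA ler_wpM2l//; exact: lB.
Unshelve. all: by end_near. Qed.

Lemma velocity_transition (h : R -> M) c c' (t : R) : atlas A c -> atlas A c' ->
  (\forall s \near t, chart_dom c (h s)) -> chart_dom c' (h t) ->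
  derivable (chart_map c \o h : R -> 'rV[R]_(n + n + 1)) t (1 : R) ->
  is_derive t (1 : R) (chart_map c' \o h : R -> 'rV[R]_(n + n + 1))
    ('D_(velocity c h t) (transition c c') (chart_map c (h t))).
Proof.
move=> Ac Ac' dh dt' dc.
have Wt : overlap c c' (chart_map c (h t)) by exists (h t) => //; split=> //; exact: nbhs_singleton dh.
have := C1_chain_rV (@overlap_open _ _ _ c c') (transition_C1 Ac Ac') (Wt : overlap c c' ((chart_map c \o h) t)) dc.
apply: near_eq_is_derive; apply: filterS dh => s ds /=.
by rewrite transitionE.
Qed.

(** [sqspeed] is read in the chart selected at [h t]; the transformation laws of velocity and metric
    bring it to a chart of the atlas in which computations are made. *)
Lemma sqspeed_chart (S : contact_subriemannian A) (h : R -> M) c (t : R) : atlas A c ->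
  (\forall s \near t, chart_dom c (h s)) ->
  derivable (chart_map c \o h : R -> 'rV[R]_(n + n + 1)) t (1 : R) ->
  dist S c (chart_map c (h t)) (velocity c h t) ->
  sqspeed S h t = metric S c (chart_map c (h t)) (velocity c h t) (velocity c h t).
Proof.
move=> Ac dh dc dd; have dt := nbhs_singleton dh.
set c' := chart_at A (h t); have Ac' : atlas A c' := chart_at_atlas A _.
have dt' : chart_dom c' (h t) := chart_at_dom A _.
have Wt : overlap c c' (chart_map c (h t)) by exists (h t).
have /(@derive_val _ _ _ _ _ _ _) dv := velocity_transition Ac Ac' dh dt' dc.
by rewrite (metric_transition Ac Ac' Wt dd dd) transitionE// -dv.
Qed.

End manifold_curves.

Section affine_smooth.
Context {R : realType} {V W : normedModType R}.

Lemma smooth_cst (U : set V) (w : W) : smooth_on U (fun=> w).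
Proof.
move=> k; elim: k w => [|k IH] w /=; first by split=> // x _; exact: cst_continuous.
split=> [x _|v]; first exact: cst_continuous.
split=> [x _|]; first exact: derivable_cst.
have -> : 'D_v (fun=> w) = (fun=> 0) :> (V -> W) by apply/funext => x; rewrite derive_cst.
exact: IH.
Qed.

Lemma smooth_affine (U : set V) (f L : V -> W) :
  (forall (h : R) (p v : V), f (h *: v + p) - f p = h *: L v) -> continuous f -> smooth_on U f.
Proof.
move=> fL cf.
have d p v : is_derive p v f (L v).
  have cvL : (fun h : R => h^-1 *: ((f \o shift p) (h *: v) - f p)) @ 0^' --> L v.
    apply: cvg_near_cst; near=> h; rewrite /= fL scalerA mulVf ?scale1r//.
    by near: h; exact: nbhs_dnbhs_neq.
  by apply: DeriveDef; [apply/cvg_ex; exists (L v)|apply/cvg_lim].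
case=> [|k]; first by split=> // x _; exact: cf.
split=> [x _|v]; first exact: cf.
split=> [x _|]; first exact: (@ex_derive _ _ _ _ _ _ _ (d x v)).
have -> : 'D_v f = (fun=> L v) :> (V -> W).
  by apply/funext => x; exact: (@derive_val _ _ _ _ _ _ _ (d x v)).
exact: smooth_cst.
Unshelve. all: by end_near. Qed.

End affine_smooth.

(** * Darboux coordinates and horizontal lifts *)

Section darboux_coordinates.
Context {R : realType} {n : nat}.
Local Notation N := (n + n + 1)%N.
Local Notation J := (Jmx R n).

Definition vecxz (x : 'rV[R]_(n + n)) (z : R) : 'rV[R]_N := row_mx x (z%:M : 'M[R]_1).

Lemma xcoord_vecxz x z : xcoord (vecxz x z) = x.
Proof. by rewrite /xcoord row_mxKl. Qed.

Lemma zcoord_vecxz x z : zcoord (vecxz x z) = z.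
Proof. by rewrite /zcoord row_mxKr mxE eqxx mulr1n. Qed.

Lemma vecxz_coords p : vecxz (xcoord p) (zcoord p) = p.
Proof. by rewrite /vecxz /zcoord -mx11_scalar hsubmxK. Qed.

Lemma vecxzD x x' z z' : vecxz x z + vecxz x' z' = vecxz (x + x') (z + z').
Proof. by rewrite add_row_mx -raddfD. Qed.

Lemma vecxzZ k x z : k *: vecxz x z = vecxz (k *: x) (k * z).
Proof. by rewrite scale_row_mx scale_scalar_mx. Qed.

Lemma vecxz_sum (I : finType) (x : I -> 'rV[R]_(n + n)) (z : I -> R) :
  \sum_i vecxz (x i) (z i) = vecxz (\sum_i x i) (\sum_i z i).
Proof.
elim/big_rec3: _ => [|i y1 y2 y3 _ ->]; last by rewrite vecxzD.
by rewrite /vecxz raddf0 row_mx0.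
Qed.

Lemma xcoordD p p' : xcoord (p + p') = xcoord p + xcoord p' :> 'rV[R]_(n + n).
Proof. by rewrite /xcoord linearD. Qed.
Lemma xcoordZ k p : xcoord (k *: p) = k *: xcoord p :> 'rV[R]_(n + n).
Proof. by rewrite /xcoord linearZ. Qed.
Lemma xcoord0 : xcoord 0 = 0 :> 'rV[R]_(n + n).
Proof. by rewrite /xcoord linear0. Qed.
Lemma zcoordD (p p' : 'rV[R]_N) : zcoord (p + p') = zcoord p + zcoord p'.
Proof. by rewrite /zcoord linearD mxE. Qed.
Lemma zcoordZ k (p : 'rV[R]_N) : zcoord (k *: p) = k * zcoord p.
Proof. by rewrite /zcoord linearZ mxE. Qed.

(* Horizontal lift: the vector of the contact distribution at [p] projecting to [x]. *)
Definition hlift (p : 'rV[R]_N) (x : 'rV[R]_(n + n)) : 'rV[R]_N :=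
  vecxz x (2^-1 * mform J (xcoord p) x).

Lemma hliftD p x y : hlift p (x + y) = hlift p x + hlift p y.
Proof. by rewrite /hlift vecxzD mformDr mulrDr. Qed.

Lemma hliftZ p k x : hlift p (k *: x) = k *: hlift p x.
Proof. by rewrite /hlift vecxzZ mformZr mulrCA. Qed.

Lemma xcoord_hlift p x : xcoord (hlift p x) = x.
Proof. exact: xcoord_vecxz. Qed.

Lemma darboux_hlift p v : darboux_form p v = 0 <-> v = hlift p (xcoord v).
Proof.
have E : darboux_form p v = - zcoord v + 2^-1 * mform J (xcoord p) (xcoord v) by [].
rewrite E; split=> [/eqP|->].
  rewrite addrC subr_eq0 => /eqP h; rewrite /hlift h; exact/esym/vecxz_coords.
by rewrite xcoord_hlift /hlift zcoord_vecxz addNr.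
Qed.

Lemma xcoord_continuous i : continuous (fun p : 'rV[R]_N => xcoord p 0 i).
Proof.
rewrite (_ : (fun p => _) = fun p : 'rV[R]_N => p 0 (lshift 1 i)); first exact: coord_continuous.
by apply/funext => p; rewrite /xcoord mxE.
Qed.

Lemma zcoord_continuous : continuous (@zcoord R n).
Proof.
rewrite (_ : @zcoord R n = fun p : 'rV[R]_N => p 0 (rshift (n + n) 0)); first exact: coord_continuous.
by apply/funext => p; rewrite /zcoord mxE.
Qed.

Lemma mform_xcoord_continuous (g : 'M[R]_(n + n)) x :
  continuous (fun p : 'rV[R]_N => mform g (xcoord p) x).
Proof.
apply: continuous_bigsum => i; apply: continuous_bigsum => j p.
apply: (@continuousM R _ (fun p : 'rV[R]_N => g i j * xcoord p 0 i) (cst (x 0 j))); last exact: cst_continuous.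
apply: (@continuousM R _ (cst (g i j)) (fun p : 'rV[R]_N => xcoord p 0 i)); first exact: cst_continuous.
exact: xcoord_continuous.
Qed.

Lemma hlift_smooth (U : set 'rV[R]_N) x : smooth_on U (fun p => hlift p x).
Proof.
have E p : hlift p x = vecxz x 0 + (2^-1 * mform J (xcoord p) x) *: vecxz 0 1.
  by rewrite vecxzZ vecxzD scaler0 mulr1 addr0 add0r.
apply: (@smooth_affine R 'rV[R]_N 'rV[R]_N U _ (fun v => (2^-1 * mform J (xcoord v) x) *: vecxz 0 1)).
  move=> h p v; rewrite !E opprD addrACA subrr add0r -scalerBl scalerA xcoordD xcoordZ.
  by rewrite mformDl mformZl; congr (_ *: _); ring.
rewrite (_ : (fun p => _) = fun p => vecxz x 0 + (2^-1 * mform J (xcoord p) x) *: vecxz 0 1); last first.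
  by apply/funext => p; exact: E.
move=> p; apply: (@continuousD R 'rV[R]_N _ (cst (vecxz x 0))
  (fun p : 'rV[R]_N => (2^-1 * mform J (xcoord p) x) *: vecxz 0 1)); first exact: cst_continuous.
apply: (@continuousZr_tmp R 'rV[R]_N _ (fun p : 'rV[R]_N => 2^-1 * mform J (xcoord p) x)).
apply: (@continuousM R _ (cst 2^-1) (fun p : 'rV[R]_N => mform J (xcoord p) x)); first exact: cst_continuous.
exact: mform_xcoord_continuous.
Qed.

Lemma Jmx_asym : J^T = - J.
Proof. by rewrite /Jmx tr_block_mx opp_block_mx !trmx0 !oppr0 opprK linearN/= trmx1. Qed.

Lemma Jmx_unit : J \in unitmx.
Proof.
apply: (@proj1 _ ((- J) \in unitmx)); apply: (@mulmx1_unit _ _ J (- J)).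
rewrite mulmxN /Jmx mulmx_block !mul0mx !mulmx0 !mulmx1 mulmxN mulmx1 !add0r !addr0 opp_block_mx.
by rewrite !opprK oppr0 -scalar_mx_block.
Qed.

End darboux_coordinates.

(** * Geodesics in the frame *)

Section metric_in_frame.
Context {R : realType} {n : nat} {M : topologicalType}.
Local Notation N := (n + n + 1)%N.
Context {A : connected_manifold R N M} (S : contact_subriemannian A) (q : M) (c : chart R N M).
Hypothesis cD : darboux_chart S q c.

Let Ac : atlas A c. Proof. by case: cD. Qed.

Lemma darboux_img0 : chart_img c 0.
Proof. by case: cD => _ dq q0 _; exists q. Qed.

Lemma dist_hlift p v : chart_img c p -> dist S c p v <-> v = hlift p (xcoord v).
Proof. by case: cD => _ _ _ h ip; rewrite h//; exact: darboux_hlift. Qed.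

Lemma hlift_dist p x : chart_img c p -> dist S c p (hlift p x).
Proof. by move=> ip; apply/dist_hlift => //; rewrite xcoord_hlift. Qed.

(** The metric on the distribution at [p], carried to row vectors of length [n + n] by the
    horizontal lift. The fibre no longer depends on [p], which makes coefficients at different
    points comparable. *)
Definition hmetric p x y : R := metric S c p (hlift p x) (hlift p y).

Lemma hmetric_linear p k x y w : chart_img c p ->
  hmetric p (k *: x + y) w = k * hmetric p x w + hmetric p y w.
Proof.
by move=> ip; rewrite /hmetric hliftD hliftZ metric_linear//; exact: hlift_dist.
Qed.

Lemma hmetric_sym p x y : chart_img c p -> hmetric p x y = hmetric p y x.
Proof. by move=> ip; rewrite /hmetric Defs.metric_sym//; exact: hlift_dist. Qed.

Lemma hmetric_suml p (I : finType) (u : I -> R) (e : I -> 'rV[R]_(n + n)) w : chart_img c p ->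
  hmetric p (\sum_i u i *: e i) w = \sum_i u i * hmetric p (e i) w.
Proof.
move=> ip; have h0 : hmetric p 0 w = 0.
  have := hmetric_linear 1 0 0 w ip; rewrite scale1r addr0 mul1r.
  by move/eqP; rewrite -subr_eq0 opprD addNKr oppr_eq0 => /eqP.
by elim/big_rec2: _ => // i y1 y2 _ <-; rewrite hmetric_linear.
Qed.

Lemma hmetric_bil p (I : finType) (u w : I -> R) (e : I -> 'rV[R]_(n + n)) : chart_img c p ->
  hmetric p (\sum_i u i *: e i) (\sum_i w i *: e i) = bil (fun i j => hmetric p (e i) (e j)) u w.
Proof.
move=> ip; rewrite hmetric_suml//; apply: eq_bigr => i _.
rewrite hmetric_sym// hmetric_suml// mulr_sumr; apply: eq_bigr => j _.
by rewrite hmetric_sym//; ring.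
Qed.

Lemma hmetric_gt0 p x : chart_img c p -> x != 0 -> 0 < hmetric p x x.
Proof.
move=> ip x0; apply: metric_pos => //; first exact: hlift_dist.
by apply: contra_neq x0 => h; rewrite -(xcoord_hlift p x) h xcoord0.
Qed.

Lemma hmetric_smooth x y : smooth_on (chart_img c) (fun p => hmetric p x y : R^o).
Proof.
apply: metric_smooth => //; [exact: chart_img_open|exact: hlift_smooth|exact: hlift_smooth|].
by move=> p ip; split; exact: hlift_dist.
Qed.

Definition metric0 : 'M[R]_(n + n) := \matrix_(i, j) hmetric 0 'e_i 'e_j.

Lemma mform_metric0 x y : mform metric0 x y = hmetric 0 x y.
Proof.
rewrite [x in RHS]row_sum_delta [y in RHS]row_sum_delta (hmetric_bil _ _ _ darboux_img0).
by apply: eq_bigr => i _; apply: eq_bigr => j _; rewrite mxE.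
Qed.

Lemma darboux_frame : exists (d : nat) (e : 'I_d * bool -> 'rV[R]_(n + n)) (beta : 'I_d -> R),
  [/\ forall j, 0 < beta j, forall i k, mform metric0 (e i) (e k) = (i == k)%:R,
      forall i k, mform (Jmx R n) (e i) (e k) = planeW beta i k
    & forall x, x = \sum_i mform metric0 x (e i) *: e i].
Proof.
apply: symplectic_frame; last exact: Jmx_unit; last exact: Jmx_asym.
  by apply/matrixP => i j; rewrite !mxE hmetric_sym//; exact: darboux_img0.
by move=> x x0; rewrite mform_metric0; apply: hmetric_gt0 => //; exact: darboux_img0.
Qed.

Context {d : nat} (e : 'I_d * bool -> 'rV[R]_(n + n)) (beta : 'I_d -> R).
Hypothesis d0 : (0 < d)%N.
Hypothesis eon : forall i k, mform metric0 (e i) (e k) = (i == k)%:R.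
Hypothesis eW : forall i k, mform (Jmx R n) (e i) (e k) = planeW beta i k.
Hypothesis espan : forall x, x = \sum_i mform metric0 x (e i) *: e i.
Local Notation I := ('I_d * bool)%type.

(** The frame is orthonormal at the origin only, but the horizontal constraint takes its normal form
    in it at every point, because the Darboux form has the constant matrix [J]. *)
Definition emb (y : I -> R) (z : R) : 'rV[R]_N := vecxz (\sum_i y i *: e i) z.
Definition ycoord (p : 'rV[R]_N) (i : I) : R := mform metric0 (xcoord p) (e i).

Lemma emb_coord p : emb (ycoord p) (zcoord p) = p.
Proof. by rewrite /emb -espan vecxz_coords. Qed.

Lemma ycoord_emb y z i : ycoord (emb y z) i = y i.
Proof.
rewrite /ycoord /emb xcoord_vecxz mform_suml (bigD1 i)//= mformZl eon eqxx mulr1.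
by rewrite big1 ?addr0// => k ki; rewrite mformZl eon (negbTE ki) mulr0.
Qed.

Lemma zcoord_emb y z : zcoord (emb y z) = z. Proof. exact: zcoord_vecxz. Qed.

(** One index type for the horizontal coordinates and the height, so that [smooth_box] treats them
    together. *)
Definition basxz (k : I + unit) : 'rV[R]_N :=
  match k with inl i => vecxz (e i) 0 | inr _ => vecxz 0 1 end.
Definition coefxz (y : I -> R) (z : R) (k : I + unit) : R :=
  match k with inl i => y i | inr _ => z end.

Lemma sum_coefxz (F : I + unit -> R) : \sum_k F k = \sum_i F (inl i) + F (inr tt).
Proof. by rewrite big_sumType/= (big_pred1 tt)//; case. Qed.

Lemma lincomb_coefxz y z : lincomb basxz (coefxz y z) = emb y z.
Proof.
rewrite /lincomb big_sumType/= (big_pred1 tt)/=; last by case.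
under eq_bigr do rewrite vecxzZ mulr0.
by rewrite vecxz_sum vecxzZ vecxzD scaler0 mulr1 addr0 big1_eq add0r.
Qed.

Definition Gf (i j : I) (y : I -> R) (z : R) : R := hmetric (emb y z) (e i) (e j).
Definition Df (i j k : I) (y : I -> R) (z : R) : R :=
  'D_(basxz (inl k)) (fun p => hmetric p (e i) (e j) : R^o) (emb y z).
Definition Dzf (i j : I) (y : I -> R) (z : R) : R :=
  'D_(basxz (inr tt)) (fun p => hmetric p (e i) (e j) : R^o) (emb y z).

Lemma emb0 : emb (fun=> 0) 0 = 0.
Proof.
rewrite /emb big1; last by move=> i _; rewrite scale0r.
by rewrite -[RHS]vecxz_coords xcoord0 /zcoord linear0 mxE.
Qed.

Lemma Gf0 i j : Gf i j (fun=> 0) 0 = (i == j)%:R.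
Proof. by rewrite /Gf emb0 -mform_metric0 eon. Qed.

(** All that is used of the smoothness of the metric is extracted here. [regular_metric] serves the
    calibration; the last clause, with the Lipschitz derivatives, serves the fixed point
    argument. *)
Lemma metric_box : exists rho L : R, [/\ 0 < rho, 0 <= L, regular_metric Gf Df Dzf rho L,
  forall y z, inbox rho y z -> chart_img c (emb y z) &
  forall i j y z y' z', inbox rho y z -> inbox rho y' z' ->
    (forall k, `|Df i j k y' z' - Df i j k y z| <= L * dist1 y y' z z') /\
    `|Dzf i j y' z' - Dzf i j y z| <= L * dist1 y y' z z'].
Proof.
have I0 : (0 : R) < (2 * #|{: I}|%:R)^-1.
  by rewrite invr_gt0 mulr_gt0// ltr0n card_prod card_ord card_bool muln_gt0 d0.
have [r [L [r0 L0 h1 h2]]] := @smooth_box R (I * I)%type (I + unit)%type N basxz (chart_img c)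
  (fun ij p => hmetric p (e ij.1) (e ij.2)) _ (chart_img_open (c := c)) darboux_img0
  (fun ij => hmetric_smooth _ _) I0.
have inb y z : inbox r y z -> forall k, `|coefxz y z k| <= r by move=> [hy hz] [i|?] /=.
have dE y z y' z' : \sum_k `|coefxz y' z' k - coefxz y z k| = dist1 y y' z z' by rewrite sum_coefxz.
exists r, L; split=> //.
- move=> i j; split.
  + move=> y z /inb/h1[_ /(_ (i, j))[+ _]].
    by rewrite lincomb_coefxz/= -mform_metric0 eon; exact.
  + by move=> y z /inb/h1[ip _]; rewrite lincomb_coefxz in ip; exact: hmetric_sym.
  + move=> y z y' z' /inb b1 /inb b2; have [+ _ _] := h2 _ _ b1 b2 (i, j).
    by rewrite dE !lincomb_coefxz.
  + move=> y z y' z' /inb b1 /inb b2; have [_ _ +] := h2 _ _ b1 b2 (i, j).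
    rewrite dE !lincomb_coefxz sum_coefxz/=; congr (`|_ - _| <= _).
    by congr (_ + _); [apply: eq_bigr => k _|]; rewrite mulrC.
  + move=> y z /inb/h1[_ /(_ (i, j))[_ +]]; rewrite lincomb_coefxz => h.
    by split=> [k|]; [exact: (h (inl k))|exact: (h (inr tt))].
- by move=> y z /inb/h1[+ _]; rewrite lincomb_coefxz.
move=> i j y z y' z' /inb b1 /inb b2; have [_ + _] := h2 _ _ b1 b2 (i, j).
rewrite dE !lincomb_coefxz => h.
by split=> [k|]; [exact: (h (inl k))|exact: (h (inr tt))].
Qed.

End metric_in_frame.

Section curves_in_frame.
Context {R : realType} {n : nat} {M : topologicalType}.
Local Notation N := (n + n + 1)%N.
Context {A : connected_manifold R N M} (S : contact_subriemannian A) (q : M) (c : chart R N M).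
Hypothesis cD : darboux_chart S q c.
Context {d : nat} (e : 'I_d * bool -> 'rV[R]_(n + n)) (beta : 'I_d -> R).
Hypothesis eon : forall i k, mform (metric0 S c) (e i) (e k) = (i == k)%:R.
Hypothesis eW : forall i k, mform (Jmx R n) (e i) (e k) = planeW beta i k.
Hypothesis espan : forall x, x = \sum_i mform (metric0 S c) x (e i) *: e i.
Local Notation I := ('I_d * bool)%type.
Local Notation embe := (emb e).
Local Notation yco := (ycoord S c e).
Local Notation Gfe := (Gf S c e).

Let Ac : atlas A c. Proof. by case: cD. Qed.

(** Writing frame coordinates as combinations of entries lets derivatives and Lipschitz bounds pass
    from the chart to the frame. *)
Lemma ycoord_sum p i : yco p i = \sum_a yco 'e_a i * p 0 a.
Proof.
have yD p1 p2 : yco (p1 + p2) i = yco p1 i + yco p2 i by rewrite /ycoord xcoordD mformDl.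
have y0 : yco 0 i = 0 by rewrite /ycoord xcoord0 mform0l.
rewrite {1}[p]row_sum_delta (big_morph (yco ^~ i) yD y0); apply: eq_bigr => a _.
by rewrite /ycoord xcoordZ mformZl mulrC.
Qed.

Lemma zcoord_sum (p : 'rV[R]_N) : zcoord p = \sum_a zcoord ('e_a : 'rV[R]_N) * p 0 a.
Proof.
have z0 : zcoord (0 : 'rV[R]_N) = 0 by rewrite /zcoord linear0 mxE.
rewrite {1}[p]row_sum_delta (big_morph (@zcoord R n) (@zcoordD R n) z0); apply: eq_bigr => a _.
by rewrite zcoordZ mulrC.
Qed.

Lemma emb_entry y z a : embe y z 0 a = \sum_i (vecxz (e i) 0 : 'rV[R]_N) 0 a * y i + (vecxz 0 1 : 'rV[R]_N) 0 a * z.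
Proof.
have -> : embe y z = \sum_i y i *: vecxz (e i) 0 + z *: vecxz 0 1.
  by under eq_bigr do rewrite vecxzZ mulr0; rewrite vecxz_sum vecxzZ vecxzD scaler0 mulr1 addr0 big1_eq add0r.
rewrite !mxE summxE; congr (_ + _); last by rewrite mulrC.
by apply: eq_bigr => i _; rewrite mxE mulrC.
Qed.

Lemma is_derive_linear (w : 'I_N -> R) (g : R -> 'rV[R]_N) (t : R) : derivable g t (1 : R) ->
  is_derive t (1 : R) (fun s : R => \sum_a w a * g s 0 a) (\sum_a w a * ('D_1 g t) 0 a).
Proof.
move=> dg; apply: is_derive_bigsum => a.
have da : is_derive t (1 : R) (fun s : R => g s 0 a) (('D_1 g t) 0 a).
  have /derivable_mxP/(_ 0 a) h := dg; apply: DeriveDef => //.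
  by rewrite (derive_mx dg) mxE.
exact: (is_deriveZ (w a) da).
Qed.

Lemma ycoord_derive (g : R -> 'rV[R]_N) (t : R) i : derivable g t (1 : R) ->
  is_derive t (1 : R) (fun s : R => yco (g s) i) (yco ('D_1 g t) i).
Proof.
move=> dg; rewrite ycoord_sum (_ : (fun s : R => _) = fun s : R => \sum_a yco 'e_a i * g s 0 a).
  exact: is_derive_linear.
by apply/funext => s; exact: ycoord_sum.
Qed.

Lemma zcoord_derive (g : R -> 'rV[R]_N) (t : R) : derivable g t (1 : R) ->
  is_derive t (1 : R) (fun s : R => zcoord (g s)) (zcoord ('D_1 g t)).
Proof.
move=> dg; rewrite zcoord_sum (_ : (fun s : R => _) = fun s : R => \sum_a zcoord ('e_a : 'rV[R]_N) * g s 0 a).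
  exact: is_derive_linear.
by apply/funext => s; exact: zcoord_sum.
Qed.

Lemma emb_derive (y : R -> I -> R) (z : R -> R) (u : I -> R) (w t : R) :
  (forall i, is_derive t (1 : R) (fun s : R => y s i) (u i)) -> is_derive t (1 : R) z w ->
  is_derive t (1 : R) (fun s : R => embe (y s) (z s)) (embe u w).
Proof.
move=> dy dz.
have da (a : 'I_N) : is_derive t (1 : R) (fun s : R => embe (y s) (z s) 0 a) (embe u w 0 a).
  rewrite emb_entry (_ : (fun s : R => _) = fun s : R =>
    \sum_i (vecxz (e i) 0 : 'rV[R]_N) 0 a * y s i + (vecxz 0 1 : 'rV[R]_N) 0 a * z s); last first.
    by apply/funext => s; exact: emb_entry.
  apply: (@is_deriveD R _ _ (fun s : R => \sum_i (vecxz (e i) 0 : 'rV[R]_N) 0 a * y s i)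
    (fun s : R => (vecxz 0 1 : 'rV[R]_N) 0 a * z s)).
    by apply: is_derive_bigsum => i; exact: (is_deriveZ _ (dy i)).
have df : derivable (fun s : R => embe (y s) (z s)) t (1 : R).
  by apply/derivable_mxP => i a; rewrite (ord1 i); exact: (@ex_derive _ _ _ _ _ _ _ (da a)).
apply: DeriveDef => //; rewrite (derive_mx df); apply/matrixP => i a; rewrite mxE (ord1 i).
exact: (@derive_val _ _ _ _ _ _ _ (da a)).
Qed.

Lemma mform_J_frame (y u : I -> R) :
  mform (Jmx R n) (\sum_i y i *: e i) (\sum_i u i *: e i) = bil (planeW beta) y u.
Proof.
rewrite mform_suml; apply: eq_bigr => i _; rewrite mformZl.
have mr : mform (Jmx R n) (e i) (\sum_j u j *: e j) = \sum_j mform (Jmx R n) (e i) (u j *: e j).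
  apply: (big_morph (mform (Jmx R n) (e i)) (fun a b => mformDr _ _ a b)).
  by rewrite -(scale0r (0 : 'rV[R]_(n + n))) mformZr mul0r.
rewrite mr mulr_sumr; apply: eq_bigr => j _; rewrite mformZr eW; ring.
Qed.

Lemma hlift_emb (y u : I -> R) (z : R) :
  hlift (embe y z) (\sum_i u i *: e i) = embe u (2^-1 * bil (planeW beta) y u).
Proof. by rewrite /hlift /emb xcoord_vecxz mform_J_frame. Qed.

Lemma horizontal_velocity p v : chart_img c p -> dist S c p v ->
  zcoord v = 2^-1 * bil (planeW beta) (yco p) (yco v) /\
  metric S c p v v = bil (fun i j => Gfe i j (yco p) (zcoord p)) (yco v) (yco v).
Proof.
move=> ip /(dist_hlift cD _ ip) vE.
have pE := emb_coord espan p; have xE : xcoord v = \sum_i yco v i *: e i by exact: espan.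
split.
  by rewrite {1}vE xE -{1}pE hlift_emb zcoord_emb.
rewrite {1 2}vE xE -[LHS]/(hmetric S c p _ _) (hmetric_bil cD _ _ _ ip).
by rewrite /Gf pE.
Qed.

Lemma horizontal_dist (y u : I -> R) (z : R) : chart_img c (embe y z) ->
  dist S c (embe y z) (embe u (2^-1 * bil (planeW beta) y u)).
Proof. by move=> ip; rewrite -(hlift_emb y u z); exact: (hlift_dist cD). Qed.

Lemma curve_frame_derivatives (h : R -> M) (t : R) :
  (\forall s \near t, chart_dom c (h s)) ->
  derivable (chart_map c \o h : R -> 'rV[R]_N) t (1 : R) ->
  dist S c (chart_map c (h t)) (velocity c h t) ->
  let yh s := yco (chart_map c (h s)) in let zh s := zcoord (chart_map c (h s)) in
  exists uh : I -> R, [/\ forall i, is_derive t (1 : R) (fun s : R => yh s i) (uh i),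
    is_derive t (1 : R) zh (2^-1 * bil (planeW beta) (yh t) uh) &
    sqspeed S h t = bil (fun i j => Gfe i j (yh t) (zh t)) uh uh].
Proof.
move=> dh dc dd yh zh; have dt := nbhs_singleton dh.
have ip : chart_img c (chart_map c (h t)) by exists (h t).
have [zE mE] := horizontal_velocity ip dd.
exists (yco (velocity c h t)); split.
- by move=> i; exact: (ycoord_derive i dc).
- by rewrite -zE; exact: (zcoord_derive dc).
by rewrite (sqspeed_chart Ac dh dc dd) mE.
Qed.

Lemma ycoord_continuous i : continuous (yco ^~ i).
Proof. exact: mform_xcoord_continuous. Qed.

Lemma sqspeed_ge0 (h : R -> M) (t : R) :
  (forall c', atlas A c' -> chart_dom c' (h t) -> dist S c' (chart_map c' (h t)) (velocity c' h t)) ->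
  0 <= sqspeed S h t.
Proof.
move=> hd; rewrite /sqspeed; set c' := chart_at A (h t).
have Ac' : atlas A c' := chart_at_atlas A _.
have dt : chart_dom c' (h t) := chart_at_dom A _.
have ip : chart_img c' (chart_map c' (h t)) by exists (h t).
have := hd c' Ac' dt; move: (velocity c' h t) => v dv.
have [v0|v0] := eqVneq v 0; last by apply: ltW; exact: metric_pos.
rewrite v0 in dv *.
have := metric_linear 1 Ac' ip dv dv dv; rewrite scale1r addr0 mul1r.
by move/eqP; rewrite -subr_eq0 opprD addNKr oppr_eq0 => /eqP ->.
Qed.

End curves_in_frame.

(** * Leaving a coordinate box *)

Section frame_geodesics.
Context {R : realType} {n : nat} {M : topologicalType}.
Local Notation N := (n + n + 1)%N.
Context {A : connected_manifold R N M} (S : contact_subriemannian A) (q : M) (c : chart R N M).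
Hypothesis cD : darboux_chart S q c.
Context {d : nat} (e : 'I_d * bool -> 'rV[R]_(n + n)) (beta : 'I_d -> R).
Hypothesis eon : forall i k, mform (metric0 S c) (e i) (e k) = (i == k)%:R.
Hypothesis eW : forall i k, mform (Jmx R n) (e i) (e k) = planeW beta i k.
Hypothesis espan : forall x, x = \sum_i mform (metric0 S c) x (e i) *: e i.
Local Notation I := ('I_d * bool)%type.
Local Notation yco := (ycoord S c e).
Local Notation mu := (@lebesgue_measure R).

Let Ac : atlas A c. Proof. by case: cD. Qed.

Variables (rho L : R).
Hypothesis (rho0 : 0 < rho) (L0 : 0 <= L).
Hypothesis regG : regular_metric (Gf S c e) (Df S c e) (Dzf S c e) rho L.
Hypothesis boxI : forall y z, inbox rho y z -> chart_img c (emb e y z).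

Definition frame_box : set M :=
  [set m | chart_dom c m /\ inbox rho (yco (chart_map c m)) (zcoord (chart_map c m))].

Let coord_box : set 'rV[R]_N := [set p | inbox rho (yco p) (zcoord p)].

Let coord_box_img p : coord_box p -> chart_img c p.
Proof. by move=> /boxI; rewrite emb_coord. Qed.

Let coord_box_closed : closed coord_box.
Proof.
have cl (f : 'rV[R]_N -> R) : continuous f -> closed [set p | `|f p| <= rho].
  move=> cf; have -> : [set p | `|f p| <= rho] = f @^-1` `[- rho, rho]%classic.
    by apply/seteqP; split=> p /=; rewrite in_itv/= ler_norml.
  by move/continuous_closedP : cf; apply; exact: interval_closed.
have -> : coord_box = (\bigcap_i [set p | `|yco p i| <= rho]) `&` [set p | `|zcoord p| <= rho].
  by apply/seteqP; split=> p [h1 h2]; split=> // i; [move=> _|]; exact: h1.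
apply: closedI; last by apply: cl; exact: zcoord_continuous.
by apply: closed_bigI => i _; apply: cl; exact: ycoord_continuous.
Qed.

Let coord_box_bounded : bounded_set coord_box.
Proof.
pose K0 := \sum_a (\sum_i `|(vecxz (e i) 0 : 'rV[R]_N) 0 a| + `|(vecxz 0 1 : 'rV[R]_N) 0 a|) * rho.
exists K0; split; first exact: num_real.
move=> K hK p pb; apply: le_trans (ltW hK).
have t0 a : 0 <= (\sum_i `|(vecxz (e i) 0 : 'rV[R]_N) 0 a| + `|(vecxz 0 1 : 'rV[R]_N) 0 a|) * rho.
  by apply: mulr_ge0 (ltW rho0); rewrite addr_ge0// sumr_ge0.
apply: rV_norm_le => [|a]; first by apply: sumr_ge0 => a _; exact: t0.
rewrite -(emb_coord espan p) emb_entry /K0 (bigD1 a)//= -[leLHS]addr0.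
apply: lerD; last by apply: sumr_ge0 => a' _; exact: t0.
rewrite (le_trans (ler_normD _ _))// mulrDl lerD//; last by rewrite normrM ler_wpM2l//; exact: pb.2.
rewrite (le_trans (ler_norm_sum _ _ _))// mulr_suml; apply: ler_sum => i _.
by rewrite normrM ler_wpM2l//; exact: pb.1.
Qed.

(** The box is compact in coordinates and [M] is Hausdorff, so its image is closed in [M] and not
    merely in the chart: a curve cannot leave the chart before a coordinate has reached [rho]. *)
Lemma frame_box_closed : closed frame_box.
Proof.
have -> : frame_box = chart_inv c @` coord_box.
  apply/seteqP; split=> [m [dm hm]|_ [p pb <-]].
    by exists (chart_map c m) => //; exact: chart_mapK.
  by have [E dp] := chart_invK (coord_box_img pb); split=> //; rewrite E.
apply: compact_closed; first exact: manifold_hausdorff A.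
apply: continuous_compact; last exact: bounded_closed_compact.
apply: continuous_in_subspaceT => p; rewrite inE => /coord_box_img[m dm <-].
exact: chart_inv_continuous.
Qed.

Lemma frame_box_interior (m : M) : chart_dom c m ->
  (forall i, `|yco (chart_map c m) i| < rho) -> `|zcoord (chart_map c m)| < rho -> nbhs m frame_box.
Proof.
move=> dm hy hz.
have lt_near (f : 'rV[R]_N -> R) : continuous f -> `|f (chart_map c m)| < rho ->
    \forall x \near m, `|f (chart_map c x)| <= rho.
  move=> cf fr; have cfm : {for m, continuous (f \o chart_map c)}.
    by apply: continuous_comp; [exact: chart_map_continuous|exact: cf].
  have r1 : 0 < rho - `|f (chart_map c m)| by rewrite subr_gt0.
  move/cvgrPdist_le : cfm => /(_ _ r1); apply: filterS => x /= hx.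
  have := ler_normB (f (chart_map c m)) (f (chart_map c m) - f (chart_map c x)); rewrite subKr.
  by move: hx; set u := `|_ - _|; set v := `|f (chart_map c m)|; lra.
near=> x; split; [|split].
- by near: x; apply: open_nbhs_nbhs; split=> //; exact: chart_dom_open.
- near: x; apply: (@filter_forall _ _ (fun i => [set x | `|yco (chart_map c x) i| <= rho]) (nbhs m)) => i.
  by apply: (lt_near (yco ^~ i)); [exact: ycoord_continuous|exact: hy].
by near: x; apply: lt_near => //; exact: zcoord_continuous.
Unshelve. all: by end_near. Qed.

(** At the supremum of the times spent in the box the curve is still in it, by closedness. If no
    coordinate has reached [rho] by then, the point is interior and the curve stays longer, unless
    the time is [b]. Starting in the half box excludes an exit at time [a]. *)
Lemma first_exit (a b : R) (h : R -> M) : a < b -> lipschitz_curve (A := A) a b h ->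
  chart_dom c (h a) -> inbox (rho / 2) (yco (chart_map c (h a))) (zcoord (chart_map c (h a))) ->
  (forall t, a <= t <= b -> frame_box (h t)) \/
  exists s, [/\ a < s, s <= b, forall t, a <= t <= s -> frame_box (h t) &
    (exists i, rho <= `|yco (chart_map c (h s)) i|) \/ rho <= `|zcoord (chart_map c (h s))|].
Proof.
move=> ab lh da ba.
pose E := [set s : R | a <= s <= b /\ forall t, a <= t <= s -> frame_box (h t)].
have rr : rho / 2 < rho by rewrite ltr_pdivrMr// ltr_pMr// ltr1n.
have fa : frame_box (h a).
  by split=> //; split=> [i|]; [exact: le_trans (ba.1 i) (ltW rr)|exact: le_trans ba.2 (ltW rr)].
have Ea : E a.
  split; first by rewrite lexx ltW.
  by move=> t /le_anti <-.
have hsE : has_sup E by split; [exists a|exists b => s [/andP[]]].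
have Eb s : E s -> s <= sup E by move=> Es; apply: sup_upper_bound.
have supb : sup E <= b by apply: ge_sup; [exists a|move=> s [/andP[]]].
have sI : a <= sup E <= b by rewrite (Eb _ Ea) supb.
have below t : a <= t -> t < sup E -> frame_box (h t).
  move=> at_ ts; have st0 : 0 < sup E - t by rewrite subr_gt0.
  have [x [_ Ex]] := sup_adherent st0 hsE; rewrite subKr => tx.
  by apply: Ex; rewrite at_ ltW.
have fs : frame_box (h (sup E)).
  apply: contrapT => nf; have aS : a < sup E.
    by rewrite lt_neqAle (Eb _ Ea) andbT; apply/eqP => aE; apply: nf; rewrite -aE.
  have nn : nbhs (h (sup E)) (~` frame_box).
    by apply: open_nbhs_nbhs; split=> //; exact: closed_openC frame_box_closed.
  have /nbhs_ballP[r /= r0 hr] := lipschitz_curve_near lh sI nn.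
  pose t := Num.max a (sup E - r / 2).
  have t1 : a <= t by rewrite le_max lexx.
  have t2 : t < sup E by rewrite gt_max aS; lra.
  have t3 : sup E - r / 2 <= t by rewrite le_max lexx orbT.
  apply: (hr t _ _ (below t t1 t2)).
    by rewrite -ball_normE /ball_/= ger0_norm ?subr_ge0 ?(ltW t2)//; lra.
  by rewrite t1 (le_trans (ltW t2)).
have allS t : a <= t <= sup E -> frame_box (h t).
  move=> /andP[t1 t2]; have [->//|tE] := eqVneq t (sup E).
  by apply: below => //; rewrite lt_neqAle tE.
have [ex|nex] := pselect ((exists i, rho <= `|yco (chart_map c (h (sup E))) i|) \/
    rho <= `|zcoord (chart_map c (h (sup E)))|).
  right; exists (sup E); split=> //.
  rewrite lt_neqAle (Eb _ Ea) andbT; apply/eqP => aE; rewrite -aE in ex.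
  by case: ex => [[i /le_trans/(_ (ba.1 i))]|/le_trans/(_ ba.2)]; rewrite leNgt rr.
left; suff sE : sup E = b by move=> t tI; apply: allS; rewrite sE.
apply: contrapT => /eqP sb.
have slb : sup E < b by rewrite lt_neqAle sb.
have nn : nbhs (h (sup E)) frame_box.
  apply: frame_box_interior; first exact: fs.1.
    by move=> i; rewrite ltNge; apply/negP => hi; apply: nex; left; exists i.
  by rewrite ltNge; apply/negP => hi; apply: nex; right.
have /nbhs_ballP[r /= r0 hr] := lipschitz_curve_near lh sI nn.
pose s := Num.min b (sup E + r / 2).
have s1 : s <= b by rewrite ge_min lexx.
have s2 : s <= sup E + r / 2 by rewrite ge_min lexx orbT.
have s3 : sup E < s by rewrite lt_min slb; lra.
have : E s.
  split; first by rewrite s1 (le_trans (Eb _ Ea) (ltW s3)).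
  move=> t /andP[t1 t2]; have [ts|st] := leP t (sup E); first by apply: allS; rewrite t1.
  apply: hr; last by rewrite t1 (le_trans t2).
  by rewrite -ball_normE /ball_/= distrC ger0_norm ?subr_ge0 ?(ltW st)//; lra.
by move/Eb; rewrite leNgt s3.
Qed.

End frame_geodesics.

Lemma sqr_half_gap {R : realType} (r x w : R) : 0 < r -> `|x| <= r / 2 -> r <= `|w| ->
  (r / 2) ^+ 2 <= (w - x) ^+ 2.
Proof.
move=> r0 xr rw; have r20 : 0 <= r / 2 by rewrite divr_ge0 ?ltW.
rewrite -(real_normK (num_real (w - x))) lerXn2r ?nnegrE//.
have := lerB_dist w x; lra.
Qed.

(** For a horizontal curve in the box, [bl] is [W (y, u)] and half of it is the rate of the height,
    which is thus controlled by the horizontal velocity. *)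
Lemma sqr_bilinear_bound {R : realType} (w r k bl y1 u1 Su : R) : 0 <= w -> 0 <= u1 -> 0 <= k -> 
  `|bl| <= w * (y1 * u1) -> y1 <= k * r -> u1 ^+ 2 <= k * Su ->
  (2^-1 * bl) ^+ 2 <= 2^-1 * w * (k * r) * (2^-1 * w * (k * r)) * k * Su.
Proof.
move=> w0 u0 k0 hb hy hu; set m := 2^-1 * w * (k * r).
have h1 : `|2^-1 * bl| <= m * u1.
  rewrite normrM ger0_norm; last by rewrite invr_ge0.
  have : w * (y1 * u1) <= w * (k * r * u1) by rewrite ler_wpM2l// ler_wpM2r.
  by rewrite /m; lra.
rewrite -(real_normK (num_real (2^-1 * bl))).
apply: (@le_trans _ _ ((m * u1) ^+ 2)).
  by rewrite lerXn2r ?nnegrE// (le_trans _ h1).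
rewrite (_ : m * m * k * Su = m ^+ 2 * (k * Su)); last by ring.
by rewrite exprMn; apply: ler_wpM2l => //; exact: sqr_ge0.
Qed.

Section frame_curves.
Context {R : realType} {n : nat} {M : topologicalType}.
Local Notation N := (n + n + 1)%N.
Context {A : connected_manifold R N M} (S : contact_subriemannian A) (q : M) (c : chart R N M).
Hypothesis cD : darboux_chart S q c.
Context {d : nat} (e : 'I_d * bool -> 'rV[R]_(n + n)) (beta : 'I_d -> R).
Hypothesis eon : forall i k, mform (metric0 S c) (e i) (e k) = (i == k)%:R.
Hypothesis eW : forall i k, mform (Jmx R n) (e i) (e k) = planeW beta i k.
Hypothesis espan : forall x, x = \sum_i mform (metric0 S c) x (e i) *: e i.
Local Notation I := ('I_d * bool)%type.
Local Notation yco := (ycoord S c e).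
Local Notation W := (planeW beta).
Local Notation lm := (@lebesgue_measure R).

Let Ac : atlas A c. Proof. by case: cD. Qed.

Variables (rho L : R).
Hypothesis (rho0 : 0 < rho) (L0 : 0 <= L).
Hypothesis regG : regular_metric (Gf S c e) (Df S c e) (Dzf S c e) rho L.
Hypothesis boxI : forall y z, inbox rho y z -> chart_img c (emb e y z).

Variables (y : R -> I -> R) (z : R -> R) (u : R -> I -> R) (nu : R -> R).
Hypothesis geod : geodesic_eqs W (Gf S c e) (Df S c e) (Dzf S c e) y z u nu.
Hypothesis box : forall t, inbox (rho / 2) (y t) (z t).

(** Clamping the parameter makes the curve constant on either side of [[0, 1]], the normalization
    imposed on the curves that are counted. *)
Definition frame_curve (t : R) : M := chart_inv c (emb e (y (clamp01 t)) (z (clamp01 t))).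

Let half : rho / 2 < rho. Proof. by rewrite ltr_pdivrMr// ltr_pMr// ltr1n. Qed.

Let box1 t : inbox rho (y t) (z t).
Proof. by have [h1 h2] := box t; split=> [i|]; [exact: le_trans (h1 i) (ltW half)|exact: le_trans h2 (ltW half)]. Qed.

Lemma frame_curve_map t : chart_map c (frame_curve t) = emb e (y (clamp01 t)) (z (clamp01 t)) /\
  chart_dom c (frame_curve t).
Proof. by apply: chart_invK; exact: boxI. Qed.

Lemma frame_curve_derive (t : R) : 0 < t < 1 ->
  is_derive t (1 : R) (chart_map c \o frame_curve : R -> 'rV[R]_N)
    (emb e (u t) (2^-1 * bil W (y t) (u t))).
Proof.
move=> t01; have [_ _ _ _ /(_ t t01)[dy dz _ _]] := geod.
apply: near_eq_is_derive (emb_derive e dy dz).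
by apply: filterS (near_clamp01 t01) => s sE; rewrite /= (frame_curve_map s).1 sE.
Qed.

Let velE (t : R) : 0 < t < 1 -> velocity c frame_curve t = emb e (u t) (2^-1 * bil W (y t) (u t)).
Proof. by move=> t01; exact: (@derive_val _ _ _ _ _ _ _ (frame_curve_derive t01)). Qed.

Let derivE (t : R) : 0 < t < 1 -> derivable (chart_map c \o frame_curve : R -> 'rV[R]_N) t (1 : R).
Proof. by move=> t01; exact: (@ex_derive _ _ _ _ _ _ _ (frame_curve_derive t01)). Qed.

Let clampE (t : R) : 0 < t < 1 -> clamp01 t = t.
Proof. by move=> /andP[h1 h2]; apply: clamp01_id; rewrite !ltW. Qed.

Let distE (t : R) : 0 < t < 1 -> dist S c (chart_map c (frame_curve t)) (velocity c frame_curve t).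
Proof.
move=> t01; rewrite velE// (frame_curve_map t).1 clampE//; apply: (horizontal_dist cD eW).
exact: boxI.
Qed.

Let domE (t : R) : \forall s \near t, chart_dom c (frame_curve s).
Proof. by apply: filterE => s; exact: (frame_curve_map s).2. Qed.

Lemma frame_curve_sqspeed (t : R) : 0 < t < 1 -> sqspeed S frame_curve t = speed2 (Gf S c e) y z u t.
Proof.
move=> t01; rewrite (sqspeed_chart Ac (domE t) (derivE t01) (distE t01)).
have ip : chart_img c (chart_map c (frame_curve t)) by exists (frame_curve t) => //; exact: (frame_curve_map t).2.
have [_ ->] := horizontal_velocity cD eW espan ip (distE t01).
rewrite velE// (frame_curve_map t).1 clampE// zcoord_emb.
have E y' z' : yco (emb e y' z') = y' by apply/funext => i; exact: ycoord_emb.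
by rewrite !E.
Qed.

Lemma frame_curve_lipschitz : exists2 k : R, 0 <= k & forall s t : R, 0 <= s <= 1 -> 0 <= t <= 1 ->
  `|chart_map c (frame_curve s) - chart_map c (frame_curve t)| <= k * `|s - t|.
Proof.
have [cy cz cu _ hg] := geod.
have ly i : lipb 0 1 (fun t => y t i).
  have [m m0 hm] := continuous_bounded01 (cu i).
  apply: (@lipb_of_derive R 0 1 _ (fun t => u t i) m) => // [t t01|t /andP[h1 h2]].
    by have [dy _ _ _] := hg t t01; exact: dy.
  by apply: hm; rewrite !ltW.
have lz : lipb 0 1 z.
  have cb : continuous (fun t => 2^-1 * bil W (y t) (u t)).
    move=> t; apply: (@continuousM R _ (cst 2^-1) (fun t => bil W (y t) (u t))); first exact: cst_continuous.
    move: t; apply: continuous_bigsum => i; apply: continuous_bigsum => j t.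
    apply: (@continuousM R _ (fun t => W i j * y t i) (fun t => u t j)); last exact: cu.
    by apply: (@continuousM R _ (cst (W i j)) (fun t => y t i)); [exact: cst_continuous|exact: cy].
  have [m m0 hm] := continuous_bounded01 cb.
  apply: (@lipb_of_derive R 0 1 _ (fun t => 2^-1 * bil W (y t) (u t)) m) => // [t t01|t /andP[h1 h2]].
    by have [_ dz _ _] := hg t t01.
  by apply: hm; rewrite !ltW.
have le01 : (0 : R) <= 1 by [].
have la (a : 'I_N) : exists2 k : R, 0 <= k & lipschitz_within k 0 1 (fun t => emb e (y t) (z t) 0 a).
  apply: lipb_ge0; rewrite (_ : (fun t : R => _) = fun t : R =>
    \sum_i (vecxz (e i) 0 : 'rV[R]_N) 0 a * y t i + (vecxz 0 1 : 'rV[R]_N) 0 a * z t); last first.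
    by apply/funext => t; exact: emb_entry.
  apply: lipb_add; last by apply: lipb_mul => //; exact: lipb_cst.
  by apply: lipb_sum => i; apply: lipb_mul => //; exact: lipb_cst.
have [k k0 hk] : exists2 k : R, 0 <= k & forall a, lipschitz_within k 0 1 (fun t => emb e (y t) (z t) 0 a).
  apply: finite_bound la => a m m' hm mm' s t s01 t01.
  by apply: le_trans (hm s t s01 t01) _; rewrite ler_wpM2r.
exists k => // s t s01 t01; rewrite !(frame_curve_map _).1 !clamp01_id//.
apply: rV_norm_le => [|a]; first by rewrite mulr_ge0.
by rewrite mxE [X in _ + X]mxE; exact: hk.
Qed.

Lemma frame_curve_horizontal : horizontal S 0 1 frame_curve.
Proof.
split.
  move=> t _; have [k k0 hk] := frame_curve_lipschitz.
  exists c, setT, k; split=> //; first exact: filterT.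
    by move=> s _ _; exact: (frame_curve_map s).2.
  by move=> s s' _ _; exact: hk.
apply: aeW => t t01 c' Ac' dt'.
have dv := velocity_transition Ac Ac' (domE t) dt' (derivE t01).
split; first exact: (@ex_derive _ _ _ _ _ _ _ dv).
rewrite /velocity (@derive_val _ _ _ _ _ _ _ dv).
have dt := (frame_curve_map t).2.
have Wt : overlap c c' (chart_map c (frame_curve t)) by exists (frame_curve t).
by have := (dist_transition S (velocity c frame_curve t) Ac Ac' Wt).1 (distE t01); rewrite transitionE.
Qed.

Lemma frame_curve_energy (a b : R) : 0 <= a -> b <= 1 ->
  (\int[lm]_(t in `]a, b[) (sqspeed S frame_curve t)%:E =
   \int[lm]_(t in `]a, b[) (speed2 (Gf S c e) y z u t)%:E)%E.
Proof.
move=> a0 b1; apply: eq_integral => t; rewrite inE/= in_itv/= => /andP[h1 h2].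
by rewrite frame_curve_sqspeed// (le_lt_trans a0 h1) (lt_le_trans h2).
Qed.

(* A competitor that leaves the box moves a coordinate by [rho / 2], so its energy
   is at least a constant over [b - a], while the curve has energy [O(b - a)]. *)
Lemma frame_curve_minimizing : locally_minimizing S frame_curve.
Proof.
pose w0 : R := \sum_i \sum_j `|W i j|.
have w00 : 0 <= w0 by apply: sumr_ge0 => i _; apply: sumr_ge0 => j _.
have Ww i j : `|W i j| <= w0.
  rewrite /w0 (bigD1 i)//= (bigD1 j)//= -addrA lerDl addr_ge0//; first by apply: sumr_ge0.
  by apply: sumr_ge0 => i' _; apply: sumr_ge0.
have [del1 del10 hmin] := geodesic_locally_minimal (planeW_asym beta) Ww rho0 L0 regG geod box1.
have [B B0 hB] := speed2_energy_bound regG geod box1.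
pose nI : R := #|{: I}|%:R.
pose Kz : R := 2^-1 * w0 * (nI * rho) * (2^-1 * w0 * (nI * rho)) * nI.
have Kz0 : 0 <= Kz.
  apply: mulr_ge0; last exact: ler0n.
  exact: sqr_ge0.
(* [Kz] bounds the squared rate of the height by the squared horizontal velocity, and
   [k * (Kz + 1) = 1/2] puts [k] times the squared rate of any coordinate below the squared
   speed. *)
pose k : R := (2 * (Kz + 1))^-1.
have k0 : 0 < k by rewrite invr_gt0 mulr_gt0// ltr_wpDl.
have kK : k * (2 * (Kz + 1)) = 1 by rewrite mulVf// gt_eqF// mulr_gt0// ltr_wpDl.
have kK2 : k * (Kz + 1) = 2^-1 by move: kK; move: Kz k {Kz0 k0} => K1 k1; lra.
(* An exit then costs at least [k * (rho / 2) ^+ 2 / (b - a) >= B + 1], more than the bound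
   [B * (b - a)] for the curve once [b - a <= 1]. *)
pose del2 : R := k * (rho / 2) ^+ 2 / (B + 1).
have del20 : 0 < del2.
  apply: divr_gt0; last by rewrite ltr_wpDl.
  by apply: mulr_gt0 => //; apply: exprn_gt0; apply: divr_gt0.
pose del := Num.min del1 (Num.min 1 del2).
have del0 : 0 < del by rewrite !lt_min del10 ltr01 del20.
move=> t0 t001; exists (del / 2); first by apply: divr_gt0.
move=> a b a0 ab b1 at0 bt0 h [lh th] ha hb.
have bad : b - a < del.
  rewrite (_ : b - a = (b - t0) - (a - t0)); last by ring.
  rewrite (le_lt_trans (ler_norm _))// (le_lt_trans (ler_normB _ _))//.
  by rewrite [ltRHS](splitr del) ltrD.
have [N0 [mN0 N00 hN0]] := th.
have offN t : a < t < b -> ~ N0 t -> forall c', atlas A c' -> chart_dom c' (h t) ->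
    derivable (chart_map c' \o h : R -> 'rV[R]_N) t (1 : R) /\
    dist S c' (chart_map c' (h t)) (velocity c' h t).
  move=> tab nN; apply: contrapT => nh; apply: nN; apply: hN0 => /= hh; apply: nh.
  exact: (hh tab).
have domh t : a < t < b -> chart_dom c (h t) -> \forall s \near t, chart_dom c (h s).
  move=> tab dt.
  have tI : t \in `]a, b[ by rewrite in_itv.
  have tc : a <= t <= b by case/andP: tab => h1 h2; rewrite !ltW.
  have nd : nbhs (h t) (chart_dom c) by apply: open_nbhs_nbhs; split=> //; exact: chart_dom_open.
  have n1 := lipschitz_curve_near lh tc nd; have n2 := near_in_itvoo tI.
  near=> s; have sI : s \in `]a, b[ by near: s.
  have : a <= s <= b -> chart_dom c (h s) by near: s.
  by apply; move: sI; rewrite in_itv/= => /andP[h1 h2]; rewrite !ltW.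
have fact t : a < t < b -> ~ N0 t -> chart_dom c (h t) ->
    let yh s := yco (chart_map c (h s)) in let zh s := zcoord (chart_map c (h s)) in
    exists uh : I -> R, [/\ forall i, is_derive t (1 : R) (fun s : R => yh s i) (uh i),
      is_derive t (1 : R) zh (2^-1 * bil W (yh t) uh) &
      sqspeed S h t = bil (fun i j => Gf S c e i j (yh t) (zh t)) uh uh].
  move=> tab nN dt; have [dc dd] := offN t tab nN c Ac dt.
  exact: (curve_frame_derivatives cD eW espan (domh t tab dt) dc dd).
have yE t : 0 <= t <= 1 -> yco (chart_map c (frame_curve t)) = y t.
  by move=> t01; rewrite (frame_curve_map t).1 clamp01_id//; apply/funext => i; exact: ycoord_emb.
have zE t : 0 <= t <= 1 -> zcoord (chart_map c (frame_curve t)) = z t.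
  by move=> t01; rewrite (frame_curve_map t).1 clamp01_id//; exact: zcoord_emb.
have a01 : 0 <= a <= 1 by rewrite a0 (le_trans (ltW ab)).
have b01 : 0 <= b <= 1 by rewrite b1 (le_trans a0 (ltW ab)).
have da : chart_dom c (h a) by rewrite ha; exact: (frame_curve_map a).2.
have ba : inbox (rho / 2) (yco (chart_map c (h a))) (zcoord (chart_map c (h a))).
  by rewrite ha yE// zE//; exact: box.
have lipl s (w : 'I_N -> R) : a <= s -> s <= b -> (forall t, a <= t <= s -> chart_dom c (h t)) ->
    lipb a s (fun t => \sum_j w j * chart_map c (h t) 0 j).
  move=> as_ sb dom; apply: lipb_sum => j; apply: lipb_mul => //; first exact: lipb_cst.
  by apply: (@lipschitz_curve_chart R n M A a s h c j) => //; exact: lipschitz_curve_sub lh.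
have lipy s i : a <= s -> s <= b -> (forall t, a <= t <= s -> chart_dom c (h t)) ->
    lipb a s (fun t => yco (chart_map c (h t)) i).
  rewrite (_ : (fun t => _) = fun t => \sum_j yco 'e_j i * chart_map c (h t) 0 j); first exact: lipl.
  by apply/funext => t; exact: ycoord_sum.
have lipz s : a <= s -> s <= b -> (forall t, a <= t <= s -> chart_dom c (h t)) ->
    lipb a s (fun t => zcoord (chart_map c (h t))).
  rewrite (_ : (fun t => _) = fun t => \sum_j zcoord ('e_j : 'rV[R]_N) * chart_map c (h t) 0 j); first exact: lipl.
  by apply/funext => t; exact: zcoord_sum.
rewrite /energy; apply: lee_wpmul2l; first by rewrite lee_fin invr_ge0.
rewrite frame_curve_energy; [|exact: a0|exact: b1].
have [inb|[s [as_ sb inb ex]]] := first_exit espan rho0 boxI ab lh da ba.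
  apply: (hmin a b a0 ab b1 _ (fun t => yco (chart_map c (h t))) (fun t => zcoord (chart_map c (h t))) N0).
  - by rewrite (lt_le_trans bad)// ge_min lexx.
  - by move=> i; apply: lipy => //; [exact: ltW|move=> t /inb[]].
  - by apply: lipz => //; [exact: ltW|move=> t /inb[]].
  - by move=> t /inb[].
  - exact: mN0.
  - exact: N00.
  - move=> t tab nN; have [dt _] : frame_box S c e rho (h t).
      by apply: inb; case/andP: tab => h1 h2; rewrite !ltW.
    by have [uh [h1 h2 h3]] := fact t tab nN dt; exists uh; split=> //; rewrite h3.
  - by move=> i; rewrite ha hb !yE.
  - by rewrite ha zE.
  - by rewrite hb zE.
apply: (le_trans (hB a b a0 ab b1)).
have ba0 : 0 < b - a by rewrite subr_gt0.
(* [p] is whichever coordinate reaches [rho] at the exit time. *)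
have [p [lp pa ps pE]] : exists p : R -> R, [/\ lipb a s p, `|p a| <= rho / 2, rho <= `|p s| &
    forall t, a < t < s -> ~ N0 t -> derivable p t 1 /\ k * 'D_1 p t ^+ 2 <= sqspeed S h t].
  have key t (uh : I -> R) : a < t < s ->
      sqspeed S h t = bil (fun i j => Gf S c e i j (yco (chart_map c (h t))) (zcoord (chart_map c (h t)))) uh uh ->
      k * ((Kz + 1) * \sum_i uh i ^+ 2) <= sqspeed S h t.
    move=> /andP[t1 t2] ->.
    have [_ bt] : frame_box S c e rho (h t) by apply: inb; rewrite !ltW.
    have hd i j : `|Gf S c e i j (yco (chart_map c (h t))) (zcoord (chart_map c (h t))) - (i == j)%:R| <=
        (2 * #|{: I}|%:R)^-1 by have [hd _ _ _ _] := regG i j; exact: hd.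
    by have := bil_lower uh hd; rewrite mulrA kK2; exact.
  have dom : forall t, a <= t <= s -> chart_dom c (h t) by move=> t /inb[].
  have tab t : a < t < s -> a < t < b by move=> /andP[-> /lt_le_trans->].
  have tas t : a < t < s -> a <= t <= s by move=> /andP[h1 h2]; rewrite !ltW.
  have [[i hi]|hz] := ex.
    exists (fun t => yco (chart_map c (h t)) i); split=> //.
    - by apply: lipy => //; exact: ltW.
    - exact: ba.1.
    move=> t ts nN; have [uh [h1 h2 h3]] := fact t (tab t ts) nN (dom t (tas t ts)).
    split; first exact: (@ex_derive _ _ _ _ _ _ _ (h1 i)).
    rewrite (@derive_val _ _ _ _ _ _ _ (h1 i)); apply: le_trans (key t uh ts h3).
    rewrite ler_pM2l// (bigD1 i)//=.
    have := sqr_ge0 (uh i); have : 0 <= \sum_(j | j != i) uh j ^+ 2 by apply: sumr_ge0 => j _; exact: sqr_ge0.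
    by move: Kz0; move: (uh i ^+ 2) (\sum_(j | j != i) _) => x1 x2; nra.
  exists (fun t => zcoord (chart_map c (h t))); split=> //.
  - by apply: lipz => //; exact: ltW.
  - exact: ba.2.
  move=> t ts nN; have [uh [h1 h2 h3]] := fact t (tab t ts) nN (dom t (tas t ts)).
  split; first exact: (@ex_derive _ _ _ _ _ _ _ h2).
  rewrite (@derive_val _ _ _ _ _ _ _ h2); apply: le_trans (key t uh ts h3).
  rewrite ler_pM2l//.
  have [_ bt] := inb t (tas t ts).
  have g1 := bil_le (yco (chart_map c (h t))) uh Ww.
  have g2 := norm1_sum_le bt.1.
  have g3 := sqr_norm1_le uh.
  apply: (le_trans (sqr_bilinear_bound w00 (norm1_ge0 uh) (ler0n _ _) g1 g2 g3)).
  by rewrite -/nI -/Kz ler_wpM2r ?lerDl// sumr_ge0// => j _; exact: sqr_ge0.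
apply: le_trans (exit_energy as_ sb (ltW k0) lp mN0 N00 pE _); last first.
  by move=> t tab nN; apply: sqspeed_ge0 => c' Ac' dt; exact: (offN t tab nN c' Ac' dt).2.
rewrite lee_fin ler_pdivlMr//.
have g1 : (rho / 2) ^+ 2 <= (p s - p a) ^+ 2 by exact: sqr_half_gap.
have g2 : b - a <= 1 by rewrite (le_trans (ltW bad))// !ge_min lexx orbT.
have g3 : (b - a) * (B + 1) <= k * (rho / 2) ^+ 2.
  rewrite -ler_pdivlMr ?ltr_wpDl//; apply: (le_trans (ltW bad)).
  by rewrite /del !ge_min lexx !orbT.
have g4 : k * (rho / 2) ^+ 2 <= k * (p s - p a) ^+ 2 by rewrite ler_pM2l.
apply: le_trans g4; apply: le_trans g3.
have g5 := mulr_ge0 (mulr_ge0 B0 (ltW ba0)) (_ : 0 <= 1 - (b - a)).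
have {g5} : 0 <= B * (b - a) * (1 - (b - a)) by apply: g5; rewrite subr_ge0.
move: ba0; move: (b - a) => x x0 g5.
have -> : x * (B + 1) = B * x * x + (B * x * (1 - x) + x) by ring.
by rewrite lerDl addr_ge0// ltW.
Unshelve. all: by end_near. Qed.

End frame_curves.

(** * Null sets *)

Section null_sets.
Context {R : realType}.

Let box_vol N (a b : 'rV[R]_N) : R := \prod_i (b 0 i - a 0 i).

Lemma measure_zero_sub N (Z Z' : set 'rV[R]_N) : Z `<=` Z' -> measure_zero Z' -> measure_zero Z.
Proof.
move=> ZZ' mz e e0; have [a [b [h1 h2 h3]]] := mz e e0; exists a, b; split=> // p /ZZ'.
exact: h2.
Qed.

(** The [n]-th set gets the share [e / 2 ^ n.+1], and a bijection between [nat] and its square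
    merges the covers. *)
Lemma measure_zero_bigcup N (Z : nat -> set 'rV[R]_N) :
  (forall n, measure_zero (Z n)) -> measure_zero (\bigcup_n Z n).
Proof.
move=> mz e e0.
have en n : 0 < e / (2 ^ n.+1)%:R by rewrite divr_gt0// ltr0n expn_gt0.
have /choice[ab hab] : forall n, exists ab : (nat -> 'rV[R]_N) * (nat -> 'rV[R]_N),
    [/\ forall k i, ab.1 k 0 i <= ab.2 k 0 i,
        forall p, Z n p -> exists k, forall i, ab.1 k 0 i <= p 0 i <= ab.2 k 0 i
      & (\sum_(0 <= k <oo) (box_vol (ab.1 k) (ab.2 k))%:E <= (e / (2 ^ n.+1)%:R)%:E)%E].
  by move=> n; have [a [b h]] := mz n _ (en n); exists (a, b).
have /card_esym/ppcard_eqP[f] := card_nat2.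
pose a k := (ab (f k).1).1 (f k).2; pose b k := (ab (f k).1).2 (f k).2.
have vol0 n k : (0 <= (box_vol ((ab n).1 k) ((ab n).2 k))%:E)%E.
  rewrite lee_fin; apply: prodr_ge0 => i _; rewrite subr_ge0.
  by have [h _ _] := hab n; exact: h.
exists a, b; split.
- by move=> k i; have [h _ _] := hab (f k).1; exact: h.
- move=> p [n _ Znp]; have [_ /(_ p Znp)[k hk] _] := hab n.
  by exists (f^-1%FUN (n, k)) => i; rewrite /a /b invK ?inE//=; exact: hk.
rewrite nneseries_esumT; last by move=> k; exact: vol0.
pose V (q : nat * nat) := (box_vol ((ab q.1).1 q.2) ((ab q.1).2 q.2))%:E.
rewrite -(@reindex_esum R nat (nat * nat)%type setT setT f V); last exact: bij.
have -> : [set: nat * nat] = [set: nat] `*`` (fun=> [set: nat]) by apply/seteqP; split.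
rewrite -(@esum_esum _ _ _ _ _ (fun n k => V (n, k))); last by move=> n k _ _; exact: vol0.
rewrite (_ : esum _ _ = \sum_(n <oo) \sum_(k <oo) V (n, k))%E; last first.
  rewrite nneseries_esumT; last by move=> n; apply: nneseries_ge0 => k _ _; exact: vol0.
  by apply: eq_esum => n _; rewrite nneseries_esumT// => k; exact: vol0.
apply: (@le_trans _ _ (\sum_(n <oo) (e / (2 ^ n.+1)%:R)%:E)%E).
  apply: lee_nneseries => [n _ _|n _]; first by apply: nneseries_ge0 => k _ _; exact: vol0.
  by have [_ _ h] := hab n; exact: h.
by apply: epsilon_trick0; exact: ltW.
Qed.

(** The finite cover is completed by copies of the point [0], whose volume vanishes because the
    dimension is positive. *)
Lemma measure_zero_finite_cover N (Z : set 'rV[R]_N.+1) :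
  (forall e : R, 0 < e -> exists (T : finType) (a b : T -> 'rV[R]_N.+1),
    [/\ forall t i, a t 0 i <= b t 0 i,
        forall p, Z p -> exists t, forall i, a t 0 i <= p 0 i <= b t 0 i &
        \sum_t box_vol (a t) (b t) <= e]) -> measure_zero Z.
Proof.
move=> h e e0; have [T [a [b [h1 h2 h3]]]] := h e e0.
pose ext (c : T -> 'rV[R]_N.+1) k : 'rV[R]_N.+1 :=
  if insub k is Some i then c (enum_val (i : 'I_#|T|)) else 0.
exists (ext a), (ext b); split.
- by move=> k i; rewrite /ext; case: insub => [j|]; [exact: h1|rewrite lexx].
- move=> p /h2[t ht]; exists (enum_rank t) => i; rewrite /ext.
  by rewrite insubT//= => ?; rewrite (_ : Sub _ _ = enum_rank t) ?enum_rankK//; exact: val_inj.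
rewrite (nneseries_split 0 #|T|); last first.
  move=> k _; rewrite lee_fin; apply: prodr_ge0 => i _; rewrite subr_ge0 /ext.
  by case: insub => [j|]; [exact: h1|rewrite lexx].
rewrite add0n eseries0 ?adde0; last first.
  move=> k kT _; rewrite /ext insubF; last by rewrite ltnNge kT.
  by rewrite (bigD1 ord0)//= subrr mul0r.
rewrite sumEFin lee_fin big_mkord (le_trans _ h3)//.
rewrite (reindex (@enum_val T T)) /=; last exact: (onW_bij _ (enum_val_bij T)).
apply: ler_sum => i _; rewrite /ext insubT//= => ?.
by rewrite (_ : Sub _ _ = i)//; exact: val_inj.
Qed.

Lemma grid_cell (n K : nat) (x : R) : (0 < K)%N -> `|x| <= n.+1%:R ->
  exists k : 'I_K, - n.+1%:R + 2 * n.+1%:R / K%:R * k%:R <= x <=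
    - n.+1%:R + 2 * n.+1%:R / K%:R * k.+1%:R.
Proof.
move=> K0; rewrite ler_norml => /andP[x1 x2].
have KR : (0 : R) < K%:R by rewrite ltr0n.
have nR : (0 : R) < n.+1%:R by rewrite ltr0n.
set dl := 2 * n.+1%:R / K%:R; have dl0 : 0 < dl by rewrite divr_gt0// mulr_gt0.
have E : dl * K%:R = 2 * n.+1%:R by rewrite divfK// gt_eqF.
pose y := (x + n.+1%:R) / dl.
have y0 : 0 <= y by rewrite divr_ge0 ?(ltW dl0)//; lra.
have xE : x = - n.+1%:R + dl * y by rewrite /y mulrC divfK ?gt_eqF//; ring.
have [yK|Ky] := ltP y K%:R.
  have tK : (Num.truncn y < K)%N by rewrite truncn_lt_nat.
  exists (Ordinal tK) => /=; have /andP[t1 t2] := truncn_itv y0.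
  by rewrite xE !lerD2l !ler_pM2l// t1 ltW.
(* The right end of the range is in no half-open cell and goes to the last one. *)
have K1 : (K.-1 < K)%N by rewrite prednK.
have yE : y = K%:R.
  apply/eqP; rewrite eq_le Ky andbT -(ler_pM2l dl0) E; move: x2; rewrite {1}xE; lra.
exists (Ordinal K1) => /=; rewrite prednK// xE yE !lerD2l !ler_pM2l// lexx andbT.
by rewrite ler_nat leq_pred.
Qed.

(** The equation is solved for a coordinate [i0] with nonzero coefficient. Over a cell of side [dl]
    in the other coordinates the solution stays within [B * dl] of its value at the corner, so a
    bounded piece is covered by boxes of total volume [O(dl)]. *)
Lemma measure_zero_hyperplane N (c : 'rV[R]_N) : c != 0 ->
  measure_zero [set p : 'rV[R]_N | \sum_i c 0 i * p 0 i = 0].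
Proof.
case: N c => [|N] c c0.
  by case/eqP: c0; apply/rowP => -[].
have [i0 ci0] : exists i0, c 0 i0 != 0.
  apply: contrapT => h; case/eqP: c0; apply/rowP => i; rewrite mxE; apply: contrapT => ci.
  by apply: h; exists i; apply/eqP.
pose Zn n := [set p : 'rV[R]_N.+1 | \sum_i c 0 i * p 0 i = 0 /\ forall i, `|p 0 i| <= n.+1%:R].
suff mZ n : measure_zero (Zn n).
  apply: measure_zero_sub (measure_zero_bigcup mZ) => p /= hp.
  exists (Num.truncn `|p|) => //; split=> // i.
  have /andP[_ h] := truncn_itv (normr_ge0 p); apply: le_trans (ltW h).
  by rewrite [leRHS]/Num.Def.normr/= mx_normrE; exact: (le_bigmax _ (fun k : 'I_1 * 'I_N.+1 => `|p k.1 k.2|) (0, i)).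
apply: measure_zero_finite_cover => e e0.
pose B := \sum_(j < N) `|c 0 (lift i0 j) / c 0 i0|.
have B0 : 0 <= B by apply: sumr_ge0.
pose r : R := 2 * n.+1%:R; have r0 : 0 < r by rewrite mulr_gt0.
(* Number of subdivisions per axis; the total volume will be [r ^+ N.+1 * (2 * B) / K%:R]. *)
pose K := (Num.truncn (r ^+ N.+1 * (2 * B) / e)).+1.
have KR : (0 : R) < K%:R by rewrite ltr0n.
pose dl := r / K%:R; have dl0 : 0 < dl by rewrite divr_gt0.
pose corner (t : {ffun 'I_N -> 'I_K}) j : R := - n.+1%:R + dl * (t j)%:R.
pose ctr t : R := - \sum_(j < N) c 0 (lift i0 j) / c 0 i0 * corner t j.
pose a t : 'rV[R]_N.+1 := \row_i (if unlift i0 i is Some j then corner t j else ctr t - B * dl).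
pose b t : 'rV[R]_N.+1 := \row_i (if unlift i0 i is Some j then corner t j + dl else ctr t + B * dl).
exists {ffun 'I_N -> 'I_K}, a, b; split.
- move=> t i; rewrite !mxE; case: unliftP => [j _|_]; first by rewrite lerDl ltW.
  by have := mulr_ge0 B0 (ltW dl0); lra.
- move=> p [hp pn].
  have /choice[t ht] : forall j : 'I_N, exists k : 'I_K,
      - n.+1%:R + dl * k%:R <= p 0 (lift i0 j) <= - n.+1%:R + dl * k.+1%:R.
    by move=> j; exact: grid_cell.
  exists [ffun j => t j] => i; rewrite !mxE; case: unliftP => [j ->|->].
    have /andP[h1 h2] := ht j; rewrite /corner ffunE h1/= (le_trans h2)// -[(t j).+1%:R]natr1; lra.
  have pi0 : p 0 i0 = - \sum_(j < N) c 0 (lift i0 j) / c 0 i0 * p 0 (lift i0 j).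
    apply: (mulfI ci0); rewrite mulrN mulr_sumr; apply/eqP; rewrite -addr_eq0; apply/eqP.
    rewrite -[RHS]hp (bigD1_ord i0)//=; congr (_ + _); apply: eq_bigr => j _.
    by field.
  have : `|p 0 i0 - ctr [ffun j => t j]| <= B * dl.
    rewrite pi0 /ctr -opprD normrN -sumrB (le_trans (ler_norm_sum _ _ _))// mulr_suml.
    apply: ler_sum => j _; rewrite -mulrBr normrM ler_wpM2l// /corner ffunE.
    have /andP[h1] := ht j; rewrite -[(t j).+1%:R]natr1 => h2; rewrite ger0_norm; lra.
  by rewrite ler_distl => /andP[-> ->].
have vol t : box_vol (a t) (b t) = dl ^+ N * (2 * B * dl).
  rewrite /box_vol (bigD1_ord i0)//= !mxE unlift_none mulrC; congr (_ * _); last by ring.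
  rewrite (eq_bigr (fun=> dl)); first by rewrite prodr_const card_ord.
  by move=> j _; rewrite !mxE liftK; ring.
rewrite (eq_bigr _ (fun t _ => vol t)) sumr_const card_ffun !card_ord -[leLHS]mulr_natl natrX.
rewrite mulrA -exprMn /dl (mulrC K%:R) divfK ?gt_eqF//.
have -> : r ^+ N * (2 * B * (r / K%:R)) = (r ^+ N.+1 * (2 * B)) / K%:R by rewrite exprS; ring.
rewrite ler_pdivrMr// [leRHS]mulrC -ler_pdivrMr//.
have h0 : 0 <= r ^+ N.+1 * (2 * B) / e.
  by rewrite divr_ge0 ?(ltW e0)// !mulr_ge0// exprn_ge0// ltW.
by have /andP[_ h] := truncn_itv h0; exact: ltW.
Qed.

End null_sets.

(** * Counting geodesics *)

(** The coefficients are controlled on the box only. Clamping their arguments makes them globally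
    Lipschitz, as the fixed point argument requires; the solutions found have size [O(e)], hence
    stay in the half box, where clamping changes nothing. *)
Lemma geodesic_bvp_box {R : realType} (d : nat) (beta : 'I_d -> R)
    (G : 'I_d * bool -> 'I_d * bool -> ('I_d * bool -> R) -> R -> R)
    (D : 'I_d * bool -> 'I_d * bool -> 'I_d * bool -> ('I_d * bool -> R) -> R -> R)
    (Dz : 'I_d * bool -> 'I_d * bool -> ('I_d * bool -> R) -> R -> R) (rho L : R) :
  0 < rho -> 0 <= L -> regular_metric G D Dz rho L ->
  (forall i j y z y' z', inbox rho y z -> inbox rho y' z' ->
    (forall k, `|D i j k y' z' - D i j k y z| <= L * dist1 y y' z z') /\
    `|Dz i j y' z' - Dz i j y z| <= L * dist1 y y' z z') ->
  (forall i j, G i j (fun=> 0) 0 = (i == j)%:R) ->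
  forall (lo hi : R) (X : 'I_d * bool -> R) (zt : R), lo <= hi ->
  (forall m : R, lo <= m <= hi -> forall j, sin (m * beta j / 2) != 0) ->
  (phi0 beta X lo - zt) * (phi0 beta X hi - zt) < 0 ->
  exists2 e1 : R, 0 < e1 & forall e : R, 0 < e <= e1 ->
    exists m y z u nu, lo <= m <= hi /\ geodesic_eqs (planeW beta) G D Dz y z u nu /\
      [/\ forall i, y 0 i = 0, z 0 = 0, nu 0 = m, forall i, y 1 i = e * X i & z 1 = e ^+ 2 * zt] /\
      forall t, inbox (rho / 2) (y t) (z t).
Proof.
move=> rho0 L0 regG lipD G0 lo hi X zt lohi nopole sgn.
have rr : - rho <= rho by rewrite (le_trans _ (ltW rho0))// oppr_le0 ltW.
pose cl : R -> R := clampr (- rho) rho.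
pose cv (y : 'I_d * bool -> R) := fun i => cl (y i).
have clbox y z : inbox rho (cv y) (cl z).
  by split=> [i|]; rewrite ler_norml; exact: clampr_itv.
have clid y z : inbox rho y z -> cv y = y /\ cl z = z.
  move=> [hy hz]; split; last by apply: clampr_id; rewrite -ler_norml.
  by apply/funext => i; apply: clampr_id; rewrite -ler_norml.
have cl0 : cl 0 = 0 by apply: clampr_id; rewrite oppr_le0 !ltW.
have lip (H : ('I_d * bool -> R) -> R -> R) :
    (forall y z y' z', inbox rho y z -> inbox rho y' z' -> `|H y' z' - H y z| <= L * dist1 y y' z z') ->
    lip_yz L (fun y z => H (cv y) (cl z)).
  move=> hH y z y' z'; apply: (le_trans (hH _ _ _ _ (clbox y' z') (clbox y z))).
  apply: ler_wpM2l => //; apply: lerD; last exact: clampr_lip.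
  by apply: ler_sum => i _; exact: clampr_lip.
pose G' i j y z := G i j (cv y) (cl z).
pose D' i j k y z := D i j k (cv y) (cl z).
pose Dz' i j y z := Dz i j (cv y) (cl z).
have GL i j : lip_yz L (G' i j).
  by apply: lip => y z y' z' b1 b2; have [_ _ h _ _] := regG i j; exact: h.
have DL i j k : lip_yz L (D' i j k).
  by apply: lip => y z y' z' b1 b2; have [h _] := lipD i j _ _ _ _ b1 b2; exact: h.
have DzL i j : lip_yz L (Dz' i j).
  by apply: lip => y z y' z' b1 b2; have [_ h] := lipD i j _ _ _ _ b1 b2; exact: h.
have G0' i j : G' i j (fun=> 0) 0 = (i == j)%:R.
  by rewrite /G' /cv cl0 -G0.
have [e0 [B [/andP[e00 e01] B0 hB]]] := geodesic_bvp L0 GL DL DzL G0' lohi nopole sgn.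
have B1 : 0 < B + 1 by rewrite ltr_wpDl.
have r2 : 0 < rho / 2 by rewrite divr_gt0.
exists (Num.min e0 (rho / 2 / (B + 1))); first by rewrite lt_min e00 divr_gt0.
move=> e /andP[ep]; rewrite le_min => /andP[ee0 er].
have eI : 0 < e <= e0 by rewrite ep ee0.
have [m [y [z [u [nu [mI [geod [ends bnd]]]]]]]] := hB e eI.
have Be : B * e <= rho / 2.
  move: er; rewrite ler_pdivlMr// => er; apply: le_trans er.
  by rewrite mulrDr mulr1 mulrC lerDl ltW.
have box t : inbox (rho / 2) (y t) (z t).
  by have [h1 h2] := bnd t; split=> [i|]; [exact: le_trans (h1 i) Be|exact: le_trans h2 Be].
have half : rho / 2 <= rho by rewrite ler_pdivrMr// ler_pMr// ler1n.
have box1 t : inbox rho (y t) (z t).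
  by have [h1 h2] := box t; split=> [i|]; [exact: le_trans (h1 i) half|exact: le_trans h2 half].
exists m, y, z, u, nu; split=> //; split; last by split.
have GE t i j : G' i j (y t) (z t) = G i j (y t) (z t).
  by rewrite /G'; have [-> ->] := clid _ _ (box1 t).
have DE t i j k : D' i j k (y t) (z t) = D i j k (y t) (z t).
  by rewrite /D'; have [-> ->] := clid _ _ (box1 t).
have DzE t i j : Dz' i j (y t) (z t) = Dz i j (y t) (z t).
  by rewrite /Dz'; have [-> ->] := clid _ _ (box1 t).
have GF t : (fun i j => G' i j (y t) (z t)) = (fun i j => G i j (y t) (z t)).
  by apply/funext => i; apply/funext => j.
have DF t k : (fun i j => D' i j k (y t) (z t)) = (fun i j => D i j k (y t) (z t)).
  by apply/funext => i; apply/funext => j.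
have DzF t : (fun i j => Dz' i j (y t) (z t)) = (fun i j => Dz i j (y t) (z t)).
  by apply/funext => i; apply/funext => j.
have [h1 h2 h3 h4 h5] := geod; split=> // t t01; have [g1 g2 g3 g4] := h5 t t01.
rewrite DzF in g3; split=> // k; have := g4 k; rewrite DzF DF.
have -> : (fun s : R => momentum (fun i j => G' i j (y s) (z s)) (u s) k) =
  (fun s : R => momentum (fun i j => G i j (y s) (z s)) (u s) k).
  by apply/funext => s; rewrite GF.
exact.
Qed.

(** The height of the model is odd in the multiplier, so negative heights are reached with negative
    multipliers; the period is then read on the absolute value. *)
Lemma signed_model_intervals {R : realType} (d : nat) (beta : 'I_d -> R) (j0 : 'I_d) :
  (forall j, 0 < beta j) -> (forall j, beta j <= beta j0) ->
  exists2 C : R, 0 < C & forall (X : 'I_d * bool -> R) (zt : R),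
    let Xn j := X (j, false) ^+ 2 + X (j, true) ^+ 2 in
    (forall j, 0 < Xn j) -> forall k, C * k.+1%:R * (\sum_j Xn j) < `|zt| ->
    exists lo hi : R, [/\ lo <= hi, forall m : R, lo <= m <= hi -> forall j, sin (m * beta j / 2) != 0,
      (phi0 beta X lo - zt) * (phi0 beta X hi - zt) < 0 &
      forall m, lo <= m <= hi -> 2 * pi / beta j0 * k%:R < `|m| < 2 * pi / beta j0 * k.+1%:R].
Proof.
move=> beta0 bmax; have [C C0 hC] := model_intervals beta0 bmax.
exists C => // X zt Xn Xn0 k hk.
have [lo [hi [h1 h2 h3 h4 /andP[h5 h6]]]] := hC Xn `|zt| Xn0 k hk.
have per0 : 0 <= 2 * pi / beta j0 * k%:R.
  by rewrite mulr_ge0// divr_ge0 ?(ltW (beta0 _))// mulr_ge0// pi_ge0.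
have lo0 : 0 < lo by exact: le_lt_trans h1.
have hi0 : 0 < hi by exact: lt_le_trans h2.
have loI : lo <= lo <= hi by rewrite lexx.
have hiI : lo <= hi <= hi by rewrite lexx h2.
have phiE m : lo <= m <= hi -> phi0 beta X m = model_z beta Xn m.
  move=> mI; have m0 : m != 0 by rewrite gt_eqF// (lt_le_trans lo0)//; case/andP: mI.
  by rewrite (phi0E X (h4 m mI) m0).
have phiN m : lo <= m <= hi -> phi0 beta X (- m) = - model_z beta Xn m.
  move=> mI; have m0 : - m != 0 by rewrite oppr_eq0 gt_eqF// (lt_le_trans lo0)//; case/andP: mI.
  have np j : sin (- m * beta j / 2) != 0 by rewrite !mulNr sinN oppr_eq0; exact: h4.
  rewrite (phi0E X np m0) /model_z -sumrN; apply: eq_bigr => j _.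
  by rewrite !mulNr !sinN sqrrN -opprD mulrN mulNr.
have [z0|z0] := leP 0 zt.
  rewrite (ger0_norm z0) in h5 h6; exists lo, hi; split=> //.
    by rewrite !phiE// pmulr_llt0 ?subr_gt0// subr_lt0.
  move=> m /andP[m1 m2]; rewrite ger0_norm; last by rewrite (le_trans (ltW lo0)).
  by rewrite (lt_le_trans h1 m1) (le_lt_trans m2 h3).
rewrite (ltr0_norm z0) in h5 h6; exists (- hi), (- lo).
have flip m : - hi <= m <= - lo -> lo <= - m <= hi by rewrite lerNr lerNl andbC.
split; first by rewrite lerN2.
- by move=> m /flip mI j; have := h4 _ mI j; rewrite !mulNr sinN oppr_eq0.
- by rewrite !phiN// pmulr_llt0 ?subr_gt0 ?subr_lt0 1?ltrNl// ltrNr.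
move=> m /flip/andP[m1 m2]; rewrite -normrN ger0_norm; last by rewrite (le_trans (ltW lo0)).
by rewrite (lt_le_trans h1 m1) (le_lt_trans m2 h3).
Qed.

(** Equal curves have equal velocities and momenta, so the momentum equations leave
    [(nu - nu') * contrW u = 0], where [nu - nu'] is constant. If it is not zero, [u] vanishes
    because all [beta j] are positive, and the curve is constant. *)
Lemma geodesic_eqs_multiplier {R : realType} (d : nat) (beta : 'I_d -> R)
    (G : 'I_d * bool -> 'I_d * bool -> ('I_d * bool -> R) -> R -> R)
    (D : 'I_d * bool -> 'I_d * bool -> 'I_d * bool -> ('I_d * bool -> R) -> R -> R)
    (Dz : 'I_d * bool -> 'I_d * bool -> ('I_d * bool -> R) -> R -> R)
    (y y' : R -> 'I_d * bool -> R) (z z' : R -> R) (u u' : R -> 'I_d * bool -> R) (nu nu' : R -> R) i0 :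
  (forall j, 0 < beta j) ->
  geodesic_eqs (planeW beta) G D Dz y z u nu -> geodesic_eqs (planeW beta) G D Dz y' z' u' nu' ->
  (forall t, 0 <= t <= 1 -> y t = y' t /\ z t = z' t) -> y 0 i0 != y 1 i0 -> nu 0 = nu' 0.
Proof.
move=> beta0 g g' same ne.
have near01 (t : R) : 0 < t < 1 -> \forall s \near t, 0 < s < 1.
  move=> t01; have tI : t \in `]0, 1[ by rewrite in_itv.
  by have := near_in_itvoo tI; apply: filterS => s; rewrite in_itv.
have w01 (t : R) : 0 < t < 1 -> 0 <= t <= 1 by move=> /andP[h1 h2]; rewrite !ltW.
have [cy cz cu cn hg] := g; have [cy' cz' cu' cn' hg'] := g'.
have uE (t : R) : 0 < t < 1 -> u t = u' t.
  move=> t01; apply/funext => i; have [dy _ _ _] := hg t t01; have [dy' _ _ _] := hg' t t01.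
  have d2 : is_derive t (1 : R) (fun s => y' s i) (u t i).
    apply: near_eq_is_derive (dy i); apply: filterS (near01 t t01) => s /w01 s01.
    by have [-> _] := same s s01.
  by rewrite -(@derive_val _ _ _ _ _ _ _ d2) (@derive_val _ _ _ _ _ _ _ (dy' i)).
have key (t : R) k : 0 < t < 1 -> nu t * contrW (planeW beta) (u t) k = nu' t * contrW (planeW beta) (u t) k.
  move=> t01; have [_ _ _ /(_ k) d1] := hg t t01; have [_ _ _ /(_ k) d2] := hg' t t01.
  have [yE zE] := same t (w01 t t01).
  have hm : \forall s \near t, momentum (fun i j => G i j (y s) (z s)) (u s) k =
      momentum (fun i j => G i j (y' s) (z' s)) (u' s) k.
    apply: filterS (near01 t t01) => s s01.
    by have [-> ->] := same s (w01 s s01); rewrite uE.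
  have d3 := near_eq_is_derive hm d1.
  have := @derive_val _ _ _ _ _ _ _ d2; rewrite (@derive_val _ _ _ _ _ _ _ d3) -yE -zE -uE//.
  exact: addrI.
apply: contrapT => /eqP nne.
have cd : continuous (fun t => nu t - nu' t).
  by move=> t; apply: (@continuousB R _ _ nu nu'); [exact: cn|exact: cn'].
have const (t : R) : 0 <= t <= 1 -> nu t - nu' t = nu 0 - nu' 0.
  apply: (derive0_constant cd) => s s01.
  have [_ _ d1 _] := hg s s01; have [_ _ d2 _] := hg' s s01; have [yE zE] := same s (w01 s s01).
  apply: is_derive_eq (is_deriveB d1 d2) _.
  by rewrite -yE -zE -uE// subrr.
have u0 (t : R) i : 0 < t < 1 -> u t i = 0.
  move=> t01; have := key t (partner i) t01; rewrite contr_planeW.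
  have -> : partner (partner i) = i by rewrite /partner /= negbK; case: i.
  move/eqP; rewrite -subr_eq0 -mulrBl const ?w01// mulf_eq0 subr_eq0 (negbTE nne)/=.
  rewrite oppr_eq0 !mulf_eq0 (gt_eqF (beta0 _))/=.
  by rewrite /sgnb; case: ifP => _; rewrite ?oppr_eq0 oner_eq0 => /eqP.
have := @derive0_constant R (fun t => y t i0) (cy i0); move=> /(_ _)/wrap[].
  move=> t t01; have [dy _ _ _] := hg t t01; rewrite -(u0 t i0 t01); exact: dy.
move=> /(_ 1); rewrite lexx ler01 => /(_ isT) E.
by case/eqP: ne; rewrite E.
Qed.

(** An infinite set counts as [+oo], so cardinals are compared in the finite case only. *)
Lemma counting_ge {R : realType} (T : choiceType) (Y : set T) (K : nat) (f : nat -> T) :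
  (forall k, (k < K)%N -> Y (f k)) ->
  (forall k l, (k < K)%N -> (l < K)%N -> f k = f l -> k = l) ->
  (K%:R%:E <= counting Y :> \bar R)%E.
Proof.
move=> fY finj; rewrite /counting; case: ifPn => [/asboolP finY|_]; last by rewrite leey.
rewrite lee_fin ler_nat; apply: leq_card_fset_set => //.
apply: (@card_le_trans _ _ _ (f @` `I_K)); last by apply: subset_card_le => _ [k kK <-]; exact: fY.
have cI : (f @` `I_K #= `I_K)%card by apply: inj_card_eq => k l; rewrite !inE; exact: finj.
by rewrite (card_le_eqr cI) card_lexx.
Qed.

Lemma limf_einf_ge {R : realType} (f : R -> \bar R) (x : \bar R) :
  (\forall e \near (0 : R)^'+, (x <= f e)%E) -> (x <= limf_einf f (0 : R)^'+)%E.
Proof.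
move=> h; rewrite limf_einfE; apply: ereal_sup_ge.
exists (ereal_inf (f @` [set e | (x <= f e)%E])); first by exists [set e | (x <= f e)%E].
by apply: le_ereal_inf_tmp => _ [e he <-].
Qed.

Section geodesic_family.
Context {R : realType} {n : nat} {M : topologicalType}.
Local Notation N := (n + n + 1)%N.
Context {A : connected_manifold R N M} (S : contact_subriemannian A) (q : M) (c : chart R N M).
Hypothesis cD : darboux_chart S q c.
Context {d : nat} (e : 'I_d * bool -> 'rV[R]_(n + n)) (beta : 'I_d -> R).
Hypothesis beta0 : forall j, 0 < beta j.
Hypothesis eon : forall i k, mform (metric0 S c) (e i) (e k) = (i == k)%:R.
Hypothesis eW : forall i k, mform (Jmx R n) (e i) (e k) = planeW beta i k.
Hypothesis espan : forall x, x = \sum_i mform (metric0 S c) x (e i) *: e i.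
Local Notation I := ('I_d * bool)%type.
Local Notation yco := (ycoord S c e).

Variables (rho L : R).
Hypothesis (rho0 : 0 < rho) (L0 : 0 <= L).
Hypothesis regG : regular_metric (Gf S c e) (Df S c e) (Dzf S c e) rho L.
Hypothesis boxI : forall y z, inbox rho y z -> chart_img c (emb e y z).

(** The multiplier at time [0] is kept as a label, which tells apart geodesics with the same
    endpoints. *)
Definition normalized_geodesic (y : R -> I -> R) (z : R -> R) (m : R) :=
  exists u nu, [/\ geodesic_eqs (planeW beta) (Gf S c e) (Df S c e) (Dzf S c e) y z u nu,
    forall t, inbox (rho / 2) (y t) (z t), forall i, y 0 i = 0, z 0 = 0 & nu 0 = m].

Lemma dilation_emb (ep : R) (p : 'rV[R]_N) :
  emb e (fun i => ep * yco p i) (ep ^+ 2 * zcoord p) = dilation ep p.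
Proof.
rewrite /dilation -[X in row_mx _ (_ *: X)](_ : (zcoord p)%:M = _); last by rewrite /zcoord -mx11_scalar.
rewrite scale_scalar_mx /emb /vecxz; congr (row_mx _ _).
by rewrite [in RHS](espan (xcoord p)) scaler_sumr; apply: eq_bigr => i _; rewrite scalerA.
Qed.

Lemma normalized_geodesic_joining y z m (p : 'rV[R]_N) i0 : normalized_geodesic y z m ->
  y 1 i0 != 0 -> emb e (y 1) (z 1) = p ->
  geodesics_joining S (chart_dom c) q (chart_inv c p) (frame_curve c e y z).
Proof.
move=> [u [nu [geod box y0 z0 _]]] y1 pE.
have map := frame_curve_map rho0 boxI box.
have [_ dq q0 _] := cD.
have c0 : clamp01 (0 : R) = 0 by apply: clamp01_id; rewrite lexx ler01.
have c1 : clamp01 (1 : R) = 1 by apply: clamp01_id; rewrite lexx ler01.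
have g1 : frame_curve c e y z 1 = chart_inv c p by rewrite /frame_curve c1 pE.
split=> //.
- split.
  + exact: (frame_curve_horizontal cD eW rho0 boxI geod box).
  + exists 0, 1; rewrite !lexx ler01; split=> // E.
    have := congr1 (fun m => yco (chart_map c m) i0) E.
    rewrite !(map _).1 c0 c1 !(ycoord_emb eon) y0 => /eqP.
    by rewrite eq_sym (negbTE y1).
  + exact: (frame_curve_minimizing cD eon eW espan rho0 L0 regG boxI geod box).
- rewrite /frame_curve c0 z0 (_ : y 0 = fun=> 0); last by apply/funext.
  by rewrite emb0 -q0 chart_mapK.
- by move=> t _; exact: (map t).2.
move=> t; rewrite -/(clampr 0 1 t) -/(clamp01 t) /frame_curve.
by rewrite [clamp01 (clamp01 t)]clamp01_id//; exact: clamp01_itv.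
Qed.

Lemma normalized_geodesic_inj y z m y' z' m' i0 : y 1 i0 != 0 ->
  normalized_geodesic y z m -> normalized_geodesic y' z' m' ->
  frame_curve c e y z = frame_curve c e y' z' -> m = m'.
Proof.
move=> y1 [u [nu [geod box y0 z0 <-]]] [u' [nu' [geod' box' y0' z0' <-]]] E.
apply: (geodesic_eqs_multiplier (i0 := i0) beta0 geod geod'); last by rewrite y0 eq_sym.
move=> t t01; have := congr1 (fun g => chart_map c (g t)) E.
rewrite (frame_curve_map rho0 boxI box t).1 (frame_curve_map rho0 boxI box' t).1 clamp01_id// => Et.
split; last by have := congr1 (@zcoord R n) Et; rewrite !zcoord_emb.
by apply/funext => i; have := congr1 (fun p => yco p i) Et; rewrite !(ycoord_emb eon).
Qed.

End geodesic_family.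

(** The count uses the norm of the metric at [q], the theorem the Euclidean norm of the
    coordinates. *)
Lemma mform_le_sqnorm {R : realType} m (g : 'M[R]_m) :
  exists2 C : R, 0 < C & forall x, mform g x x <= C * sqnorm x.
Proof.
pose C := \sum_i \sum_j `|g i j| + 1.
have C0 : 0 <= \sum_i \sum_j `|g i j| by apply: sumr_ge0 => i _; apply: sumr_ge0.
exists C; first by rewrite ltr_wpDl.
move=> x; have sE : sqnorm x = \sum_i x 0 i ^+ 2.
  by rewrite /sqnorm /dotv mxE; apply: eq_bigr => i _; rewrite mxE expr2.
have s0 : 0 <= sqnorm x by rewrite sE; apply: sumr_ge0 => i _; exact: sqr_ge0.
have le i : x 0 i ^+ 2 <= sqnorm x.
  by rewrite sE (bigD1 i)//= lerDl; apply: sumr_ge0 => j _; exact: sqr_ge0.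
apply: (@le_trans _ _ ((\sum_i \sum_j `|g i j|) * sqnorm x)); last by rewrite ler_wpM2r// lerDl.
rewrite /mform /bil mulr_suml; apply: ler_sum => i _; rewrite mulr_suml; apply: ler_sum => j _.
rewrite (le_trans (ler_norm _))// -mulrA normrM ler_wpM2l// ler_norml.
have := le i; have := le j; have := sqr_ge0 (x 0 i - x 0 j); have := sqr_ge0 (x 0 i + x 0 j).
by move: (x 0 i) (x 0 j) (sqnorm x) => a b s; rewrite !expr2 => *; apply/andP; split; lra.
Qed.

Lemma ratio_bound {R : realType} (C1 Cg s s' z : R) : 0 < C1 -> 0 < Cg -> 0 < s -> s <= Cg * s' ->
  0 <= z -> (C1 * Cg)^-1 * (z / s') <= z / (C1 * s).
Proof.
move=> C10 Cg0 s0 ss z0; have s'0 : 0 < s' by rewrite -(pmulr_rgt0 _ Cg0) (lt_le_trans s0).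
rewrite ler_pdivlMr ?mulr_gt0//.
have -> : (C1 * Cg)^-1 * (z / s') * (C1 * s) = z * (s / (Cg * s')) by field; rewrite !gt_eqF.
by rewrite ler_piMr// ler_pdivrMr ?mulr_gt0// mul1r.
Qed.

Theorem theorem8 (R : realType) (n : nat) (n_gt0 : (0 < n)%N)
    (M : topologicalType) (A : connected_manifold R (n + n + 1) M)
    (S : contact_subriemannian A) (q : M) (c : chart R (n + n + 1) M)
    (c_darboux : darboux_chart S q c) :
  exists C K : R, 0 < C /\
    exists2 Z : set 'rV[R]_(n + n + 1), measure_zero Z &
      forall p, chart_img c p -> ~ Z p ->
        ((C * (`|zcoord p| / sqnorm (xcoord p)) + K)%:E <=
         limf_einf (fun e : R =>
           nu S (chart_dom c) q (chart_inv c (dilation e p))) (0 : R)^'+)%E.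
Proof.
have [d [e [beta [beta0 eon eW espan]]]] := darboux_frame c_darboux.
(* With no plane the frame would span [0] only, against [n_gt0]. *)
have d0 : (0 < d)%N.
  rewrite lt0n; apply/eqP => dE.
  have x0 : (const_mx 1 : 'rV[R]_(n + n)) = 0.
    by rewrite (espan (const_mx 1)) big1// => -[[j jd] b]; exfalso; move: jd; rewrite dE.
  have nn : (0 < n + n)%N by rewrite addn_gt0 n_gt0.
  by move/rowP/(_ (Ordinal nn)) : x0; rewrite !mxE => /eqP; rewrite oner_eq0.
have [rho [L [rho0 L0 regG boxI lipD]]] := metric_box c_darboux d0 eon.
have [j0 bmax] : exists j0, forall j, beta j <= beta j0.
  by case: (@Order.TotalTheory.arg_maxP _ _ 'I_d (Ordinal d0) xpredT beta erefl) => j0 _ h; exists j0 => j; exact: h.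
have [C1 C10 hC1] := signed_model_intervals beta0 bmax.
have [Cg Cg0 hCg] := mform_le_sqnorm (metric0 S c).
pose per : R := 2 * pi / beta j0.
have per0 : 0 < per by rewrite divr_gt0// mulr_gt0// pi_gt0.
(* [C1] is the height per period and per unit of squared length at [q], and [Cg] compares that
   length with the Euclidean one. *)
exists (C1 * Cg)^-1, (- 2); split; first by rewrite invr_gt0 mulr_gt0.
exists [set p | exists j, ycoord S c e p (j, false) = 0].
  (* The successor form of [d] gives access to [inord], which turns the union over the planes into a
     union over [nat], with repetitions. *)
  case: d d0 e beta beta0 eon eW espan {rho L rho0 L0 regG boxI lipD j0 bmax C1 C10 hC1 per per0}
    => // d _ e beta _ eon _ espan.
  pose w i : 'rV[R]_(n + n + 1) := \row_a ycoord S c e 'e_a i.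
  have wE (p : 'rV[R]_(n + n + 1)) i : \sum_a w i 0 a * p 0 a = ycoord S c e p i.
    by rewrite [RHS]ycoord_sum; apply: eq_bigr => a _; rewrite mxE.
  have w0 i : w i != 0.
    apply/eqP => wi; have := wE (emb e (fun k => (k == i)%:R) 0) i.
    rewrite (ycoord_emb eon) eqxx wi big1; last by move=> a _; rewrite mxE mul0r.
    by move/esym/eqP; rewrite oner_eq0.
  apply: measure_zero_sub (measure_zero_bigcup (fun k => measure_zero_hyperplane (w0 (inord k, false)))).
  by move=> p [j hj]; exists (j : nat) => //=; rewrite wE inord_val.
move=> p ip nZ.
pose X := ycoord S c e p; pose zt := zcoord p.
(* Every plane then contributes a positive term, so each of its poles is a pole of the height; the
   endpoint is also kept away from the start. *)
have X0 j : X (j, false) != 0 by apply/eqP => h; apply: nZ; exists j.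
pose Xn j := X (j, false) ^+ 2 + X (j, true) ^+ 2.
have Xn0 j : 0 < Xn j by rewrite ltr_wpDr ?sqr_ge0// exprn_even_gt0//= X0.
pose s := \sum_j Xn j.
have s0 : 0 < s.
  by rewrite /s (bigD1 (Ordinal d0))//= ltr_wpDr// sumr_ge0// => j _; exact: ltW.
have sE : s = mform (metric0 S c) (xcoord p) (xcoord p).
  rewrite {1}(espan (xcoord p)) mform_suml (eq_bigr (fun i => X i ^+ 2)).
    have -> : \sum_i X i ^+ 2 = \sum_(i : 'I_d * bool) X (i.1, i.2) ^+ 2 by apply: eq_bigr => -[].
    rewrite -(pair_bigA _ (fun j b => X (j, b) ^+ 2))/=; apply: eq_bigr => j _.
    by rewrite big_bool/= [RHS]addrC.
  move=> i _; rewrite mformZl expr2; congr (_ * _).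
  rewrite /X /ycoord !(mform_metric0 c_darboux) (hmetric_sym c_darboux)//.
  exact: darboux_img0 c_darboux.
pose r : R := `|zt| / (C1 * s).
have r0 : 0 <= r by rewrite divr_ge0// mulr_ge0// ltW.
(* One below the integer part, so that [k < K] gives the strict inequality [k.+1%:R < r]. This and
   the rounding lose at most [2]. *)
pose K := (Num.truncn r).-1.
have hK k : (k < K)%N -> C1 * k.+1%:R * s < `|zt|.
  move=> kK; have /andP[t1 _] := truncn_itv r0.
  have : k.+1%:R < r.
    by apply: lt_le_trans t1; rewrite ltr_nat; move: kK; rewrite /K; case: (Num.truncn r).
  by rewrite /r ltr_pdivlMr ?mulr_gt0// mulrCA mulrA.
have Kr : r - 2 <= K%:R.
  have /andP[_] := truncn_itv r0; rewrite /K; case: (Num.truncn r) => [|t] /=; first lra.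
  by rewrite -[t.+2%:R]natr1 -[t.+1%:R]natr1; lra.
apply: (@le_trans _ _ K%:R%:E).
  rewrite lee_fin (le_trans _ Kr)// lerD2r; apply: ratio_bound => //.
  by rewrite sE.
apply: limf_einf_ge.
have fam (k : 'I_K) : \forall ep \near (0 : R)^'+, exists yzm : (R -> 'I_d * bool -> R) * (R -> R) * R,
    [/\ normalized_geodesic S c e beta rho yzm.1.1 yzm.1.2 yzm.2,
      per * k%:R < `|yzm.2| < per * k.+1%:R,
      forall i, yzm.1.1 1 i = ep * X i & yzm.1.2 1 = ep ^+ 2 * zt].
  have [lo [hi [lohi nopole sgn mI]]] := hC1 X zt Xn0 k (hK k (ltn_ord k)).
  have [e1 e10 he1] := geodesic_bvp_box rho0 L0 regG lipD (Gf0 c_darboux eon) lohi nopole sgn.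
  near=> ep; have [|m [y [z [u [nu [mI' [geod [[y0 z0 n0 y1 z1] box]]]]]]]] := he1 ep.
    by apply/andP; split; near: ep; [exact: nbhs_right_gt|exact: nbhs_right_le].
  by exists (y, z, m); split=> //=; [exists u, nu|exact: mI].
(* The threshold on [ep] depends on the period; there are finitely many periods, so a common one
   exists. *)
have near_fam := filter_forall (at_right_proper_filter (0 : R)) fam.
near=> ep; have ep0 : 0 < ep by near: ep; exact: nbhs_right_gt.
have /choice[F hF] : forall k : 'I_K, exists yzm : (R -> 'I_d * bool -> R) * (R -> R) * R,
    [/\ normalized_geodesic S c e beta rho yzm.1.1 yzm.1.2 yzm.2,
      per * k%:R < `|yzm.2| < per * k.+1%:R,
      forall i, yzm.1.1 1 i = ep * X i & yzm.1.2 1 = ep ^+ 2 * zt] by near: ep.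
(* The constant curve is a mere default from [K] on. *)
pose f (k : nat) : R -> M :=
  if insub k is Some i then frame_curve c e (F i).1.1 (F i).1.2 else fun=> q.
have fE k (kK : (k < K)%N) : f k = frame_curve c e (F (Ordinal kK)).1.1 (F (Ordinal kK)).1.2.
  by rewrite /f insubT.
have y1 k : (F k).1.1 1 (Ordinal d0, false) != 0.
  by have [_ _ -> _] := hF k; rewrite mulf_neq0// gt_eqF.
apply: (counting_ge (f := f)) => [k kK|k l kK lK].
  rewrite (fE _ kK); have [ng _ yE zE] := hF (Ordinal kK).
  apply: (normalized_geodesic_joining c_darboux eon eW espan rho0 L0 regG boxI ng (y1 _)).
  rewrite zE -(dilation_emb espan); congr (emb e _ _).
  by apply/funext => i; exact: yE.
rewrite (fE _ kK) (fE _ lK).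
have [ng m1 _ _] := hF (Ordinal kK); have [ng' m2 _ _] := hF (Ordinal lK).
move/(normalized_geodesic_inj beta0 eon rho0 boxI (y1 _) ng ng') => mE.
(* The absolute values of the multipliers lie in disjoint open intervals, one for each period. *)
move: m1 m2; rewrite -mE /= => /andP[a1 a2] /andP[b1 b2].
have := lt_trans a1 b2; have := lt_trans b1 a2.
by rewrite !ltr_pM2l// !ltr_nat !ltnS => ? ?; apply/eqP; rewrite eqn_leq; apply/andP.
Unshelve. all: by end_near. Qed.
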